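(* Let $k$ be an algebraically closed field of characteristic $2$. Let $k[[z]]/k[[t]]$ be a $(\mathbb{Z}/2)^3$-cover of type $(4,4,4)$, and let $R[[Z]]/R[[T]]$ be a lift of it to characteristic $0$. Then the only possible branch partition of the Hurwitz tree of this lift is $(1,1,1,1,1,1,1)$; i.e. the lift has $7$ branch points and equidistant geometry.
   Context: Conventions. $R$ is a complete discrete valuation ring that is a finite extension of $W(k)$, with fraction field $K$, uniformizer $\pi$, valuation $v$; $R$ may be replaced by finite extensions whenever necessary. Lift. A lift of a $G$-Galois extension $k[[z]]/k[[t]]$ is a $G$-Galois extension $R[[Z]]/R[[T]]$ (with $T$ reducing to $t$) such that the $G$-action on $R[[Z]]$ reduces modulo $\pi$ to the given one on $k[[z]]$. Branch locus. The branch points of $R[[Z]]/R[[T]]$ are the (horizontal) prime divisors of $\mathrm{Spec}\,R[[T]]$ over which the cover is ramified; $R$ is enlarged so that they are $R$-rational, i.e. given by $T=b$ with $b$ in the maximal ideal of $R$. The set $B$ of these $b$ is the branch locus. Type. A totally ramified $\mathbb{Z}/2$-extension of $k((t))$ given by $w^2-w=f(1/t)$, $f(1/t)\in k[t^{-1}]$ of odd degree $m$, has conductor $m+1$. A $(\mathbb{Z}/2)^3$-cover $k[[z]]/k[[t]]$, $k[[t]]=k[[z]]^G$, $G=(\mathbb{Z}/2)^3$, has type $(m_1+1,m_2+1,m_3+1)$ if $(m_1,m_2,m_3)$ is the lexicographically smallest triple for which there are index-$2$ subgroups $G_1,G_2,G_3$ of $G$ with $k[[z]]^{G_i}/k[[t]]$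 of conductor $m_i+1$ and $k[[z]]^{G_1},k[[z]]^{G_2},k[[z]]^{G_3}$ linearly disjoint over $k[[t]]$. Hurwitz tree and branch partition. The Hurwitz tree is the rooted tree obtained from the dual graph of the special fiber of the semistable model of $\mathbb{P}^1_K$ separating the points of $B\cup\{\infty\}$: a root node $v_0$ is attached to the vertex $v_1$ of the component to which $\infty$ specializes, and for each $b\in B$ a leaf is attached to the vertex of the component to which $b$ specializes. The branches of the tree are the subtrees hanging from the vertices adjacent to $v_1$ other than $v_0$ (on the side away from $v_0$); the size of a branch is its number of leaves. The tree has branch partition $(e_1,\ldots,e_s)$ if it has $s$ branches, of sizes $e_1,\ldots,e_s$. Concretely, if $\mu=\min_{b\ne b'\in B}v(b-b')$, the branches correspond to the classes of the equivalence relation on $B$ given by $b\sim b'$ iff $b=b'$ or $v(b-b')>\mu$, and the sizes are the cardinalities of the classes. The branch locus has equidistant geometry if $v(b-b')$ is the same for all pairs of distinct $b,b'\in B$. *)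

(* Defs.v *)
From HB Require Import structures.
From mathcomp Require Import all_boot all_order all_algebra all_fingroup all_solvable.
From mathcomp Require Import boolp classical_sets cardinality.

Set Implicit Arguments.
Unset Strict Implicit.
Unset Printing Implicit Defensive.

Import GRing.Theory.
Local Open Scope ring_scope.

(* Formal power series in one variable, as coefficient sequences.  The record
   keeps the Cauchy product apart from the pointwise product of functions. *)
Record powser (R : Type) : Type := PowSer { pcoef : nat -> R }.

HB.instance Definition _ (R : Type) := gen_eqMixin (powser R).
HB.instance Definition _ (R : Type) := gen_choiceMixin (powser R).

Lemma powserP (R : Type) (f g : powser R) :
  (forall n, pcoef f n = pcoef g n) -> f = g.
Proof. by case: f g => f [g] /= /funext ->. Qed.

Section PowserRing.
Variable R : comNzRingType.
Implicit Types f g h : powser R.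

Definition ps_zero : powser R := PowSer (fun=> 0).
Definition ps_opp f : powser R := PowSer (fun n => - pcoef f n).
Definition ps_add f g : powser R := PowSer (fun n => pcoef f n + pcoef g n).
Definition ps_mul f g : powser R :=
  PowSer (fun n => \sum_(i < n.+1) pcoef f i * pcoef g (n - i)%N).
Definition powserC (c : R) : powser R :=
  PowSer (fun n => if n == 0%N then c else 0).
Definition powserX : powser R := PowSer (fun n => (n == 1%N)%:R).

Lemma ps_addA : associative ps_add.
Proof. by move=> f g h; apply: powserP => n /=; rewrite addrA. Qed.
Lemma ps_addC : commutative ps_add.
Proof. by move=> f g; apply: powserP => n /=; rewrite addrC. Qed.
Lemma ps_add0 : left_id ps_zero ps_add.
Proof. by move=> f; apply: powserP => n /=; rewrite add0r. Qed.
Lemma ps_addN : left_inverse ps_zero ps_opp ps_add.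
Proof. by move=> f; apply: powserP => n /=; rewrite addNr. Qed.

HB.instance Definition _ :=
  GRing.isZmodule.Build (powser R) ps_addA ps_addC ps_add0 ps_addN.

Definition ps_trunc (m : nat) f : {poly R} := \poly_(i < m) pcoef f i.

Lemma ps_mul_coef m f g (p q : {poly R}) n : (n < m)%N ->
  (forall i, (i < m)%N -> p`_i = pcoef f i) ->
  (forall i, (i < m)%N -> q`_i = pcoef g i) ->
  pcoef (ps_mul f g) n = (p * q)`_n.
Proof.
move=> nm pf qg; rewrite coefM /=; apply: eq_bigr => i _.
rewrite pf ?qg //; first by apply: leq_ltn_trans nm; apply: leq_subr.
by apply: leq_trans nm; rewrite ltnS -ltnS.
Qed.

Lemma coef_trunc m f i : (i < m)%N -> (ps_trunc m f)`_i = pcoef f i.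
Proof. by move=> im; rewrite coef_poly im. Qed.

Lemma ps_mulA : associative ps_mul.
Proof.
move=> f g h; apply: powserP => n.
have nn : (n < n.+1)%N by [].
have t := @coef_trunc n.+1.
rewrite (ps_mul_coef (p := ps_trunc n.+1 f)
   (q := ps_trunc n.+1 g * ps_trunc n.+1 h) nn) //; last first.
- by move=> i im; rewrite (ps_mul_coef im (t g) (t h)).
- exact: t.
rewrite (ps_mul_coef (p := ps_trunc n.+1 f * ps_trunc n.+1 g)
   (q := ps_trunc n.+1 h) nn) ?mulrA //; last exact: t.
by move=> i im; rewrite (ps_mul_coef im (t f) (t g)).
Qed.

Lemma ps_mulC : commutative ps_mul.
Proof.
move=> f g; apply: powserP => n.
have t := @coef_trunc n.+1.
by rewrite (ps_mul_coef (ltnSn n) (t f) (t g)) mulrC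
           -(ps_mul_coef (ltnSn n) (t g) (t f)).
Qed.

Lemma ps_mul1 : left_id (powserC 1) ps_mul.
Proof.
move=> f; apply: powserP => n /=.
rewrite big_ord_recl /= mul1r subn0 big1 ?addr0 // => i _.
by rewrite mul0r.
Qed.

Lemma ps_mulDl : left_distributive ps_mul ps_add.
Proof.
move=> f g h; apply: powserP => n /=; rewrite -big_split /=.
by apply: eq_bigr => i _; rewrite mulrDl.
Qed.

Lemma ps_one_neq0 : powserC 1 != 0.
Proof.
apply/eqP => /(congr1 (fun f => pcoef f 0%N)) /= /eqP.
by rewrite (negPf (oner_neq0 R)).
Qed.

HB.instance Definition _ := GRing.Zmodule_isComNzRing.Build (powser R)
  ps_mulA ps_mulC ps_mul1 ps_mulDl ps_one_neq0.

Definition ps_unit : {pred powser R} := fun f => `[< exists g, g * f = 1 >].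
Definition ps_inv f : powser R :=
  if pselect (exists g, g * f = 1) is left e then projT1 (cid e) else f.

Lemma ps_mulVx : {in ps_unit, left_inverse 1 ps_inv *%R}.
Proof.
move=> f /asboolP fu; rewrite /ps_inv; case: pselect => // e.
exact: (projT2 (cid e)).
Qed.
Lemma ps_unitP f g : g * f = 1 -> ps_unit f.
Proof. by move=> gf; apply/asboolP; exists g. Qed.
Lemma ps_inv_out : {in [predC ps_unit], ps_inv =1 id}.
Proof.
move=> f /negP fu; rewrite /ps_inv; case: pselect => // e.
by case: fu; apply/asboolP.
Qed.

HB.instance Definition _ := GRing.ComNzRing_hasMulInverse.Build (powser R)
  ps_mulVx ps_unitP ps_inv_out.

End PowserRing.

Lemma powser_integral (R : idomainType) (f g : powser R) :
  f * g = 0 -> (f == 0) || (g == 0).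
Proof.
have nz (h : powser R) : h != 0 -> exists i, pcoef h i != 0.
  move=> h0; apply: contrapT => /forallNP hz; case/eqP: h0.
  by apply: powserP => i; apply/eqP/negPn/negP/hz.
move=> fg; apply: contrapT => /negP; rewrite negb_or => /andP[/nz f0 /nz g0].
case: (ex_minnP f0) => i fi imin; case: (ex_minnP g0) => j gj jmin.
have := congr1 (fun h => pcoef h (i + j)%N) fg => /=.
have ij : (i < (i + j).+1)%N by rewrite ltnS leq_addr.
rewrite (bigD1 (Ordinal ij)) //= addKn big1 ?addr0.
  by move/eqP; rewrite mulf_eq0 (negPf fi) (negPf gj).
move=> l; rewrite -val_eqE /= neq_ltn => /orP[li|il].
- have -> : pcoef f l = 0.
    by apply/eqP; apply: contraTT li => /imin; rewrite -leqNgt.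
  by rewrite mul0r.
- have -> : pcoef g (i + j - l)%N = 0; last by rewrite mulr0.
  apply/eqP; apply: contraTT il => /jmin; rewrite -leqNgt => jl.
  have lij : (l <= i + j)%N by rewrite -ltnS.
  by rewrite -(leq_add2r j) -leq_subRL // addnC.
Qed.

HB.instance Definition _ (R : idomainType) :=
  GRing.ComUnitRing_isIntegral.Build (powser R) (@powser_integral R).

Definition map_powser (R S : Type) (f : R -> S) (a : powser R) : powser S :=
  PowSer (fun n => f (pcoef a n)).

(* Complete discrete valuation rings. *)

Definition is_dvr (R : idomainType) (pi : R) : Prop :=
  [/\ pi != 0, pi \isn't a GRing.unit &
      forall x : R, x != 0 ->
        exists (u : R) (n : nat), u \is a GRing.unit /\ x = u * pi ^+ n].

Definition adically_complete (R : comNzRingType) (pi : R) : Prop :=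
  forall x : nat -> R,
    (forall n, exists y, x n.+1 - x n = pi ^+ n * y) ->
    exists l : R, forall n, exists y, l - x n = pi ^+ n * y.

Definition is_complete_dvr (R : idomainType) (pi : R) : Prop :=
  is_dvr pi /\ adically_complete pi.

Definition in_ideal (R : comNzRingType) (pi x : R) : Prop :=
  exists y : R, x = pi * y.

(* The normalised valuation (pi has valuation 1).  Its value at 0 is junk;
   it is only ever applied to differences of distinct elements. *)
Definition dvr_val (R : idomainType) (pi x : R) : nat :=
  xget 0%N [set n : nat | exists u : R, u \is a GRing.unit /\ x = u * pi ^+ n].

Definition is_residue_map (R : idomainType) (k : fieldType) (pi : R)
    (red : {rmorphism R -> k}) : Prop :=
  (forall c : k, exists x : R, red x = c) /\
  (forall x : R, red x = 0 <-> in_ideal pi x).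

(* For k perfect of characteristic p, the ring W(k) of Witt vectors is the
   complete discrete valuation ring with uniformizer p and residue field k,
   which is unique up to unique isomorphism (Serre, Local Fields, II.5-6). *)
Definition is_Witt_ring (p : nat) (k : fieldType) (W : idomainType)
    (redW : {rmorphism W -> k}) : Prop :=
  is_complete_dvr (p%:R : W) /\ is_residue_map p%:R redW.

Definition finite_extension (W R : comNzRingType) (j : {rmorphism W -> R}) :
    Prop :=
  injective j /\
  exists (n : nat) (e : 'I_n -> R),
    forall x : R, exists c : 'I_n -> W, x = \sum_(i < n) j (c i) * e i.

(* R is a complete discrete valuation ring with uniformizer pi, finite over
   W = W(k) and with residue map red extending that of W. *)
Definition is_coefficient_ring (p : nat) (k : fieldType) (W R : idomainType)
    (redW : {rmorphism W -> k}) (j : {rmorphism W -> R}) (pi : R)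
    (red : {rmorphism R -> k}) : Prop :=
  [/\ is_Witt_ring p redW, is_complete_dvr pi, is_residue_map pi red,
      finite_extension j & forall w : W, red (j w) = redW w].

(* Galois extensions of rings of power series. *)

(* The inclusion of A in B is given by iota; since the rings used below are
   integrally closed, this amounts to B being the integral closure of A in a
   Galois extension of Frac A with group gT. *)
Definition is_Galois_extension (gT : finGroupType) (A B : comNzRingType)
    (iota : {rmorphism A -> B}) (rho : gT -> {rmorphism B -> B}) : Prop :=
  [/\ injective iota,
      (forall x, rho 1%g x = x) /\
      (forall g h x, rho (g * h)%g x = rho g (rho h x)),
      (forall g, (forall x, rho g x = x) -> g = 1%g) &
      (forall x, (forall g, rho g x = x) <-> exists a, x = iota a)].

(* S[[Z]]/S[[T]] is a gT-Galois extension; the first series ring is the ring in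
   the variable T and the second one the ring in the variable Z. *)
Definition is_Galois_cover (gT : finGroupType) (S : comNzRingType)
    (iota : {rmorphism powser S -> powser S})
    (rho : gT -> {rmorphism powser S -> powser S}) : Prop :=
  is_Galois_extension iota rho /\
  (forall c : S, iota (powserC c) = powserC c).

Definition is_lift (gT : finGroupType) (R k : comNzRingType)
    (red : {rmorphism R -> k})
    (iotak : {rmorphism powser k -> powser k})
    (rhok : gT -> {rmorphism powser k -> powser k})
    (iota : {rmorphism powser R -> powser R})
    (rho : gT -> {rmorphism powser R -> powser R}) : Prop :=
  [/\ is_Galois_cover iota rho,
      (forall a, map_powser red (iota a) = iotak (map_powser red a)) &
      (forall g x, map_powser red (rho g x) = rhok g (map_powser red x))].

(* The type of a (Z/2)^3-cover. *)

Definition fixed_by (gT : finGroupType) (B : comNzRingType)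
    (rho : gT -> {rmorphism B -> B}) (H : {group gT}) (x : B) : Prop :=
  forall g, g \in H -> rho g x = x.

Definition lin_indep (A B : comNzRingType) (iota : {rmorphism A -> B})
    (I : finType) (x : I -> B) : Prop :=
  forall a : I -> A, \sum_i iota (a i) * x i = 0 -> forall i, a i = 0.

Definition linearly_disjoint3 (A B : comNzRingType) (iota : {rmorphism A -> B})
    (C1 C2 C3 : B -> Prop) : Prop :=
  forall (n1 n2 n3 : nat)
    (x1 : 'I_n1 -> B) (x2 : 'I_n2 -> B) (x3 : 'I_n3 -> B),
    (forall i, C1 (x1 i)) -> (forall i, C2 (x2 i)) -> (forall i, C3 (x3 i)) ->
    lin_indep iota x1 -> lin_indep iota x2 -> lin_indep iota x3 ->
    lin_indep iota (fun i : 'I_n1 * 'I_n2 * 'I_n3 =>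
                      x1 i.1.1 * x2 i.1.2 * x3 i.2).

Section Type2.
Variables (gT : finGroupType) (k : fieldType).
Variables (iota : {rmorphism powser k -> powser k}).
Variables (rho : gT -> {rmorphism powser k -> powser k}).

(* The element w of k((z)) lies in the fraction field of k[[z]]^H. *)
Definition in_fixed_field (H : {group gT}) (w : {fraction powser k}) : Prop :=
  exists x y : powser k,
    [/\ fixed_by rho H x, fixed_by rho H y, y != 0 &
        w = tofrac x / tofrac y].

(* The Z/2-extension k[[z]]^H/k[[t]] has conductor c = m + 1: its fraction
   field is k((t))(w) with w^2 - w = f(1/t) and f of odd degree m. *)
Definition has_conductor (H : {group gT}) (c : nat) : Prop :=
  exists (m : nat) (f : {poly k}) (w : {fraction powser k}),
    [/\ odd m, c = m.+1, size f = m.+1,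
        in_fixed_field H w /\ ~ in_fixed_field [group of [set: gT]] w &
        w ^+ 2 - w =
        \sum_(i < size f)
          tofrac (powserC f`_i) * (tofrac (iota (powserX k)))^-1 ^+ i].

Definition conductor_triple (c1 c2 c3 : nat) : Prop :=
  exists G1 G2 G3 : {group gT},
    [/\ #|[set: gT] : G1|%g = 2 /\ has_conductor G1 c1,
        #|[set: gT] : G2|%g = 2 /\ has_conductor G2 c2,
        #|[set: gT] : G3|%g = 2 /\ has_conductor G3 c3 &
        linearly_disjoint3 iota
          (fixed_by rho G1) (fixed_by rho G2) (fixed_by rho G3)].

Definition lex3_le (c1 c2 c3 d1 d2 d3 : nat) : Prop :=
  (c1 < d1)%N \/
  (c1 = d1 /\ ((c2 < d2)%N \/ (c2 = d2 /\ (c3 <= d3)%N))).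

Definition has_type (c1 c2 c3 : nat) : Prop :=
  conductor_triple c1 c2 c3 /\
  forall d1 d2 d3, conductor_triple d1 d2 d3 -> lex3_le c1 c2 c3 d1 d2 d3.

End Type2.

(* Branch locus. *)

Definition is_prime_ideal (A : comNzRingType) (P : {pred A}) : Prop :=
  idealr_closed P /\ prime_idealr_closed P.

(* Height one primes. *)
Definition is_prime_divisor (A : comNzRingType) (P : {pred A}) : Prop :=
  [/\ is_prime_ideal P, (exists2 x, x \in P & x != 0) &
      forall Q : {pred A}, is_prime_ideal Q -> (exists2 x, x \in Q & x != 0) ->
        {subset Q <= P} -> {subset P <= Q}].

Definition lies_over (A B : comNzRingType) (iota : {rmorphism A -> B})
    (Q : {pred B}) (P : {pred A}) : Prop :=
  forall a, (iota a \in Q) = (a \in P).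

Definition in_extended_ideal (A B : comNzRingType) (iota : {rmorphism A -> B})
    (P : {pred A}) (x : B) : Prop :=
  exists (n : nat) (a : 'I_n -> A) (b : 'I_n -> B),
    (forall i, a i \in P) /\ x = \sum_(i < n) iota (a i) * b i.

(* P B_Q <> Q B_Q.  This is ramification whenever the residue field of P has
   characteristic 0, as is the case for the horizontal divisors below. *)
Definition ramified_at (A B : comNzRingType) (iota : {rmorphism A -> B})
    (P : {pred A}) (Q : {pred B}) : Prop :=
  ~ (forall x, x \in Q ->
       exists s, s \notin Q /\ in_extended_ideal iota P (s * x)).

Definition ramified_over (A B : comNzRingType) (iota : {rmorphism A -> B})
    (P : {pred A}) : Prop :=
  exists Q : {pred B},
    [/\ is_prime_ideal Q, lies_over iota Q P & ramified_at iota P Q].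

Section BranchLocus.
Variables (R : idomainType) (pi : R).
Variable iota : {rmorphism powser R -> powser R}.

(* Branch points, as horizontal prime divisors of Spec R[[T]]. *)
Definition is_branch_divisor (P : {pred powser R}) : Prop :=
  [/\ is_prime_divisor P, powserC pi \notin P & ramified_over iota P].

(* The ideal of R[[T]] generated by T - b. *)
Definition point_ideal (b : R) : {pred powser R} :=
  fun a => `[< in_ideal (powserX R - powserC b) a >].

Definition branch_points_rational : Prop :=
  forall P : {pred powser R}, is_branch_divisor P ->
    exists2 b : R, in_ideal pi b & P =i point_ideal b.

Definition branch_locus : set R :=
  [set b | in_ideal pi b /\ is_branch_divisor (point_ideal b)].

End BranchLocus.

(* Geometry of a finite set of points. *)

Section Geometry.
Variables (R : idomainType) (pi : R).
Local Notation v := (dvr_val pi).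

Definition is_min_distance (B : set R) (mu : nat) : Prop :=
  (exists b b', [/\ B b, B b', b <> b' & v (b - b') = mu]) /\
  (forall b b', B b -> B b' -> b <> b' -> (mu <= v (b - b'))%N).

Definition same_branch (mu : nat) (b b' : R) : Prop :=
  b = b' \/ (mu < v (b - b'))%N.

(* cls lists the classes of same_branch on B, each enumerated without
   repetition; e is the list of their sizes (in any order). *)
Definition branch_partition (B : set R) (e : seq nat) : Prop :=
  exists (mu : nat) (cls : seq (seq R)),
    [/\ is_min_distance B mu,
        uniq (flatten cls) /\ [::] \notin cls,
        (forall b, B b <-> b \in flatten cls),
        (forall c b b', c \in cls -> b \in c -> B b' ->
           (b' \in c <-> same_branch mu b b')) &
        e = map size cls].

Definition equidistant_geometry (B : set R) : Prop :=
  forall b1 b2 b3 b4, B b1 -> B b2 -> B b3 -> B b4 -> b1 <> b2 -> b3 <> b4 ->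
    v (b1 - b2) = v (b3 - b4).

End Geometry.

(* Main.v *)
(** Let [g_a = X_a ^ 2 - t ^ 2 X_a] be the Artin-Schreier equations (cleared of
    denominators) of the seven quadratic subcovers, indexed by the nonzero
    characters [a] in F_2^3; minimality of the type forces all of them to have
    conductor 4, so that [g_a = c_a t + O(t ^ 2)] with [c_a] nonzero.  Norms of
    the parameter [Z] show that the invariants of a subgroup of order 4 in
    R[[Z]] reduce to a dense subset of those in k[[z]], so [X_a] lifts, to high
    order, to an invariant [w] of trace [f] and norm [- h].  Thus the quadratic subcover [a]
    of the lift has the radicand [F = f ^ 2 + 4 h] with [f = t ^ 2 + ...] and
    [h = c_a t + ...] modulo [pi].  It is squarefree of Weierstrass degree 4, so
    each subcover has 4 branch points, and counting characters yields exactly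
    one branch point [beta v] for each nonzero [v], with [beta v] a root of
    [F_a] iff [a . v = 1].

    For the distances, put [T = b + rho X] with [rho] of the minimal valuation.
    Then [f = rho ^ 2 phi], [h = rho eta] and [4 = rho ^ 3 theta], and
    [F / rho ^ 4] reduces to [P_a = phi ^ 2 + theta eta], a constant times the
    product of the [X - x_v] over [a . v = 1], where [x_v] is the residue of
    [(beta v - b) / rho].  The coefficient of [X ^ 3] gives
    [sum_(a . v = 1) x_v = 0].  For [a1 + a2 = a3] the product of the three
    square roots is invariant, which makes
    [(P_1 P_2 P_3 - (phi_1 phi_2 phi_3) ^ 2) / theta] a square modulo [pi]; its
    derivative gives
    [c_1 P_2 P_3 + c_2 P_1 P_3 + c_3 P_1 P_2 = 0].  Comparing multiplicities at
    a point, each class of equal residues is a subspace of F_2^3 without 0, and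
    the vanishing of the sums then allows no class but singletons. *)
Require Import Defs.
From HB Require Import structures.
From mathcomp Require Import all_boot all_order all_algebra all_fingroup all_solvable.
From mathcomp Require Import boolp classical_sets cardinality.
From mathcomp Require Import ring zify.
Import GRing.Theory.
Local Open Scope ring_scope.
Set Implicit Arguments.
Unset Strict Implicit.
Unset Printing Implicit Defensive.

(** * Power series *)

(** Modulo [pi] the radicand F is the square f ^ 2, so its reduction forgets the quadratic cover;
    what survives is h, visible only after division by 4. Each subcover is therefore carried as an
    element w of trace f and norm - h, and the square root 2 w - f of F enters only through
    products. The nonzero linear coefficient of h is used three times: it makes F squarefree, it
    makes h / (T - b) a unit at a root b, so that 4 is divisible by rho ^ 3, and it supplies the
    nonzero constants c_i of the relation between the P_i. Before rescaling, w is shifted by a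
    constant so that f and h both vanish at one root of F. Then h is divisible by rho after the
    substitution, and F = rho ^ 4 P forces rho ^ 2 to divide f. The residue of theta may be 0, so
    the division by theta is carried out formally. *)

Section PowserBasics.
Variable S : comNzRingType.
Implicit Types f g h : powser S.

Lemma pcoefD f g n : pcoef (f + g) n = pcoef f n + pcoef g n. Proof. by []. Qed.
Lemma pcoefN f n : pcoef (- f) n = - pcoef f n. Proof. by []. Qed.
Lemma pcoefB f g n : pcoef (f - g) n = pcoef f n - pcoef g n. Proof. by []. Qed.
Lemma pcoef0 n : pcoef (0 : powser S) n = 0. Proof. by []. Qed.
Lemma pcoef1 n : pcoef (1 : powser S) n = (n == 0%N)%:R.
Proof. by rewrite /=; case: eqP. Qed.
Lemma pcoefM f g n :
  pcoef (f * g) n = \sum_(i < n.+1) pcoef f i * pcoef g (n - i)%N.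
Proof. by []. Qed.
Lemma pcoef_sum I (r : seq I) (P : pred I) (F : I -> powser S) n :
  pcoef (\sum_(i <- r | P i) F i) n = \sum_(i <- r | P i) pcoef (F i) n.
Proof. exact: (big_morph (fun f => pcoef f n) (fun f g => pcoefD f g n) (pcoef0 n)). Qed.

Lemma pcoefMC c f n : pcoef (powserC c * f) n = c * pcoef f n.
Proof.
rewrite pcoefM big_ord_recl /= subn0 big1 ?addr0 // => i _.
by rewrite mul0r.
Qed.

Lemma powserCB : {morph @powserC S : a b / a - b}.
Proof. by move=> a b; apply: powserP => -[|n] //=; rewrite subr0. Qed.
Lemma powserC_monoid : monoid_morphism (@powserC S).
Proof.
split=> // a b; apply: powserP => n.
by rewrite pcoefMC /=; case: eqP; rewrite ?mulr0.
Qed.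
HB.instance Definition _ :=
  GRing.isZmodMorphism.Build S (powser S) (@powserC S) powserCB.
HB.instance Definition _ :=
  GRing.isMonoidMorphism.Build S (powser S) (@powserC S) powserC_monoid.

Lemma pcoefC (c : S) n : pcoef (powserC c) n = if n == 0%N then c else 0.
Proof. by []. Qed.

Lemma powserC_inj : injective (@powserC S).
Proof. by move=> a b /(congr1 (fun f => pcoef f 0%N)). Qed.

Lemma pcoefM0 f g : pcoef (f * g) 0%N = pcoef f 0%N * pcoef g 0%N.
Proof. by rewrite pcoefM big_ord_recl big_ord0 addr0. Qed.
Lemma pcoefXM f n : pcoef (powserX S * f) n = if n is m.+1 then pcoef f m else 0.
Proof.
case: n => [|n]; first by rewrite pcoefM0 /= mul0r.
rewrite pcoefM 2!big_ord_recl /= mul0r add0r mul1r big1 ?addr0 ?subSS ?subn0 //.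
by move=> i _; rewrite mul0r.
Qed.

Lemma pcoefXnM m f n :
  pcoef (powserX S ^+ m * f) n = if (m <= n)%N then pcoef f (n - m) else 0.
Proof.
elim: m n => [|m IH] n; first by rewrite expr0 mul1r subn0.
by rewrite exprS -mulrA pcoefXM; case: n => [|n] //; rewrite IH ltnS subSS.
Qed.

Lemma powserX_dvd n f :
  (forall i, (i < n)%N -> pcoef f i = 0) -> exists g, f = powserX S ^+ n * g.
Proof.
move=> f0; exists (PowSer (fun i => pcoef f (n + i)%N)); apply: powserP => i.
rewrite pcoefXnM /=; case: leqP => [ni|/f0//].
by rewrite subnKC.
Qed.

Lemma powserX_dvdP n f g : f = powserX S ^+ n * g ->
  forall i, (i < n)%N -> pcoef f i = 0.
Proof. by move=> -> i i_n; rewrite pcoefXnM leqNgt i_n. Qed.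

Lemma pcoefXn m n : pcoef (powserX S ^+ m) n = (n == m)%:R.
Proof.
rewrite -[_ ^+ m]mulr1 pcoefXnM pcoef1 subn_eq0 eqn_leq andbC.
by case: leqP.
Qed.

(* The geometric series in [1 - u f]. *)
Lemma powser_unit_exists f u : u * pcoef f 0%N = 1 -> exists g, g * f = 1.
Proof.
move=> uf; pose e := 1 - powserC u * f.
have e0 : pcoef e 0%N = 0 by rewrite pcoefB pcoef1 pcoefMC uf subrr.
have [e' ee'] : exists e', e = powserX S ^+ 1 * e'.
  by apply: powserX_dvd => -[].
have eX i j : (j < i)%N -> pcoef (e ^+ i) j = 0.
  by move=> ji; rewrite ee' expr1 exprMn pcoefXnM leqNgt ji.
pose s n := \sum_(i < n) e ^+ i.
have sE n m : (n < m)%N -> pcoef (s m) n = pcoef (s n.+1) n.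
  elim: m => // m IH; rewrite ltnS leq_eqVlt => /orP[/eqP<- //|nm].
  by rewrite {1}/s big_ord_recr pcoefD -/(s m) IH //= (eX _ _ nm) addr0.
pose v := PowSer (fun n => pcoef (s n.+1) n).
have vE : (1 - e) * v = 1.
  apply: powserP => n.
  have -> : pcoef ((1 - e) * v) n = pcoef ((1 - e) * s n.+1) n.
    rewrite !pcoefM; apply: eq_bigr => i _; congr (_ * _).
    by rewrite [RHS]sE // ltnS leq_subr.
  have -> : (1 - e) * s n.+1 = 1 - e ^+ n.+1.
    by apply: oppr_inj; rewrite -mulNr !opprB -subrX1.
  by rewrite pcoefB eX ?subr0.
exists (v * powserC u); rewrite -mulrA.
have -> : powserC u * f = 1 - e by rewrite /e subKr.
by rewrite mulrC.
Qed.

Definition psderiv f : powser S := PowSer (fun n => pcoef f n.+1 *+ n.+1).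

Lemma psderivD f g : psderiv (f + g) = psderiv f + psderiv g.
Proof. by apply: powserP => n /=; rewrite mulrnDl. Qed.

Lemma psderivM f g : psderiv (f * g) = psderiv f * g + f * psderiv g.
Proof.
apply: powserP => n.
have t := @coef_trunc S n.+2.
have t' h i : (i < n.+1)%N -> (ps_trunc n.+2 h)^`()`_i = pcoef (psderiv h) i.
  by move=> i_n; rewrite coef_deriv t.
have t1 h i : (i < n.+1)%N -> (ps_trunc n.+2 h)`_i = pcoef h i.
  by move=> i_n; apply: t; apply: ltnW.
have -> : pcoef (psderiv (f * g)) n = pcoef (f * g) n.+1 *+ n.+1 by [].
have -> : pcoef (f * g) n.+1 = _ := ps_mul_coef (ltnSn n.+1) (t f) (t g).
rewrite -coef_deriv derivM coefD pcoefD; congr (_ + _); apply: esym.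
  exact: (ps_mul_coef (ltnSn n) (t' f) (t1 g)).
exact: (ps_mul_coef (ltnSn n) (t1 f) (t' g)).
Qed.

Lemma psderivMn f n : psderiv (f *+ n) = psderiv f *+ n.
Proof.
elim: n => [|n IH]; last by rewrite !mulrS psderivD IH.
by apply: powserP => n /=; rewrite mul0rn.
Qed.

Lemma psderivC (c : S) : psderiv (powserC c) = 0.
Proof. by apply: powserP => n /=; rewrite mul0rn. Qed.

Lemma psderivX : psderiv (powserX S) = 1.
Proof. by apply: powserP => -[|n]; rewrite pcoef1 //= mul0rn. Qed.

End PowserBasics.

Lemma map_powserB (R S : comNzRingType) (f : {rmorphism R -> S}) :
  {morph map_powser f : a b / a - b}.
Proof. by move=> a b; apply: powserP => n /=; rewrite rmorphB. Qed.
Lemma map_powser_monoid (R S : comNzRingType) (f : {rmorphism R -> S}) :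
  monoid_morphism (map_powser f).
Proof.
split=> [|a b]; apply: powserP => n /=.
  by case: eqP => _; rewrite ?rmorph0 ?rmorph1.
by rewrite rmorph_sum; apply: eq_bigr => i _; rewrite rmorphM.
Qed.
HB.instance Definition _ (R S : comNzRingType) (f : {rmorphism R -> S}) :=
  GRing.isZmodMorphism.Build (powser R) (powser S) (map_powser f)
    (map_powserB f).
HB.instance Definition _ (R S : comNzRingType) (f : {rmorphism R -> S}) :=
  GRing.isMonoidMorphism.Build (powser R) (powser S) (map_powser f)
    (map_powser_monoid f).

Lemma map_powserC (R S : comNzRingType) (f : {rmorphism R -> S}) c :
  map_powser f (powserC c) = powserC (f c).
Proof. by apply: powserP => n /=; case: eqP; rewrite ?rmorph0. Qed.
Lemma map_powserX (R S : comNzRingType) (f : {rmorphism R -> S}) :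
  map_powser f (powserX R) = powserX S.
Proof. by apply: powserP => n /=; rewrite rmorph_nat. Qed.

Lemma powser_unit (R : idomainType) (f : powser R) :
  (f \is a GRing.unit) = (pcoef f 0%N \is a GRing.unit).
Proof.
apply/idP/idP => [fu|fu].
  by apply/unitrPr; exists (pcoef f^-1 0%N); rewrite -pcoefM0 divrr.
apply/unitrPr; have [g gf] := powser_unit_exists (mulVr fu).
by exists g; rewrite mulrC.
Qed.

Lemma powserX_neq0 (R : idomainType) : powserX R != 0.
Proof.
by apply/eqP => /(congr1 (fun f => pcoef f 1%N)) /eqP; rewrite /= oner_eq0.
Qed.

Lemma powser_factor (k : fieldType) (f : powser k) : f != 0 ->
  exists n g, f = powserX k ^+ n * g /\ g \is a GRing.unit.
Proof.
move=> f0; have nz : exists i, pcoef f i != 0.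
  apply: contrapT => /forallNP hz; case/eqP: f0.
  by apply: powserP => i; apply/eqP/negPn/negP/hz.
case: (ex_minnP nz) => n fn nmin.
have [|g fg] := @powserX_dvd _ n f.
  by move=> i; apply: contraTeq; rewrite -leqNgt; apply: nmin.
exists n, g; split=> //; rewrite powser_unit unitfE.
by move: fn; rewrite fg pcoefXnM leqnn subnn.
Qed.

(** * Orders of power series fixed by involutions *)

Section Order.
Variable S : comNzRingType.
Implicit Types f g h : powser S.

Definition ps_ge n f := forall i, (i < n)%N -> pcoef f i = 0.

Lemma ps_geP n f : ps_ge n f <-> exists g, f = powserX S ^+ n * g.
Proof. by split=> [/powserX_dvd|[g] /powserX_dvdP]. Qed.

Lemma ps_ge_X n g : ps_ge n (powserX S ^+ n * g).
Proof. by apply/ps_geP; exists g. Qed.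

Lemma ps_ge_leq m n f : (m <= n)%N -> ps_ge n f -> ps_ge m f.
Proof. by move=> mn fn i im; apply: fn; apply: leq_trans mn. Qed.

Lemma ps_geD n f g : ps_ge n f -> ps_ge n g -> ps_ge n (f + g).
Proof. by move=> fn gn i i_n; rewrite pcoefD fn ?gn ?addr0. Qed.

Lemma ps_geN n f : ps_ge n f -> ps_ge n (- f).
Proof. by move=> fn i i_n; rewrite pcoefN fn ?oppr0. Qed.

Lemma ps_geB n f g : ps_ge n f -> ps_ge n g -> ps_ge n (f - g).
Proof. by move=> fn gn; apply: ps_geD => //; apply: ps_geN. Qed.

Lemma ps_geM m n f g : ps_ge m f -> ps_ge n g -> ps_ge (m + n) (f * g).
Proof.
move=> /ps_geP[f' ->] /ps_geP[g' ->]; apply/ps_geP; exists (f' * g').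
by rewrite mulrACA exprD.
Qed.

Lemma ps_geMr m f g : ps_ge m f -> ps_ge m (f * g).
Proof. by move=> fm; rewrite -[m]addn0; apply: ps_geM. Qed.

Lemma ps_geMl m f g : ps_ge m f -> ps_ge m (g * f).
Proof. by move=> fm; rewrite mulrC; apply: ps_geMr. Qed.

Lemma ps_geX n f m : ps_ge n f -> ps_ge (n * m) (f ^+ m).
Proof.
by move=> fn; elim: m => [|m IH]; rewrite ?muln0 // exprS mulnS; apply: ps_geM.
Qed.

Lemma ps_ge_eq0 f : (forall n, ps_ge n f) -> f = 0.
Proof. by move=> fn; apply: powserP => n; rewrite (fn n.+1). Qed.

Lemma ps_geS n f : ps_ge n f -> pcoef f n = 0 -> ps_ge n.+1 f.
Proof.
by move=> fn f0 i; rewrite ltnS leq_eqVlt => /orP[/eqP-> //|/fn].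
Qed.

End Order.

(** Successive approximation: when every leading term occurring in P can be matched in Q, n
    corrections give accuracy n. Only finite precision is claimed, so Q need not be complete. *)
Lemma ps_approx (S : comNzRingType) (P Q : powser S -> Prop) :
  (forall x y, P x -> Q y -> P (x - y)) ->
  (forall x y, Q x -> Q y -> Q (x + y)) -> Q 0 ->
  (forall n x, P x -> ps_ge n x -> exists y, Q y /\ ps_ge n.+1 (x - y)) ->
  forall n x, P x -> exists y, Q y /\ ps_ge n (x - y).
Proof.
move=> PB QD Q0 step; elim=> [|n IH] x Px; first by exists 0; split.
have [y [Qy xy]] := IH x Px.
have [y' [Qy' xy']] := step n (x - y) (PB _ _ Px Qy) xy.
exists (y + y'); split; first exact: QD.
by rewrite opprD addrA.
Qed.

Section FieldOrder.
Variable k : fieldType.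
Implicit Types f g h x y : powser k.
Local Notation X := (powserX k).

Lemma ps_ge_unit m n u : u \is a GRing.unit -> ps_ge m (X ^+ n * u) -> (m <= n)%N.
Proof.
rewrite powser_unit unitfE => u0 mn; rewrite leqNgt; apply/negP => /mn.
by rewrite pcoefXnM leqnn subnn => /eqP; apply/negP.
Qed.

Lemma ps_ge1 f : f \isn't a GRing.unit -> ps_ge 1 f.
Proof. by rewrite powser_unit unitfE negbK => /eqP f0 []. Qed.

Lemma ps_ge_nonunit f : ps_ge 1 f -> f \isn't a GRing.unit.
Proof. by move=> /(_ 0%N isT) f0; rewrite powser_unit f0 unitr0. Qed.

Lemma ps_kill n f u y : f = X ^+ n * u -> u \is a GRing.unit -> ps_ge n y ->
  ps_ge n.+1 (y - powserC (pcoef y n / pcoef u 0%N) * f).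
Proof.
move=> -> + yn; rewrite powser_unit unitfE => u0.
apply: ps_geS; first by apply: ps_geB => //; apply: ps_geMl; apply: ps_ge_X.
by rewrite pcoefB pcoefMC pcoefXnM leqnn subnn divfK // subrr.
Qed.

Section Automorphism.
Variables sigma tau : {rmorphism powser k -> powser k}.
Hypothesis sigmaK : forall x, tau (sigma x) = x.
Hypothesis tauK : forall x, sigma (tau x) = x.

Lemma aut_ge n f : ps_ge n f -> ps_ge n (sigma f).
Proof.
have s1 : ps_ge 1 (sigma X).
  apply: ps_ge1; apply/negP => /(rmorph_unit tau); rewrite sigmaK.
  by apply/negP; apply: ps_ge_nonunit; rewrite -[X]mulr1 -[X]expr1; apply: ps_ge_X.
move=> /ps_geP[g ->]; rewrite rmorphM rmorphXn; apply: ps_geMr.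
by rewrite -[n in ps_ge n]mul1n; apply: ps_geX.
Qed.
End Automorphism.

Section Involution.
Variable sigma : {rmorphism powser k -> powser k}.
Hypothesis sigmaK : forall x, sigma (sigma x) = x.
Hypothesis sigmaC : forall c, sigma (powserC c) = powserC c.

Lemma inv_ge n f : ps_ge n f -> ps_ge n (sigma f).
Proof. exact: (aut_ge sigmaK). Qed.

Lemma inv_X : exists u, u \is a GRing.unit /\ sigma X = X * u.
Proof.
have X1 : ps_ge 1 X by rewrite -[X]mulr1 -[X]expr1; apply: ps_ge_X.
have sX0 : sigma X != 0.
  apply/eqP => /(congr1 sigma); rewrite sigmaK rmorph0.
  by apply/eqP/powserX_neq0.
have [[|[|n]] [u [E uu]]] := powser_factor sX0.
- have := inv_ge X1; rewrite E expr0 mul1r => /ps_ge_nonunit.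
  by rewrite uu.
- by exists u; rewrite E expr1.
- have /inv_ge : ps_ge 2 (sigma X) by rewrite E !exprS mulrA -expr2 -mulrA; apply: ps_ge_X.
  by rewrite sigmaK -[X]mulr1 -[X]expr1 => /(ps_ge_unit (unitr1 _)).
Qed.

Lemma inv_unit_order n u : u \is a GRing.unit ->
  exists2 v, v \is a GRing.unit & sigma (X ^+ n * u) = X ^+ n * v.
Proof.
have [w [wu E]] := inv_X => uu; exists (w ^+ n * sigma u).
  by rewrite unitrM unitrX ?rmorph_unit.
by rewrite rmorphM rmorphXn E exprMn mulrA.
Qed.

Lemma fixed_cancel x y : x != 0 -> sigma x = x -> sigma (x * y) = x * y ->
  sigma y = y.
Proof. by move=> x0 sx; rewrite rmorphM sx => /(mulfI x0). Qed.

(** Every series is approximated to any order by sums of constants times powers of [p], all fixed by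
    [sigma], and [sigma] preserves orders. *)
Lemma fixed_uniformizer_trivial p u : p = X * u -> u \is a GRing.unit ->
  sigma p = p -> forall y, sigma y = y.
Proof.
move=> E uu sp y; apply/eqP; rewrite -subr_eq0; apply/eqP/ps_ge_eq0 => n.
have [||||z [sz yz]] := @ps_approx _ xpredT (fun z => sigma z = z) _ _ _ _ n y isT.
- by [].
- by move=> a b sa sb; rewrite rmorphD sa sb.
- by rewrite rmorph0.
- move=> m x _ xm.
  have pm : p ^+ m = X ^+ m * u ^+ m by rewrite E exprMn.
  exists (powserC (pcoef x m / pcoef (u ^+ m) 0%N) * p ^+ m).
  split; first by rewrite rmorphM rmorphXn sp sigmaC.
  by apply: ps_kill => //; rewrite unitrX.
have -> : sigma y - y = sigma (y - z) - (y - z) by rewrite rmorphB sz; ring.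
by apply: ps_geB => //; apply: inv_ge.
Qed.

(** The norm [X * sigma X] has order 2; dividing an invariant of odd order by a power of it would
    leave an invariant uniformizer. *)
Lemma fixed_order_even n u : (exists y, sigma y != y) ->
  u \is a GRing.unit -> sigma (X ^+ n * u) = X ^+ n * u -> ~~ odd n.
Proof.
move=> [y sy] uu sx; apply/negP => n_odd; case/eqP: sy.
have [w [wu sX]] := inv_X.
pose q := n./2; pose N := X * sigma X; pose p := X * (u * (w ^+ q)^-1).
have wq : w ^+ q \is a GRing.unit by rewrite unitrX.
have NE : N = X ^+ 2 * w by rewrite /N sX mulrA expr2.
have E : X ^+ n * u = N ^+ q * p.
  rewrite NE exprMn -exprM /p -[n in LHS]odd_double_half n_odd -muln2 mulnC exprD expr1.
  have -> : X ^+ (2 * q) * w ^+ q * (X * (u / w ^+ q)) =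
    X * X ^+ (2 * q) * u * (w ^+ q / w ^+ q) by ring.
  by rewrite divrr // mulr1.
have N0 : N ^+ q != 0.
  rewrite expf_neq0 // NE mulf_neq0 ?expf_neq0 ?powserX_neq0 //.
  by apply: contraTneq wu => ->; rewrite unitr0.
apply: (fixed_uniformizer_trivial (p := p) erefl).
  by rewrite unitrM uu unitrV.
apply: (fixed_cancel N0); last by rewrite -E.
by rewrite rmorphXn /N rmorphM sigmaK mulrC.
Qed.
End Involution.

(** * Orders of the invariants of a Klein four-group *)

Section KleinGroup.
Variables s1 s2 : {rmorphism powser k -> powser k}.
Hypothesis s1K : forall x, s1 (s1 x) = x.
Hypothesis s2K : forall x, s2 (s2 x) = x.
Hypothesis s12 : forall x, s1 (s2 x) = s2 (s1 x).
Hypothesis s1C : forall c, s1 (powserC c) = powserC c.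
Hypothesis s2C : forall c, s2 (powserC c) = powserC c.
Hypothesis s1_nt : exists y, s1 y != y.
Hypothesis s2_nt : exists y, s2 y != y.
Hypothesis s12_nt : exists y, s1 (s2 y) != y.

Lemma klein_norm : exists2 u, u \is a GRing.unit &
  X * s1 X * (s2 X * s1 (s2 X)) = X ^+ 4 * u.
Proof.
have [u [uu E1]] := inv_X s1K; have [v [vu E2]] := inv_X s2K.
have [|w wu] := inv_unit_order s1K 1 (u := v) => //; rewrite expr1 => E3.
exists (u * (v * w)); first by rewrite !unitrM uu vu.
by rewrite E2 E3 E1; ring.
Qed.

(* Otherwise the elements fixed by the group would be dense among those fixed
   by [s1], and [s2] would act trivially on the latter; then [s2 y] would be
   [y] or [s1 y] for every [y]. *)
Lemma klein_order n u :
  u \is a GRing.unit -> s1 (X ^+ n * u) = X ^+ n * u ->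
  s2 (X ^+ n * u) = X ^+ n * u -> (4 %| n)%N.
Proof.
move=> uu f1 f2; have n_even := fixed_order_even s1K s1C s1_nt uu f1.
apply/negPn/negP => n4.
have [q nq] : exists q, n = (4 * q + 2)%N.
  exists (n %/ 4)%N; move: n_even n4; rewrite /dvdn {1 3}(divn_eq n 4).
  have := ltn_pmod n (isT : (0 < 4)%N).
  by case: (n %% 4)%N => [|[|[|[|r]]]] //= _; rewrite mulnC // addnC /= oddM.
have [w wu NE] := klein_norm.
pose N := X * s1 X * (s2 X * s1 (s2 X)).
have N1 : s1 N = N by rewrite /N !rmorphM !s1K; ring.
have N2 : s2 N = N by rewrite /N !rmorphM -!s12 !s2K; ring.
have wq : w ^+ q \is a GRing.unit by rewrite unitrX.
(* An invariant of order 2. Its powers, times constants, match the leading term of anything fixed by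
   [s1], since such orders are even. *)
pose p := X ^+ 2 * (u * (w ^+ q)^-1).
have E : X ^+ n * u = N ^+ q * p.
  rewrite /N NE exprMn -exprM /p nq exprD.
  have -> : X ^+ (4 * q) * w ^+ q * (X ^+ 2 * (u / w ^+ q)) =
    X ^+ (4 * q) * X ^+ 2 * u * (w ^+ q / w ^+ q) by ring.
  by rewrite divrr // mulr1.
have N0 : N ^+ q != 0.
  rewrite expf_neq0 // /N NE mulf_neq0 ?expf_neq0 ?powserX_neq0 //.
  by apply: contraTneq wu => ->; rewrite unitr0.
have p1 : s1 p = p by apply: (fixed_cancel N0); rewrite -?E ?rmorphXn ?N1.
have p2 : s2 p = p by apply: (fixed_cancel N0); rewrite -?E ?rmorphXn ?N2.
have pu : u * (w ^+ q)^-1 \is a GRing.unit by rewrite unitrM uu unitrV.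
have s2_fix y : s1 y = y -> s2 y = y.
  move=> y1; apply/eqP; rewrite -subr_eq0; apply/eqP/ps_ge_eq0 => m.
  have [||||z [[z1 z2] yz]] := @ps_approx _ (fun y => s1 y = y)
    (fun z => s1 z = z /\ s2 z = z) _ _ _ _ m y y1.
  - by move=> a b a1 [b1 _]; rewrite rmorphB a1 b1.
  - by move=> a b [a1 a2] [b1 b2]; rewrite !rmorphD a1 a2 b1 b2.
  - by rewrite !rmorph0.
  - move=> i x x1 xi; have [xi0|xi0] := eqVneq (pcoef x i) 0.
      by exists 0; rewrite !rmorph0 subr0; split=> //; apply: ps_geS.
    have /ps_geP[x' xE] := xi.
    have x'u : x' \is a GRing.unit.
      by rewrite powser_unit unitfE; move: xi0; rewrite xE pcoefXnM leqnn subnn.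
    have i_even : ~~ odd i.
      by apply: (fixed_order_even s1K s1C s1_nt x'u); rewrite -xE.
    have pi : p ^+ i./2 = X ^+ i * (u * (w ^+ q)^-1) ^+ i./2.
      rewrite /p exprMn -exprM; congr (X ^+ _ * _).
      by rewrite -[RHS]odd_double_half (negPf i_even) -muln2 mulnC.
    eexists; split; last by apply: (ps_kill pi); rewrite ?unitrX.
    by split; rewrite rmorphM rmorphXn ?s1C ?s2C ?p1 ?p2.
  have -> : s2 y - y = s2 (y - z) - (y - z) by rewrite rmorphB z2; ring.
  by apply: ps_geB => //; apply: inv_ge.
(* The polynomial with roots [y] and [s1 y] has coefficients fixed by [s1], hence by [s2], so [s2 y]
   is one of its roots. *)
have alt y : (s2 y == y) || (s2 y == s1 y).
  rewrite -(subr_eq0 (s2 y) y) -(subr_eq0 (s2 y) (s1 y)) -mulf_eq0.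
  have a : s2 (y + s1 y) = y + s1 y by apply: s2_fix; rewrite rmorphD s1K addrC.
  have b : s2 (y * s1 y) = y * s1 y by apply: s2_fix; rewrite rmorphM s1K mulrC.
  have -> : (s2 y - y) * (s2 y - s1 y) =
    s2 y * s2 y - s2 y * (y + s1 y) + y * s1 y by ring.
  rewrite -{1}a -b !rmorphD !rmorphM; apply/eqP; ring.
have [y1 n1] := s2_nt; have [y2 n2] := s12_nt.
have e1 : s2 y1 = s1 y1 by have := alt y1; rewrite (negPf n1) => /eqP.
have n2' : s2 y2 != s1 y2.
  by apply: contra n2 => /eqP->; rewrite s1K.
have e2 : s2 y2 = y2 by have := alt y2; rewrite (negPf n2') orbF => /eqP.
(* A group is not the union of two proper subgroups: here the one where [s2] is the identity and the
   one where it agrees with [s1]. *)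
have := alt (y1 + y2); rewrite !rmorphD e2 => /orP[/eqP/addIr/eqP|].
  by apply/negP.
by rewrite e1 => /eqP/addrI/eqP; rewrite -{1}e2; apply/negP.
Qed.
End KleinGroup.
End FieldOrder.

(** * Covers of type (4,4,4) *)

(* The vector space F_2^3: it indexes the Galois group and also its characters,
   through the pairing [dot]. *)
Definition bool3 : finType := (bool * bool * bool)%type.
Definition dot (a v : bool3) : bool :=
  [&& a.1.1 & v.1.1] (+) [&& a.1.2 & v.1.2] (+) [&& a.2 & v.2].
Definition badd (u v : bool3) : bool3 :=
  (u.1.1 (+) v.1.1, u.1.2 (+) v.1.2, u.2 (+) v.2).
Definition bzero : bool3 := (false, false, false).
Definition all_bool3 : seq bool3 :=
  [:: (false, false, false); (false, false, true); (false, true, false);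
      (false, true, true); (true, false, false); (true, false, true);
      (true, true, false); (true, true, true)].

Lemma mem_all_bool3 v : v \in all_bool3.
Proof. by case: v => [[[] []] []]. Qed.

Lemma dotDr a u v : dot a (badd u v) = dot a u (+) dot a v.
Proof. by case: a u v => [[[] []] []] [[[] []] []] [[[] []] []]. Qed.
Lemma dotDl a b v : dot (badd a b) v = dot a v (+) dot b v.
Proof. by case: a b v => [[[] []] []] [[[] []] []] [[[] []] []]. Qed.
Lemma dot0 a : dot a bzero = false.
Proof. by case: a => [[[] []] []]. Qed.
Lemma baddC u v : badd u v = badd v u.
Proof. by case: u v => [[[] []] []] [[[] []] []]. Qed.
Lemma baddA u v w : badd u (badd v w) = badd (badd u v) w.
Proof. by case: u v w => [[[] []] []] [[[] []] []] [[[] []] []]. Qed.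
Lemma baddvv u : badd u u = bzero.
Proof. by case: u => [[[] []] []]. Qed.
Lemma badd0l u : badd bzero u = u.
Proof. by case: u => [[[] []] []]. Qed.

Lemma dot_exists a : a != bzero -> exists v, dot a v.
Proof.
by case: a => [[[] []] []] // _; [exists (true, false, false)..
  | exists (false, true, false) | exists (false, true, false)
  | exists (false, false, true)].
Qed.

Fixpoint bitseqs n : seq (seq bool) :=
  if n is m.+1 then map (cons true) (bitseqs m) ++ map (cons false) (bitseqs m)
  else [:: [::]].
Lemma mem_bitseqs (l : seq bool) : l \in bitseqs (size l).
Proof.
elim: l => //= b l IH; rewrite mem_cat.
by case: b; rewrite map_f ?orbT.
Qed.

(* To check a property of all subsets of [bool3] by enumeration. *)
Definition set_of_bits (l : seq bool) (v : bool3) :=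
  nth false l (index v all_bool3).
Lemma bool3_set_ind (P : (bool3 -> bool) -> bool) :
  (forall s s', s =1 s' -> P s -> P s') ->
  all (fun l => P (set_of_bits l)) (bitseqs 8) -> forall s, P s.
Proof.
move=> Pext /allP h s.
have := h _ (mem_bitseqs (map s all_bool3)); apply: Pext => v.
by rewrite /set_of_bits (nth_map bzero) ?index_mem ?mem_all_bool3 // nth_index ?mem_all_bool3.
Qed.

(** All 256 subsets are tested by computation: a subspace of F_2^3 contained in no hyperplane is
    everything. *)
Lemma bool3_span (s : bool3 -> bool) :
  s bzero -> (forall u v, s u -> s v -> s (badd u v)) ->
  (forall a, a != bzero -> exists v, s v && dot a v) -> forall v, s v.
Proof.
pose P (s : bool3 -> bool) := [&& s bzero,
  all (fun u => all (fun v => s u ==> s v ==> s (badd u v)) all_bool3) all_bool3 &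
  all (fun a => (a != bzero) ==> has (fun v => s v && dot a v) all_bool3) all_bool3]
  ==> all s all_bool3.
have /(_ s) : forall s, P s.
  apply: bool3_set_ind => [s1 s2 E|]; last by vm_compute.
  rewrite /P !(eq_all E) E; congr ([&& _, _ & _] ==> _); apply: eq_all => u.
    by apply: eq_all => v; rewrite !E.
  by congr (_ ==> _); apply: eq_has => v; rewrite !E.
move=> + s0 sD sa v; move=> /implyP h.
apply: (allP (h _) v (mem_all_bool3 v)); apply/and3P; split=> //.
  apply/allP => u _; apply/allP => w _.
  by apply/implyP => su; apply/implyP => sw; apply: sD.
apply/allP => a _; apply/implyP => /sa[w sw]; apply/hasP; exists w => //.
exact: mem_all_bool3.
Qed.

Lemma perm_all_bool3 : perm_eq (index_enum bool3) all_bool3.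
Proof.
apply: uniq_perm; rewrite ?index_enum_uniq // => v.
by rewrite mem_index_enum mem_all_bool3.
Qed.

Lemma sum_bool3 (N : nmodType) (F : bool3 -> N) :
  \sum_v F v = \sum_(v <- all_bool3) F v.
Proof. exact: perm_big perm_all_bool3. Qed.

Lemma clear_denominators (D : idomainType) (x y t c : D) : y != 0 ->
  (tofrac t ^+ 2 * (tofrac x / tofrac y)) ^+ 2
    - tofrac t ^+ 2 * (tofrac t ^+ 2 * (tofrac x / tofrac y)) = tofrac c ->
  (t ^+ 2 * x) ^+ 2 - t ^+ 2 * (t ^+ 2 * x) * y = c * y ^+ 2.
Proof.
move=> y0 E; apply/eqP; rewrite -tofrac_eq; apply/eqP.
have yF : tofrac y != 0 by rewrite tofrac_eq0.
rewrite tofracB !(tofracM, tofracXn) -E.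
have {1 2}-> : tofrac x = tofrac x / tofrac y * tofrac y by rewrite divfK.
ring.
Qed.

Lemma clear_powers (F : fieldType) (s w : F) (a : nat -> F) : s != 0 ->
  w ^+ 2 - w = \sum_(i < 4) a i * s^-1 ^+ i ->
  (s ^+ 2 * w) ^+ 2 - s ^+ 2 * (s ^+ 2 * w) = \sum_(i < 4) a (3 - i)%N * s ^+ i.+1.
Proof.
move=> s0 E; have -> : (s ^+ 2 * w) ^+ 2 - s ^+ 2 * (s ^+ 2 * w) =
  s ^+ 4 * (w ^+ 2 - w) by ring.
by rewrite E !big_ord_recr !big_ord0 /=; field.
Qed.

Lemma divide_as (F : fieldType) (x t a b : F) : t != 0 ->
  x ^+ 2 - t ^+ 2 * x = a * t ^+ 4 + b * t ^+ 3 ->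
  (x / t ^+ 2) ^+ 2 - x / t ^+ 2 = a * t^-1 ^+ 0 + b * t^-1 ^+ 1.
Proof.
move=> t0 E; have -> : (x / t ^+ 2) ^+ 2 - x / t ^+ 2 =
  (x ^+ 2 - t ^+ 2 * x) / t ^+ 4 by field.
by rewrite E expr0 expr1; field.
Qed.

Lemma add_denominators (D : idomainType) (x t a b : D) : t != 0 ->
  x ^+ 2 - t ^+ 2 * x = a * t ^+ 4 + b * t ^+ 3 ->
  (tofrac x / tofrac (t ^+ 2)) ^+ 2 - tofrac x / tofrac (t ^+ 2) =
  tofrac a * (tofrac t)^-1 ^+ 0 + tofrac b * (tofrac t)^-1 ^+ 1.
Proof.
move=> t0 E; have tF : tofrac t != 0 by rewrite tofrac_eq0.
have EF : tofrac x ^+ 2 - tofrac t ^+ 2 * tofrac x =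
    tofrac a * tofrac t ^+ 4 + tofrac b * tofrac t ^+ 3.
  by rewrite -!tofracXn -!tofracM -tofracB -tofracD E.
rewrite tofracXn; move: (tofrac x) (tofrac t) (tofrac a) (tofrac b) tF EF.
move=> {x t a b t0 E}; exact: divide_as.
Qed.

(** * Artin-Schreier data of the seven quadratic subcovers *)

Section TypeAnalysis.
Variable k : closedFieldType.
Hypothesis char2 : 2%N \in [pchar k].
Variable gT : finGroupType.
Hypothesis abG : (2%N.-abelem [set: gT])%g.
Hypothesis cardG : #|[set: gT]| = 8%N.
Variable iota : {rmorphism powser k -> powser k}.
Variable rho : gT -> {rmorphism powser k -> powser k}.
Hypothesis cover : is_Galois_cover iota rho.
Local Notation T := (powserX k).
Local Notation t := (iota T).
Implicit Types x y X : powser k.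

Lemma powser_char2 : 2%N \in [pchar (powser k)].
Proof.
suff h : prime 2 && ((2%:R : powser k) == 0) by exact: h.
apply/andP; split=> //; apply/eqP; apply: powserP => n.
by rewrite mulr2n pcoefD -mulr2n -mulr_natl (pcharf0 char2) mul0r.
Qed.
Lemma powser_two0 : 2%:R = 0 :> powser k.
Proof. exact: pcharf0 powser_char2. Qed.
Lemma iota_inj : injective iota. Proof. by case: cover => -[]. Qed.
Lemma iotaC c : iota (powserC c) = powserC c. Proof. by case: cover. Qed.
Lemma rhoM g h x : rho (g * h)%g x = rho g (rho h x).
Proof. by case: cover => -[_ []]. Qed.
Lemma rho_iota g a : rho g (iota a) = iota a.
Proof. by case: cover => -[_ _ _ h] _; apply: (proj2 (h (iota a))); exists a. Qed.
Lemma rho_fixed x : (forall g, rho g x = x) -> exists a, x = iota a.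
Proof. by case: cover => -[_ _ _ h] _ /h. Qed.
Lemma t_neq0 : t != 0.
Proof. by rewrite -(rmorph0 iota) (inj_eq iota_inj) powserX_neq0. Qed.

Lemma gcomm (g h : gT) : (g * h = h * g)%g.
Proof. by apply: (centsP (abelem_abelian abG)); rewrite inE. Qed.
Lemma ginv2 (g : gT) : (g * g = 1)%g.
Proof.
have /(abelemP (isT : prime 2))[_ h] := abG.
by have := h g; rewrite inE expgS expg1 => ->.
Qed.

Lemma index2_coset (H : {group gT}) (g h : gT) : #|[set: gT] : H|%g = 2 ->
  g \notin H -> h \notin H -> exists2 u, u \in H & h = (u * g)%g.
Proof.
move=> H2 gH hH; have gD : g \in [set: gT] :\: H by rewrite !inE gH.
have : h \in (H :* g)%g by rewrite (rcoset_index2 (finset.subsetT _) H2 gD) !inE hH.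
by case/rcosetP => u uH ->; exists u.
Qed.

(** The quotient a / y is a root of a monic quadratic over k[[z]], hence integral; a comparison of
    orders shows it directly. *)
Lemma quadratic_integral (s a c y : powser k) : y != 0 ->
  a ^+ 2 - s * a * y = c * y ^+ 2 -> exists X, a = y * X.
Proof.
move=> y0 E; have [->|a0] := eqVneq a 0; first by exists 0; rewrite mulr0.
have [m [v [yE vu]]] := powser_factor y0.
have [n [u [aE uu]]] := powser_factor a0.
case: (leqP m n) => [mn|nm].
  exists (T ^+ (n - m) * (v^-1 * u)).
  by rewrite yE mulrACA -exprD subnKC // mulVKr.
have : ps_ge (n + n).+1 (T ^+ (n + n) * (u * u)).
  have -> : T ^+ (n + n) * (u * u) = s * a * y + c * y ^+ 2.
    by rewrite -E aE exprD; ring.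
  rewrite aE yE; apply: ps_geD.
    rewrite -mulrA; apply: ps_geMl; apply: (@ps_ge_leq _ _ (n + m)).
      by rewrite ltn_add2l.
    by apply: ps_geM; apply: ps_ge_X.
  apply: ps_geMl; rewrite expr2; apply: (@ps_ge_leq _ _ (m + m)).
    by rewrite -addnS leq_add // ltnW.
  by apply: ps_geM; apply: ps_ge_X.
by move/ps_ge_unit; rewrite unitrM uu ltnn => /(_ isT).
Qed.

(* Artin-Schreier data: [X / t ^+ 2] is an Artin-Schreier generator with right
   hand side [e4 + e3 / t + e2 / t ^+ 2 + e1 / t ^+ 3]. *)
Definition as_rhs (e : 'I_4 -> k) : powser k :=
  \sum_(i < 4) powserC (e i) * T ^+ i.+1.
Definition as_data (m : gT -> bool) X (e : 'I_4 -> k) : Prop :=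
  X ^+ 2 - t ^+ 2 * X = iota (as_rhs e) /\
  forall g, rho g X = X + (if m g then t ^+ 2 else 0).

Lemma conductor4_data (H : {group gT}) : #|[set: gT] : H|%g = 2 ->
  has_conductor iota rho H 4 ->
  exists X e, as_data (fun g => g \notin H) X e /\ e ord0 != 0.
Proof.
move=> H2 [m [f [w [m_odd [<-] sf [[x [y [xH yH y0 wE]]] wnot] wAS]]]].
have tF : tofrac t != 0 by rewrite tofrac_eq0 t_neq0.
have yF : tofrac y != 0 by rewrite tofrac_eq0.
(* Multiplication by t ^ 4 moves the coefficient of 1 / t ^ j to t ^ (4 - j). Hence the reversed
   index, which puts the leading coefficient of [f] at [e ord0]. *)
pose e (i : 'I_4) := f`_(3 - i); pose c := as_rhs e.
have cE : (tofrac t ^+ 2 * w) ^+ 2 - tofrac t ^+ 2 * (tofrac t ^+ 2 * w) =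
    tofrac (iota c).
  rewrite sf in wAS; apply: etrans (clear_powers (a := fun i => tofrac (powserC f`_i)) tF wAS) _.
  rewrite /c /as_rhs !rmorph_sum.
  apply: eq_bigr => i _; rewrite -tofracXn -tofracM.
  by rewrite (rmorphM iota) (rmorphXn iota) iotaC.
have Exy : (t ^+ 2 * x) ^+ 2 - t ^+ 2 * (t ^+ 2 * x) * y = iota c * y ^+ 2.
  by apply: clear_denominators => //; rewrite -wE.
have [X XE] := quadratic_integral y0 Exy; exists X, e.
have Xeq : X ^+ 2 - t ^+ 2 * X = iota c.
  apply: (mulfI (expf_neq0 2 y0)); rewrite [RHS]mulrC -Exy XE; ring.
have XH g : g \in H -> rho g X = X.
  move=> gH; apply: (mulfI y0); rewrite -{1}(yH g gH) -rmorphM -XE rmorphM.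
  by rewrite rmorphXn rho_iota xH.
(* The roots of the equation of X are X and X + t ^ 2. If [g] fixed X, then X and with it [w] would
   be invariant under the whole group, against [wnot]. *)
have Xmoved g : g \notin H -> rho g X = X + t ^+ 2.
  move=> gH; have : (rho g X - X) * (rho g X - X - t ^+ 2) = 0.
    have E : rho g X ^+ 2 - t ^+ 2 * rho g X = X ^+ 2 - t ^+ 2 * X.
      have /(congr1 (rho g)) := Xeq.
      by rewrite rmorphB rmorphXn rmorphM rmorphXn !rho_iota => ->.
    have -> : (rho g X - X) * (rho g X - X - t ^+ 2) =
      (rho g X ^+ 2 - t ^+ 2 * rho g X) - (X ^+ 2 - t ^+ 2 * X)
      + 2%:R * (X ^+ 2 - X * rho g X + 0 * X) by ring.
    by rewrite E powser_two0; ring.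
  move/eqP; rewrite mulf_eq0 => /orP[|].
    rewrite subr_eq0 => /eqP gX; case: wnot.
    exists X, (t ^+ 2); rewrite expf_neq0 ?t_neq0 //.
    split=> //.
    - move=> h _; have [/XH //|hH] := boolP (h \in H).
      have [u uH ->] := index2_coset H2 gH hH.
      by rewrite rhoM gX XH.
    - by move=> h _; rewrite rmorphXn rho_iota.
    - have E : tofrac (t ^+ 2) * tofrac x = tofrac y * tofrac X.
        by rewrite -!tofracM XE.
      have t2 : tofrac (t ^+ 2) != 0 by rewrite tofrac_eq0 expf_neq0 ?t_neq0.
      rewrite wE; apply: (mulIf t2); rewrite [RHS]divfK // mulrAC (mulrC (tofrac x)) E mulrC.
      exact: mulKf.
  by rewrite subr_eq0 => /eqP/(canRL (subrK _)) ->; rewrite addrC.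
split; last first.
  have : f`_3 != 0 by rewrite -[3%N]/(4.-1) -sf -lead_coefE lead_coef_eq0 -size_poly_eq0 sf.
  by [].
split=> // g; case: ifPn => [/Xmoved|]; first by [].
by rewrite negbK addr0 => /XH.
Qed.

Lemma t2_neq0 : t ^+ 2 != 0. Proof. by rewrite expf_neq0 ?t_neq0. Qed.

Lemma as_data_mul m X e g h : as_data m X e -> m (g * h)%g = m g (+) m h.
Proof.
move=> [_ mX]; have := rhoM g h X; rewrite (mX h) rmorphD !mX.
have -> : rho g (if m h then t ^+ 2 else 0) = if m h then t ^+ 2 else 0.
  by case: (m h); rewrite ?rmorph0 // rmorphXn rho_iota.
have tt : t ^+ 2 + t ^+ 2 = 0 by rewrite (addrr_pchar2 powser_char2).
rewrite -addrA => /addrI/eqP; have /negPf t0 := t2_neq0.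
by case: (m _); case: (m g); case: (m h); rewrite /= ?tt ?addr0 ?add0r ?eqxx ?t0 // eq_sym t0.
Qed.

Lemma as_dataD m1 m2 X Y e f : as_data m1 X e -> as_data m2 Y f ->
  as_data (fun g => m1 g (+) m2 g) (X + Y) (fun i => e i + f i).
Proof.
move=> [eX mX] [eY mY]; split.
  have -> : as_rhs (fun i => e i + f i) = as_rhs e + as_rhs f.
    by rewrite -big_split; apply: eq_bigr => i _; rewrite rmorphD mulrDl.
  rewrite rmorphD -eX -eY.
  have -> : (X + Y) ^+ 2 - t ^+ 2 * (X + Y) =
    X ^+ 2 - t ^+ 2 * X + (Y ^+ 2 - t ^+ 2 * Y) + 2%:R * (X * Y) by ring.
  by rewrite powser_two0 mul0r addr0.
move=> g; rewrite rmorphD mX mY addrACA; congr (_ + _).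
by case: (m1 g); case: (m2 g); rewrite ?addr0 ?add0r // (addrr_pchar2 powser_char2).
Qed.

Lemma as_data_select (b : bool) m X e : as_data m X e ->
  as_data (fun g => b && m g) (if b then X else 0) (fun i => if b then e i else 0).
Proof.
case: b => // _; split; last by move=> g; rewrite rmorph0 addr0.
rewrite expr0n mulr0 subr0 /as_rhs big1 ?rmorph0 // => i _.
by rewrite mul0r.
Qed.

(** This is the trace of [x * rho g y] from the fixed ring of [H] down to k[[t]]: [g] has order 2
    and exchanges the two summands. *)
Lemma fixed_combination (H : {group gT}) (g : gT) x y : #|[set: gT] : H|%g = 2 ->
  g \notin H -> fixed_by rho H x -> fixed_by rho H y ->
  exists a, x * rho g y + y * rho g x = iota a.
Proof.
move=> H2 gH xH yH; apply: rho_fixed => h.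
rewrite rmorphD !rmorphM -!rhoM.
have [hH|hH] := boolP (h \in H).
  by rewrite (gcomm h g) !rhoM !(xH h, yH h).
have [u uH ->] := index2_coset H2 gH hH.
rewrite !(gcomm u g) -(gcomm g (g * u)) !mulgA ginv2 mul1g !rhoM !(xH u, yH u) //.
by ring.
Qed.

(* The index-two subring [C] fixed by [H] is spanned by [1] and [X] up to the
   factor [t ^+ 2], and [g] separates these two coordinates. *)
Lemma lin_indep_mul (H : {group gT}) g X (I J : finType)
    (v : J -> powser k) (x : I -> powser k) :
  #|[set: gT] : H|%g = 2 -> g \notin H -> fixed_by rho H X ->
  rho g X = X + t ^+ 2 ->
  (forall i, fixed_by rho H (x i)) -> (forall j, rho g (v j) = v j) ->
  lin_indep iota v -> lin_indep iota x ->
  lin_indep iota (fun i : J * I => v i.1 * x i.2).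
Proof.
move=> H2 gH XH gX xH gv vi xi c cE.
have t2H : fixed_by rho H 1 by move=> h _; rewrite rmorph1.
have bex i : exists b, iota b = x i + rho g (x i).
  have [b E] := fixed_combination H2 gH (xH i) t2H.
  by exists b; rewrite -E rmorph1; ring.
have aex i : exists a, iota a = x i * rho g X + X * rho g (x i).
  by have [a E] := fixed_combination H2 gH (xH i) XH; exists a.
have [b bE] := choice bex; have [a aE] := choice aex.
have xE i : iota (a i) = t ^+ 2 * x i + X * iota (b i).
  by rewrite aE bE gX; ring.
have two0 : 2%:R = 0 :> powser k := powser_two0.
pose d i := \sum_j iota (c (j, i)) * v j.
have gd i : rho g (d i) = d i.
  rewrite rmorph_sum; apply: eq_bigr => j _.
  by rewrite rmorphM rho_iota gv.
have dx0 : \sum_i d i * x i = 0.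
  transitivity (\sum_j \sum_i iota (c (j, i)) * (v j * x i)); last first.
    by rewrite pair_bigA -[RHS]cE; apply: eq_bigr => -[].
  rewrite exchange_big; apply: eq_bigr => i _; rewrite mulr_suml.
  by apply: eq_bigr => j _; rewrite mulrA.
have db0 : \sum_i d i * iota (b i) = 0.
  have := congr1 (rho g) dx0; rewrite rmorph0 rmorph_sum => E.
  transitivity (\sum_i d i * x i + \sum_i rho g (d i * x i)).
    rewrite -big_split; apply: eq_bigr => i _.
    by rewrite bE mulrDr rmorphM gd.
  by rewrite dx0 E addr0.
have da0 : \sum_i d i * iota (a i) = 0.
  have -> : \sum_i d i * iota (a i) =
     t ^+ 2 * (\sum_i d i * x i) + X * \sum_i d i * iota (b i).
    rewrite !mulr_sumr -big_split; apply: eq_bigr => i _.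
    by rewrite xE /=; ring.
  by rewrite dx0 db0; ring.
have sum0 (e : I -> powser k) : \sum_i d i * iota (e i) = 0 ->
    forall j, \sum_i c (j, i) * e i = 0.
  move=> E; apply: vi; rewrite -[RHS]E.
  under eq_bigr => j _ do rewrite rmorph_sum mulr_suml.
  rewrite exchange_big; apply: eq_bigr => i _; rewrite mulr_suml.
  by apply: eq_bigr => j _; rewrite rmorphM mulrAC.
case=> j i; apply: (mulfI (expf_neq0 2 (powserX_neq0 k))); rewrite mulr0.
apply: (xi (fun i => T ^+ 2 * c (j, i))).
have E1 := congr1 iota (sum0 _ da0 j); have E2 := congr1 iota (sum0 _ db0 j).
rewrite rmorph0 rmorph_sum in E1; rewrite rmorph0 rmorph_sum in E2.
have -> : \sum_i0 iota (T ^+ 2 * c (j, i0)) * x i0 =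
  \sum_i iota (c (j, i) * a i) - X * \sum_i iota (c (j, i) * b i).
  rewrite mulr_sumr -sumrB; apply: eq_bigr => l _.
  by rewrite rmorphM rmorphXn !(rmorphM iota (c _)) xE; ring.
by rewrite E1 E2; ring.
Qed.

(** Here [g2] fixes the first ring and moves the second, while [g3] fixes the products of both and
    moves the third. So [lin_indep_mul] adjoins one factor at a time. *)
Lemma linearly_disjoint_index2 (H1 H2 H3 : {group gT}) g2 g3 X2 X3 :
  #|[set: gT] : H2|%g = 2 -> #|[set: gT] : H3|%g = 2 ->
  fixed_by rho H2 X2 -> fixed_by rho H3 X3 ->
  rho g2 X2 = X2 + t ^+ 2 -> rho g3 X3 = X3 + t ^+ 2 ->
  g2 \in H1 -> g2 \notin H2 -> g3 \in H1 -> g3 \in H2 -> g3 \notin H3 ->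
  linearly_disjoint3 iota (fixed_by rho H1) (fixed_by rho H2) (fixed_by rho H3).
Proof.
move=> i2 i3 X2H X3H gX2 gX3 g21 g22 g31 g32 g33 n1 n2 n3 x1 x2 x3 h1 h2 h3 l1 l2 l3.
apply: (lin_indep_mul i3 g33 X3H gX3 h3 _ _ l3 (v := fun j => x1 j.1 * x2 j.2)).
  by move=> j; rewrite rmorphM h1 ?h2.
by apply: (lin_indep_mul i2 g22 X2H gX2 h2 _ l1 l2) => j; rewrite h1.
Qed.

Lemma closed_sqrt (c : k) : exists d, d ^+ 2 = c.
Proof.
have /closed_rootP[d] : size ('X^2 - c%:P : {poly k}) != 1%N.
  by rewrite size_XnsubC.
by rewrite rootE !hornerE subr_eq0 => /eqP; exists d.
Qed.

Lemma closed_artin_schreier (c : k) : exists d, d ^+ 2 - d = c.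
Proof.
have /closed_rootP[d] : size ('X^2 - ('X + c%:P) : {poly k}) != 1%N.
  by rewrite size_polyDl ?size_polyN ?size_XaddC ?size_polyXn.
by rewrite rootE !hornerE subr_eq0 => /eqP E; exists d; rewrite E; ring.
Qed.

(** Without a t ^ -3 term, adding d / t to the generator trades its t ^ -2 term for a t ^ -1 term,
    since k has square roots. The new t ^ -1 coefficient is nonzero: an equation with constant
    right-hand side splits over k. *)
Lemma conductor2 (H : {group gT}) (m : gT -> bool) X e g :
  as_data m X e -> m g -> (forall h, h \in H -> ~~ m h) -> e ord0 = 0 ->
  has_conductor iota rho H 2.
Proof.
move=> [Xe mX] mg mH e0.
pose o i : 'I_4 := inord i.
have rhsE : as_rhs e = powserC (e (o 1%N)) * T ^+ 2 + powserC (e (o 2%N)) * T ^+ 3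
    + powserC (e (o 3%N)) * T ^+ 4.
  rewrite /as_rhs !big_ord_recl big_ord0 e0 rmorph0 mul0r add0r addr0 addrA.
  by congr (powserC (e _) * _ + powserC (e _) * _ + powserC (e _) * _);
    apply: val_inj; rewrite /= inordK.
have [d dE] := closed_sqrt (e (o 1%N)).
pose X' := X + powserC d * t.
pose e3 := e (o 2%N) + d; pose e4 := e (o 3%N).
have two0 := powser_two0.
have X'E : X' ^+ 2 - t ^+ 2 * X' =
    powserC e3 * t ^+ 3 + powserC e4 * t ^+ 4.
  have -> : X' ^+ 2 - t ^+ 2 * X' = X ^+ 2 - t ^+ 2 * X + powserC d ^+ 2 * t ^+ 2
      + powserC d * t ^+ 3 + 2%:R * (X * powserC d * t - powserC d * t ^+ 3).
    by rewrite /X'; ring.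
  rewrite two0 mul0r addr0 Xe rhsE !rmorphD !(rmorphM iota (powserC _)) !rmorphXn !iotaC.
  rewrite -/e4 -[powserC d ^+ 2]rmorphXn dE.
  set a := powserC (e (o 1%N)).
  have -> : a * t ^+ 2 + powserC (e (o 2%N)) * t ^+ 3 + powserC e4 * t ^+ 4 +
    a * t ^+ 2 + powserC d * t ^+ 3 = 2%:R * (a * t ^+ 2) +
    ((powserC (e (o 2%N)) + powserC d) * t ^+ 3 + powserC e4 * t ^+ 4) by ring.
  by rewrite two0 mul0r add0r.
have mX' h : rho h X' = X' + (if m h then t ^+ 2 else 0).
  by rewrite /X' rmorphD mX rmorphM rho_iota -iotaC rho_iota addrAC.
have X'moved : rho g X' <> X'.
  rewrite mX' mg -[in RHS](addr0 X') => /addrI/eqP.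
  exact/negP/t2_neq0.
have [e30|e30] := eqVneq e3 0.
  have [l lE] := closed_artin_schreier e4; case: X'moved.
  have : (X' - powserC l * t ^+ 2) * (X' - powserC l * t ^+ 2 - t ^+ 2) = 0.
    have -> : (X' - powserC l * t ^+ 2) * (X' - powserC l * t ^+ 2 - t ^+ 2) =
      X' ^+ 2 - t ^+ 2 * X' + (powserC l ^+ 2 - powserC l) * t ^+ 4
      + 2%:R * (powserC l * t ^+ 4 - X' * powserC l * t ^+ 2) by ring.
    have Cl : powserC l ^+ 2 - powserC l = powserC e4 by rewrite -lE rmorphB rmorphXn.
    rewrite two0 X'E e30 Cl (rmorph0 (@powserC k)).
    have -> : 0 * t ^+ 3 + powserC e4 * t ^+ 4 + powserC e4 * t ^+ 4 +
      0 * (powserC l * t ^+ 4 - X' * powserC l * t ^+ 2) =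
      2%:R * (powserC e4 * t ^+ 4) by ring.
    by rewrite two0 mul0r.
  have lg : rho g (powserC l * t ^+ 2) = powserC l * t ^+ 2.
    by rewrite rmorphM rmorphXn rho_iota -iotaC rho_iota.
  move/eqP; rewrite mulf_eq0 !subr_eq0 => /orP[] /eqP.
    by move=> ->.
  move/(canRL (subrK _)) => ->.
  by rewrite rmorphD lg rmorphXn rho_iota.
pose f : {poly k} := e4%:P + e3 *: 'X.
have sf : size f = 2.
  by rewrite /f addrC -mul_polyC size_MXaddC polyC_eq0 (negPf e30) /= size_polyC e30.
have t2 := t2_neq0.
exists 1%N, f, (tofrac X' / tofrac (t ^+ 2)); split=> //.
  split.
    exists X', (t ^+ 2); split=> // h hH; first by rewrite mX' (negPf (mH h hH)) addr0.
    by rewrite rmorphXn rho_iota.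
  move=> [x [y [xG yG y0 E]]]; case: X'moved.
  have XyE : X' * y = x * t ^+ 2.
    apply/eqP; rewrite -tofrac_eq (tofracM X') (tofracM x).
    rewrite -eqr_div ?tofrac_eq0 //; exact/eqP.
  apply: (mulIf y0); rewrite -{1}(yG g (finset.in_setT _)) -rmorphM XyE rmorphM.
  by rewrite rmorphXn rho_iota xG ?finset.in_setT.
rewrite sf.
apply: etrans (add_denominators (a := powserC f`_0) (b := powserC f`_1) t_neq0 _) _.
  rewrite X'E !coefD !coefC !coefZ !coefX /= mulr0 addr0 mulr1 add0r.
  by rewrite addrC.
by rewrite !big_ord_recl big_ord0 addr0.
Qed.


(** Linear disjointness makes the three given characters independent, so they are coordinates on the
    group. A character of conductor 2 could be exchanged for one of the three and would give the
    triple (2, 4, 4), smaller than the type. *)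
Lemma type_data : has_type iota rho 4 4 4 ->
  exists (chi : gT -> bool3) (X : bool3 -> powser k) (e : bool3 -> 'I_4 -> k),
  [/\ bijective chi, (forall g h, chi (g * h)%g = badd (chi g) (chi h)),
      (forall a, as_data (fun g => dot a (chi g)) (X a) (e a)) &
      forall a, a != bzero -> e a ord0 != 0].
Proof.
move=> [[G1 [G2 [G3 [[i1 c1] [i2 c2] [i3 c3] disj]]]] minimal].
have [X1 [e1 [D1 e10]]] := conductor4_data i1 c1.
have [X2 [e2 [D2 e20]]] := conductor4_data i2 c2.
have [X3 [e3 [D3 e30]]] := conductor4_data i3 c3.
pose chi g : bool3 := (g \notin G1, g \notin G2, g \notin G3).
pose X (a : bool3) := (if a.1.1 then X1 else 0) + (if a.1.2 then X2 else 0)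
   + (if a.2 then X3 else 0).
pose e (a : bool3) i := (if a.1.1 then e1 i else 0) + (if a.1.2 then e2 i else 0)
   + (if a.2 then e3 i else 0).
have chiM g h : chi (g * h)%g = badd (chi g) (chi h).
  by rewrite /chi (as_data_mul g h D1) (as_data_mul g h D2) (as_data_mul g h D3).
have DX a : as_data (fun g => dot a (chi g)) (X a) (e a).
  exact: as_dataD (as_dataD (as_data_select a.1.1 D1) (as_data_select a.1.2 D2))
   (as_data_select a.2 D3).
have not_fixed (H : {group gT}) Y f : #|[set: gT] : H|%g = 2 ->
    as_data (fun g => g \notin H) Y f -> exists g, g \notin H.
  move=> iH _; apply: contrapT => /forallNP hH.
  have : [set: gT] \subset H by apply/fintype.subsetP => g _; apply/negPn/negP/hH.
  by rewrite -indexg_eq1 iH.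
have XH (H : {group gT}) Y f : as_data (fun g => g \notin H) Y f -> fixed_by rho H Y.
  by move=> [_ mY] h hH; rewrite mY hH addr0.
have independent a : a != bzero -> exists g, dot a (chi g).
  move=> a0; apply: contrapT => /forallNP hg.
  have [x Ex] : exists x, X a = iota x.
    apply: rho_fixed => g; have [_ ->] := DX a.
    by case: ifPn => [/hg //|_]; rewrite addr0.
  (* The products of the three families (1, X_i) include 1, X1, X2 and X3, so disjointness forbids
     any linear relation among these four. *)
  pose fam Y (i : 'I_2) : powser k := if i == ord0 then 1 else Y.
  have famH (H : {group gT}) Y f : as_data (fun g => g \notin H) Y f ->
      forall i, fixed_by rho H (fam Y i).
    by move=> /XH YH i h hH; rewrite /fam; case: eqP; rewrite ?rmorph1 ?YH.
  have famL (H : {group gT}) Y f : #|[set: gT] : H|%g = 2 ->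
      as_data (fun g => g \notin H) Y f -> lin_indep iota (fam Y).
    move=> iH D; have [g gH] := not_fixed H Y f iH D; case: D => [_ mY] c.
    rewrite !big_ord_recl big_ord0 addr0 /fam /= mulr1 => E.
    have := congr1 (rho g) E; rewrite rmorph0 rmorphD (rmorphM (rho g)) !rho_iota mY gH.
    rewrite mulrDr addrA E add0r => /eqP.
    rewrite mulf_eq0 (negPf t2_neq0) orbF -(rmorph0 iota) (inj_eq iota_inj) => /eqP c1'.
    move: E; rewrite c1' rmorph0 mul0r addr0 -[RHS](rmorph0 iota) => /iota_inj c0'.
    by move=> i; case: (unliftP ord0 i) => [j|] -> //; rewrite (ord1 j).
  have := disj 2 2 2 (fam X1) (fam X2) (fam X3) (famH _ _ _ D1) (famH _ _ _ D2)
    (famH _ _ _ D3) (famL _ _ _ i1 D1) (famL _ _ _ i2 D2) (famL _ _ _ i3 D3).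
  pose o1 : 'I_2 := lift ord0 ord0.
  (* Coefficients of x + a1 X1 + a2 X2 + a3 X3, which vanishes in characteristic 2 if [X a] is the
     image of x. *)
  pose c (i : 'I_2 * 'I_2 * 'I_2) : powser k :=
    if i == (ord0, ord0, ord0) then x else
    if i == (o1, ord0, ord0) then a.1.1%:R else
    if i == (ord0, o1, ord0) then a.1.2%:R else
    if i == (ord0, ord0, o1) then a.2%:R else 0.
  move=> /(_ c) h; suff h0 : \sum_i iota (c i) *
      (fam X1 i.1.1 * fam X2 i.1.2 * fam X3 i.2) = 0.
    have {}h := h h0.
    have one0 : (1 : powser k) <> 0 by apply/eqP; rewrite oner_eq0.
    have := (h (o1, ord0, ord0), h (ord0, o1, ord0), h (ord0, ord0, o1)).
    by rewrite /c /=; case: a a0 {hg Ex h h0 c} => [[[] []] []] //= _ [[h1 h2] h3].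
  transitivity (\sum_i1 \sum_i2 \sum_i3 iota (c (i1, i2, i3)) * (fam X1 i1 * fam X2 i2 * fam X3 i3)).
    rewrite pair_bigA pair_bigA; apply: eq_bigr => -[[l1 l2] l3] _ //.
  have XaE : X a = a.1.1%:R * X1 + a.1.2%:R * X2 + a.2%:R * X3.
    by rewrite /X; case: a.1.1; case: a.1.2; case: a.2; rewrite ?mul1r ?mul0r.
  rewrite !big_ord_recl !big_ord0 /fam /c /= !rmorph0 !rmorph_nat -Ex XaE.
  set l := (X in X = 0).
  have -> : l = 2%:R * (a.1.1%:R * X1 + a.1.2%:R * X2 + a.2%:R * X3).
    by rewrite /l; ring.
  by rewrite powser_two0 mul0r.
have chi0 : chi 1%g = bzero.
  by have := chiM 1%g 1%g; rewrite mulg1 => {1}->; rewrite baddvv.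
have surj v : exists g, chi g = v.
  apply/asboolP; move: v; apply: bool3_span => [|u v|a a0].
  - by apply/asboolP; exists 1%g.
  - by move=> /asboolP[g <-] /asboolP[h <-]; apply/asboolP; exists (g * h)%g.
  - have [g ag] := independent a a0; exists (chi g); rewrite ag andbT.
    by apply/asboolP; exists g.
have [gam gamK] := choice surj.
have bij_gam : bijective gam.
  apply: inj_card_bij; first exact: can_inj gamK.
  by rewrite -cardsT cardG !card_prod card_bool.
have bij_chi : bijective chi := bij_can_bij bij_gam gamK.
exists chi, X, e; split=> // a a0; apply/eqP => ea0.
have group_Ka : group_set [set g | ~~ dot a (chi g)]%SET.
  apply/group_setP; split=> [|g h]; rewrite !inE ?chi0 ?dot0 //.
  by rewrite chiM dotDr => /negPf-> /negPf->.
pose K := Group group_Ka.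
have KE g : (g \in K) = ~~ dot a (chi g) by rewrite inE.
have iK : #|[set: gT] : K|%g = 2.
  have cK : #|K| = 4.
    have -> : #|K| = #|chi @^-1: [set v | ~~ dot a v]%SET|.
      by apply: eq_card => g; rewrite !inE.
    rewrite on_card_preimset; last exact: onW_bij.
    rewrite -sum1_card big_mkcond sum_bool3 !big_cons big_nil !inE.
    by case: a a0 {ea0 group_Ka K KE} => [[[] []] []].
  have := Lagrange (finset.subsetT K); rewrite cK cardG.
  by move/eqP; rewrite -[8%N]/(4 * 2)%N eqn_pmul2l // => /eqP.
have [g0 ag0] := independent a a0.
have cond2 : has_conductor iota rho K 2.
  by apply: (conductor2 (DX a) ag0) => // h; rewrite KE.
(* The vectors [u] and [v] in the kernel of [a] certify that the fixed rings of [K], [Hb] and [Hc]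
   are linearly disjoint. *)
have build (Hb Hc : {group gT}) Xb Xc fb fc u v :
    #|[set: gT] : Hb|%g = 2 -> #|[set: gT] : Hc|%g = 2 ->
    has_conductor iota rho Hb 4 -> has_conductor iota rho Hc 4 ->
    as_data (fun g => g \notin Hb) Xb fb -> as_data (fun g => g \notin Hc) Xc fc ->
    ~~ dot a u -> gam u \notin Hb -> ~~ dot a v -> gam v \in Hb ->
    gam v \notin Hc -> False.
  move=> ib ic cb cc Db Dc au uHb av vHb vHc.
  have : conductor_triple iota rho 2 4 4.
    exists K, Hb, Hc; split=> //.
    apply: (@linearly_disjoint_index2 K Hb Hc (gam u) (gam v) Xb Xc) => //.
    - exact: XH Db.
    - exact: XH Dc.
    - by have [_ ->] := Db; rewrite uHb.
    - by have [_ ->] := Dc; rewrite vHc.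
    - by rewrite KE gamK.
    - by rewrite KE gamK.
  by move/minimal => [//|[//]].
have mem1 v : (gam v \notin G1) = v.1.1 by rewrite -[in RHS](gamK v).
have mem2 v : (gam v \notin G2) = v.1.2 by rewrite -[in RHS](gamK v).
have mem3 v : (gam v \notin G3) = v.2 by rewrite -[in RHS](gamK v).
have in1 v : (gam v \in G1) = ~~ v.1.1 by rewrite -mem1 negbK.
have in2 v : (gam v \in G2) = ~~ v.1.2 by rewrite -mem2 negbK.
case: a a0 ea0 {group_Ka K KE iK g0 ag0 cond2} build => [[b1 b2] b3] a0 ea0 build.
have [b1T|b1F] := boolP b1.
  apply: (build G2 G3 X2 X3 e2 e3 (b2, true, false) (b3, false, true)) => //;
    rewrite ?mem2 ?mem3 ?in2 //.
  1,2: by rewrite b1T /dot /=; case: (b2); case: (b3).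
have [b2T|b2F] := boolP b2.
  apply: (build G1 G3 X1 X3 e1 e3 (true, false, false) (false, b3, true)) => //;
    rewrite ?mem1 ?mem3 ?in1 //.
  1,2: by rewrite b2T (negPf b1F) /dot /=; case: (b3).
(* Only the third coordinate character is left, and its leading coefficient is [e3 ord0], known to
   be nonzero. *)
case: b3 a0 ea0 {build} => //.
  by move=> _; rewrite (negPf b1F) (negPf b2F) /e /= !add0r => E; case/eqP: e30.
by rewrite (negPf b1F) (negPf b2F).
Qed.

End TypeAnalysis.

(** * Weierstrass division and prime ideals of R[[T]] *)

Section Weierstrass.
Variables (R : idomainType) (k : fieldType) (pi : R) (red : {rmorphism R -> k}).
Hypothesis dvr : is_complete_dvr pi.
Hypothesis res : is_residue_map pi red.
Local Notation C := (@powserC R).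
Local Notation X := (powserX R).
Local Notation mred := (map_powser red).
Implicit Types f g h p q : powser R.

Lemma pi_neq0 : pi != 0. Proof. by case: dvr => -[]. Qed.
Lemma red_pi : red pi = 0.
Proof. by case: res => _ /(_ pi) [_ h]; apply: h; exists 1; rewrite mulr1. Qed.
Lemma red_eq0 x : red x = 0 -> exists y, x = pi * y.
Proof. by case: res => _ /(_ x) [h _]. Qed.
Lemma red_surj c : exists x, red x = c. Proof. by case: res. Qed.

Lemma dvr_factor x : x != 0 -> exists u n, u \is a GRing.unit /\ x = u * pi ^+ n.
Proof. by case: dvr => -[_ _ h] _ /h. Qed.

Lemma unit_red x : (x \is a GRing.unit) = (red x != 0).
Proof.
apply/idP/idP => [/(rmorph_unit red)|x0]; first by rewrite unitfE.
have [|u [[|n] [uu E]]] := @dvr_factor x.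
- by apply: contraNneq x0 => ->; rewrite rmorph0.
- by rewrite E expr0 mulr1.
- by move: x0; rewrite E exprS rmorphM (rmorphM red pi) red_pi mul0r mulr0 eqxx.
Qed.

Lemma psunit_red f : (f \is a GRing.unit) = (mred f \is a GRing.unit).
Proof. by rewrite !powser_unit unit_red unitfE. Qed.

Lemma mred_pi : mred (C pi) = 0.
Proof. by rewrite map_powserC red_pi rmorph0. Qed.

Lemma mred_eq0 f : mred f = 0 -> exists g, f = C pi * g.
Proof.
move=> f0; have h n : exists y, pcoef f n = pi * y.
  by apply: red_eq0; have := congr1 (fun z : powser k => pcoef z n) f0.
have [g gE] := choice h; exists (PowSer g); apply: powserP => n.
by rewrite pcoefMC gE.
Qed.

Lemma mred_surj x : exists f, mred f = x.
Proof.
have [l lE] := choice red_surj; exists (map_powser l x).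
by apply: powserP => n /=; rewrite lE.
Qed.

Lemma gauss_factor f : f != 0 -> exists n g, f = C pi ^+ n * g /\ mred g != 0.
Proof.
move=> f0.
pose P n := `[< exists i u, u \is a GRing.unit /\ pcoef f i = u * pi ^+ n >].
have exP : exists n, P n.
  have [i fi] : exists i, pcoef f i != 0.
    apply: contrapT => /forallNP hz; case/eqP: f0.
    by apply: powserP => i; apply/eqP/negPn/negP/hz.
  have [u [n [uu E]]] := dvr_factor fi.
  by exists n; apply/asboolP; exists i, u.
case: (ex_minnP exP) => n /asboolP[i [u [uu iE]]] nmin; exists n.
have h j : exists y, pcoef f j = pi ^+ n * y.
  have [->|fj] := eqVneq (pcoef f j) 0; first by exists 0; rewrite mulr0.
  have [v [m [vu E]]] := dvr_factor fj; exists (v * pi ^+ (m - n)).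
  rewrite E mulrCA -exprD subnKC //; apply: nmin; apply/asboolP.
  by exists j, v.
have [g gE] := choice h; exists (PowSer g); split.
  by apply: powserP => j; rewrite -rmorphXn pcoefMC gE.
apply/eqP => /(congr1 (fun z : powser k => pcoef z i)) /= /eqP; apply/negP.
rewrite -unit_red; have := gE i; rewrite iE mulrC.
by move/(mulfI (expf_neq0 n pi_neq0)) => <-.
Qed.

Lemma Cpi_neq0 n : C pi ^+ n != 0.
Proof.
rewrite expf_neq0 // -(rmorph0 (@powserC R)) (inj_eq (@powserC_inj R)).
exact: pi_neq0.
Qed.

Lemma pi_separated f : (forall n, exists g, f = C pi ^+ n * g) -> f = 0.
Proof.
move=> h; apply/eqP/negPn/negP => /gauss_factor[n [g [E g0]]].
have [g' E'] := h n.+1; move: E'; rewrite E exprSr -mulrA.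
move/(mulfI (Cpi_neq0 n)) => gE; move: g0.
by rewrite gE rmorphM /= mred_pi mul0r eqxx.
Qed.

Lemma pi_cancel n f g : C pi ^+ n * f = C pi ^+ n * g -> f = g.
Proof. by move/(mulfI (Cpi_neq0 n)). Qed.

Lemma pi_series (a : nat -> powser R) : exists l, forall n, exists h,
  l = \sum_(i < n) C pi ^+ i * a i + C pi ^+ n * h.
Proof.
have h j : exists l, forall n, exists y,
    l - \sum_(i < n) pi ^+ i * pcoef (a i) j = pi ^+ n * y.
  case: dvr => _ /(_ (fun n => \sum_(i < n) pi ^+ i * pcoef (a i) j)); apply.
  by move=> n; exists (pcoef (a n) j); rewrite big_ord_recr /=; ring.
have [l lE] := choice h; exists (PowSer l) => n.
have [y yE] := choice (fun j => lE j n); exists (PowSer y).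
apply: powserP => j; rewrite pcoefD pcoef_sum -rmorphXn pcoefMC -yE addrC.
have -> : \sum_(i < n) pcoef (C pi ^+ i * a i) j =
    \sum_(i < n) pi ^+ i * pcoef (a i) j.
  by apply: eq_bigr => i _; rewrite -rmorphXn pcoefMC.
by rewrite subrK.
Qed.

Definition ps_short d f := forall i, (d <= i)%N -> pcoef f i = 0.

(* The Weierstrass degree. *)
Definition wd f d := exists2 u, u \is a GRing.unit & mred f = powserX k ^+ d * u.

Lemma wd_neq0 f d : wd f d -> mred f != 0.
Proof.
move=> [u uu ->]; rewrite mulf_neq0 ?expf_neq0 ?powserX_neq0 //.
by apply: contraTneq uu => ->; rewrite unitr0.
Qed.

Lemma wd_exists f : mred f != 0 -> exists d, wd f d.
Proof. by move=> /powser_factor[d [u [E uu]]]; exists d, u. Qed.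

Lemma wd_uniq f d e : wd f d -> wd f e -> d = e.
Proof.
move=> [u uu E] [v vu E']; apply/eqP; rewrite eqn_leq.
apply/andP; split.
  by apply: (ps_ge_unit vu); rewrite -E' E; apply: ps_ge_X.
by apply: (ps_ge_unit uu); rewrite -E E'; apply: ps_ge_X.
Qed.

Lemma wdM f g d e : wd f d -> wd g e -> wd (f * g) (d + e).
Proof.
move=> [u uu E] [v vu E']; exists (u * v); first by rewrite unitrM uu.
by rewrite rmorphM /= E E' exprD; ring.
Qed.

Lemma wdM_inv f g d : wd (f * g) d ->
  exists e e', [/\ wd f e, wd g e' & d = (e + e')%N].
Proof.
move=> h; have := wd_neq0 h; rewrite rmorphM mulf_eq0 negb_or.
move=> /andP[/wd_exists[e fe] /wd_exists[e' ge']]; exists e, e'; split=> //.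
exact: wd_uniq h (wdM fe ge').
Qed.

Lemma wd0_unit f : wd f 0 <-> f \is a GRing.unit.
Proof.
rewrite psunit_red; split=> [[u uu ->]|fu]; first by rewrite mul1r.
by exists (mred f); rewrite // mul1r.
Qed.

(** Modulo [pi], [g] is a unit times a power of the variable and division is immediate. The error is
    divisible by [pi] and is divided again; quotients and remainders are summed pi-adically. *)
Lemma weierstrass_division g d f : wd g d ->
  exists q r, f = q * g + r /\ ps_short d r.
Proof.
move=> [u uu gE].
have step f' : exists qrn : powser R * powser R * powser R,
    f' = qrn.1.1 * g + qrn.1.2 + C pi * qrn.2 /\ ps_short d qrn.1.2.
  pose r := PowSer (fun i => if (i < d)%N then pcoef f' i else 0).
  have [|s sE] := @powserX_dvd _ d (mred (f' - r)).
    by move=> i i_d; rewrite /= i_d subrr rmorph0.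
  have [q qE] := mred_surj (s * u^-1).
  have [|n nE] := @mred_eq0 (f' - r - q * g).
    rewrite rmorphB rmorphM /= sE qE gE.
    by rewrite mulrCA -mulrA mulVr // mulr1 subrr.
  exists (q, r, n); split=> /=; first by rewrite -nE; ring.
  by move=> i /=; rewrite ltnNge => ->.
have [qrn qE] := choice step.
pose N n := iter n (fun x => (qrn x).2) f.
have [q qs] := pi_series (fun n => (qrn (N n)).1.1).
have [r rs] := pi_series (fun n => (qrn (N n)).1.2).
have sumE n : f = (\sum_(i < n) C pi ^+ i * (qrn (N i)).1.1) * g +
    \sum_(i < n) C pi ^+ i * (qrn (N i)).1.2 + C pi ^+ n * N n.
  elim: n => [|n IH]; first by rewrite !big_ord0 mul0r !add0r mul1r.
  rewrite {1}IH !big_ord_recr /= -/(N n).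
  have [E _] := qE (N n); have {}E := congr1 (fun z => C pi ^+ n * z) E.
  by rewrite [LHS](congr1 _ E) exprS; ring.
exists q, r; split.
  apply/eqP; rewrite -subr_eq0; apply/eqP/pi_separated => n.
  have [h hE] := qs n; have [h' hE'] := rs n.
  exists (N n - h * g - h'); rewrite {1}(sumE n) hE hE' /=; ring.
move=> i di; have : powserC (pcoef r i) = 0.
  apply: pi_separated => n; have [h ->] := rs n.
  exists (powserC (pcoef h i)).
  rewrite pcoefD pcoef_sum big1 ?add0r -?rmorphXn ?pcoefMC -?rmorphM //.
  by move=> j _; rewrite -rmorphXn pcoefMC (qE (N j)).2 ?mulr0.
by rewrite -(rmorph0 (@powserC R)) => /powserC_inj.
Qed.

(** The Euclidean step for the Weierstrass degree. A nonzero remainder has no coefficients from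
    index [d] on, so once its content is removed its degree is below [d]. Bezout relations thus hold
    up to powers of [pi]. *)
Lemma weierstrass_remainder g d f : wd g d -> exists q, f = q * g \/
  exists n m r, [/\ (m < d)%N, wd r m & f = q * g + C pi ^+ n * r].
Proof.
move=> gd; have [q [r [E short]]] := weierstrass_division f gd; exists q.
have [r0|r0] := eqVneq r 0; first by left; rewrite E r0 addr0.
right; have [n [r' [rE r'0]]] := gauss_factor r0.
have [m rm] := wd_exists r'0; exists n, m, r'; rewrite -rE; split=> //.
rewrite ltnNge; apply/negP => dm; have [u uu uE] := rm.
have : pcoef r' m = 0.
  apply: (mulfI (expf_neq0 n pi_neq0)); rewrite mulr0 -pcoefMC rmorphXn -rE.
  exact: short.
move/(congr1 red); rewrite rmorph0 -[red _]/(pcoef (mred r') m) uE pcoefXnM.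
by rewrite leqnn subnn => /eqP; apply/negP; rewrite -unitfE -powser_unit.
Qed.

Definition ps_prime p := p \isn't a GRing.unit /\
  forall a b, in_ideal p (a * b) -> in_ideal p a \/ in_ideal p b.

(** The prime [pi] does not divide [p], so it divides the cofactor and cancels one power at a
    time. *)
Lemma pi_cancel_dvd p x y n : mred p != 0 -> p * x = C pi ^+ n * y -> in_ideal p y.
Proof.
move=> p0; elim: n x y => [|n IH] x y E; first by exists x; rewrite E mul1r.
have [|x' xE] := @mred_eq0 x.
  apply/eqP; have := congr1 mred E; rewrite rmorphM exprS -mulrA rmorphM.
  by rewrite /= mred_pi mul0r => /eqP; rewrite mulf_eq0 (negPf p0).
apply: (IH x'); apply: (@pi_cancel 1).
by rewrite expr1 [RHS]mulrA -exprS -E xE; ring.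
Qed.

(** A factor [p] of least positive Weierstrass degree is prime. If it divides [a * b], take [g] of
    least degree among the combinations of [p] and [a], up to powers of [pi]; it divides both.
    Either [g] is a unit, and [p] divides [b], or [g] has the degree of [p], and [p] divides [a]. *)
Lemma prime_factor f d : wd f d -> (0 < d)%N ->
  exists p e, [/\ ps_prime p, wd p e, (0 < e)%N & in_ideal p f].
Proof.
move=> fd d0.
pose P n := `[< (0 < n)%N /\ exists p, wd p n /\ in_ideal p f >].
have exP : exists n, P n.
  by exists d; apply/asboolP; split=> //; exists f; split=> //; exists 1; rewrite mulr1.
case: (ex_minnP exP) => e /asboolP[e0 [p [pe pf]]] emin.
exists p, e; split=> //; split.
  by apply/negP => /wd0_unit /(wd_uniq pe) E; rewrite E in e0.
move=> a b [c cE]; apply: contrapT; move/not_orP => [pa pb].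
pose S n := `[< exists g m u v, wd g n /\ C pi ^+ m * g = u * p + v * a >].
have exS : exists n, S n.
  by exists e; apply/asboolP; exists p, 0%N, 1, 0; split=> //; ring.
case: (ex_minnP exS) => m /asboolP[g [n [u [v [gm gE]]]]] mmin.
have gdiv u' v' : in_ideal g (u' * p + v' * a).
  have [q [E|[n' [m' [r [m'm rm' E]]]]]] := weierstrass_remainder (u' * p + v' * a) gm.
    by exists q; rewrite E mulrC.
  suff /mmin : S m' by rewrite leqNgt m'm.
  apply/asboolP; exists r, (n + n')%N, (C pi ^+ n * u' - q * u), (C pi ^+ n * v' - q * v).
  split=> //; rewrite exprD -mulrA.
  have -> : C pi ^+ n' * r = u' * p + v' * a - q * g by rewrite E; ring.
  have -> : C pi ^+ n * (u' * p + v' * a - q * g) =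
    C pi ^+ n * (u' * p + v' * a) - q * (C pi ^+ n * g) by ring.
  by rewrite gE; ring.
have [x xE] : in_ideal g p by have := gdiv 1 0; rewrite mul1r mul0r addr0.
have [y yE] : in_ideal g a by have := gdiv 0 1; rewrite mul1r mul0r add0r.
have := pe; rewrite xE => /wdM_inv[m' [m'' [gm' xm'' eE]]].
rewrite -(wd_uniq gm gm') in eE.
have [m0|m0] := posnP m.
  apply: pb; rewrite m0 in gm; have gu := (wd0_unit g).1 gm.
  apply: (@pi_cancel_dvd p ((u * b + v * c) * g^-1) b n (wd_neq0 pe)).
  have -> : p * ((u * b + v * c) / g) = (u * p * b + v * (p * c)) / g by ring.
  rewrite -cE; have -> : u * p * b + v * (a * b) = (u * p + v * a) * b by ring.
  by rewrite -gE mulrAC mulrK.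
have em : (e <= m)%N.
  apply: emin; apply/asboolP; split=> //; exists g; split=> //.
  by case: pf => z ->; exists (x * z); rewrite xE mulrA.
have x0 : wd x 0 by move: em eE xm''; clear; case: m'' => //; lia.
have xu := (wd0_unit x).1 x0.
by apply: pa; exists (x^-1 * y); rewrite xE -mulrA mulVKr.
Qed.

Definition pideal p : {pred powser R} := fun a => `[< in_ideal p a >].
Lemma pidealP p a : reflect (in_ideal p a) (a \in pideal p).
Proof. exact: asboolP. Qed.

Lemma pideal_prime p : ps_prime p -> is_prime_ideal (pideal p).
Proof.
move=> [pu pp]; split; first split.
- by apply/pidealP; exists 0; rewrite mulr0.
- apply/pidealP => -[y]; rewrite mulrC => y1; move/negP: pu; apply.
  by apply/unitrPr; exists y; rewrite mulrC.
- move=> a x y /pidealP[x' ->] /pidealP[y' ->]; apply/pidealP.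
  by exists (a * x' + y'); ring.
- move=> x y /pidealP/pp[h|h]; apply/orP; [left|right]; exact/pidealP.
Qed.

Section Ideals.
Variable P : {pred powser R}.
Hypothesis primeP : is_prime_ideal P.

Lemma pid0 : 0 \in P. Proof. by case: primeP => -[]. Qed.
Lemma pidD x y : x \in P -> y \in P -> x + y \in P.
Proof. by case: primeP => -[_ _ h] _ xP yP; have := h 1 x y xP yP; rewrite mul1r. Qed.
Lemma pidMl a x : x \in P -> a * x \in P.
Proof. by case: primeP => -[h0 _ h] _ xP; have := h a x 0 xP h0; rewrite addr0. Qed.
Lemma pidMr a x : x \in P -> x * a \in P.
Proof. by rewrite mulrC; apply: pidMl. Qed.
Lemma pidN x : x \in P -> - x \in P.
Proof. by rewrite -mulN1r; apply: pidMl. Qed.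
Lemma pidB x y : x \in P -> y \in P -> x - y \in P.
Proof. by move=> xP yP; apply: pidD => //; apply: pidN. Qed.
Lemma pid_unit x : x \is a GRing.unit -> x \notin P.
Proof.
move=> xu; apply/negP => /(pidMl x^-1); rewrite mulVr //.
by case: primeP => -[_ /negP].
Qed.
Lemma pid_prime x y : x * y \in P -> (x \in P) || (y \in P).
Proof. by case: primeP => _ h; apply: h. Qed.
Lemma pid_prime_expn x n : x ^+ n \in P -> x \in P.
Proof.
elim: n => [|n IH]; last by rewrite exprS => /pid_prime/orP[//|/IH].
by rewrite expr0 (negPf (pid_unit (unitr1 _))).
Qed.
Lemma pid_prod_notin (I : finType) (Q : pred I) (F : I -> powser R) :
  (forall i, Q i -> F i \notin P) -> \prod_(i | Q i) F i \notin P.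
Proof.
move=> h; apply: (big_ind (fun x => x \notin P)) => //.
  exact: pid_unit (unitr1 _).
move=> x y xP yP; apply/negP => /pid_prime.
by rewrite (negPf xP) (negPf yP).
Qed.

Hypothesis piP : C pi \notin P.

(** An element of least Weierstrass degree generates: remainders stay in P after powers of [pi] are
    cancelled, because [pi] is outside P. *)
Lemma prime_principal x : x \in P -> x != 0 -> exists p e,
  [/\ wd p e, (0 < e)%N, p \in P & forall a, a \in P -> in_ideal p a].
Proof.
have piN n g : C pi ^+ n * g \in P -> g \in P.
  by move/pid_prime => /orP[/pid_prime_expn|//]; rewrite (negPf piP).
move=> xP x0; pose S n := `[< exists p, wd p n /\ p \in P >].
have exS : exists n, S n.
  have [n [g [E g0]]] := gauss_factor x0; have [d gd] := wd_exists g0.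
  by exists d; apply/asboolP; exists g; split=> //; apply: (piN n); rewrite -E.
case: (ex_minnP exS) => e /asboolP[p [pe pP]] emin; exists p, e; split=> //.
  rewrite lt0n; apply/eqP => e0; rewrite e0 in pe.
  by have /pid_unit := (wd0_unit p).1 pe; rewrite pP.
move=> a aP; have [q [->|[n [m [r [me rm E]]]]]] := weierstrass_remainder a pe.
  by exists q; rewrite mulrC.
have rP : r \in P.
  apply: (piN n); have -> : C pi ^+ n * r = a - q * p by rewrite E; ring.
  by apply: pidB => //; apply: pidMl.
have /emin : S m by apply/asboolP; exists r.
by rewrite leqNgt me.
Qed.
End Ideals.

Lemma pi_notin_pideal p : mred p != 0 -> p \isn't a GRing.unit -> C pi \notin pideal p.
Proof.
move=> p0 pu; apply/pidealP => -[c cE].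
have := @pi_cancel_dvd p c 1 1 p0; rewrite expr1 mulr1 => /(_ (esym cE))[y y1].
by move/negP: pu; apply; apply/unitrPr; exists y.
Qed.

(** A nonzero prime Q inside (p) omits [pi], so it is generated by some p' = p d. If d were in Q,
    then p' would divide d and p would be a unit; so p is in Q. *)
Lemma pideal_prime_divisor p e : ps_prime p -> wd p e -> is_prime_divisor (pideal p).
Proof.
move=> pp pe; split; first exact: pideal_prime.
  exists p; first by apply/pidealP; exists 1; rewrite mulr1.
  by apply: contraTneq (wd_neq0 pe) => ->; rewrite rmorph0 eqxx.
move=> Q Qprime [x xQ x0] QP a /pidealP[c ->].
have piQ : C pi \notin Q.
  apply/negP => /QP; apply/negP; apply: pi_notin_pideal; last by case: pp.
  exact: wd_neq0 pe.
have [p' [e' [pe' e'0 p'Q p'gen]]] := prime_principal Qprime piQ xQ x0.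
have /pidealP[d dE] := QP _ p'Q.
apply: (pidMr Qprime); move: p'Q; rewrite dE => /(pid_prime Qprime)/orP[//|].
move=> /p'gen[y yE].
have p'0 : p' != 0 by apply: contraTneq (wd_neq0 pe') => ->; rewrite rmorph0 eqxx.
have : p' * (p * y) = p' * 1 by rewrite mulr1 mulrCA -yE -dE.
move/(mulfI p'0) => py; case: pp => /negP[]; by apply/unitrPr; exists y.
Qed.
End Weierstrass.

(** * Evaluation and substitution *)

Section Evaluation.
Variables (R : idomainType) (k : fieldType) (pi : R) (red : {rmorphism R -> k}).
Hypothesis dvr : is_complete_dvr pi.
Hypothesis res : is_residue_map pi red.
Local Notation C := (@powserC R).
Local Notation X := (powserX R).
Local Notation mred := (map_powser red).
Local Notation wd := (wd red).
Implicit Types f g h p q : powser R.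

Lemma mred_linear b : red b = 0 -> mred (X - C b) = powserX k.
Proof. by move=> b0; rewrite rmorphB /= map_powserX map_powserC b0 rmorph0 subr0. Qed.

Lemma wd_linear b : red b = 0 -> wd (X - C b) 1.
Proof. by move=> b0; exists 1; rewrite ?unitr1 // mred_linear // mulr1. Qed.

Lemma linear_neq0 b : X - C b != 0.
Proof.
apply/eqP => /(congr1 (fun f => pcoef f 1%N)); rewrite pcoefB pcoefC subr0.
by move/eqP; rewrite oner_eq0.
Qed.

(** Comparing coefficients gives q_n = b q_(n+1), so [r] is divisible by every power of [b], hence
    of [pi]. This yields uniqueness of the remainder modulo [X - C b]. *)
Lemma linear_const b q r : red b = 0 -> (X - C b) * q = C r -> r = 0.
Proof.
move=> b0 E; have E0 : r = - (b * pcoef q 0%N).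
  have := congr1 (fun f => pcoef f 0%N) E.
  by rewrite mulrBl pcoefB pcoefXM pcoefMC sub0r.
have Eq n : pcoef q n = b * pcoef q n.+1.
  have := congr1 (fun f => pcoef f n.+1) E.
  by rewrite mulrBl pcoefB pcoefXM pcoefMC => /eqP; rewrite subr_eq0 => /eqP.
have Ebn n : pcoef q 0%N = b ^+ n * pcoef q n.
  by elim: n => [|n ->]; rewrite ?mul1r // exprSr -mulrA -Eq.
have [b' bE] := red_eq0 res b0.
suff : C r = 0 by rewrite -(rmorph0 (@powserC R)) => /powserC_inj.
apply: (pi_separated dvr res) => n; exists (C (- (b * b' ^+ n * pcoef q n))).
rewrite E0 (Ebn n) {2}bE exprMn -rmorphXn -rmorphM; congr (C _); ring.
Qed.

(** The value at [b] is taken as a remainder, which avoids summing a series. The default 0 is never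
    reached when [b] has residue 0, by [evP]. *)
Definition ev b f : R := xget 0 [set r | exists q, f = (X - C b) * q + C r]%classic.

Lemma ev_eq b f q r : red b = 0 -> f = (X - C b) * q + C r -> ev b f = r.
Proof.
move=> b0 E; rewrite /ev; case: xgetP => [r' _ [q' E']|/(_ r) []]; last by exists q.
apply/eqP; rewrite -subr_eq0; apply/eqP/(@linear_const b (q - q')) => //.
have -> : (X - C b) * (q - q') =
  ((X - C b) * q + C r) - ((X - C b) * q' + C r') + C r' - C r by ring.
by rewrite -E -E' rmorphB; ring.
Qed.

Lemma evP b f : red b = 0 -> exists q, f = (X - C b) * q + C (ev b f).
Proof.
move=> b0; have [q [r [E short]]] := weierstrass_division dvr res f (wd_linear b0).
have E' : f = (X - C b) * q + C (pcoef r 0%N).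
  rewrite E mulrC; congr (_ + _); apply: powserP => -[|n] //.
  by rewrite short.
by exists q; rewrite (ev_eq b0 E').
Qed.

Section Point.
Variable b : R.
Hypothesis b0 : red b = 0.
Local Notation L := (X - C b).

Lemma evB f g : ev b (f - g) = ev b f - ev b g.
Proof.
have [q E] := evP f b0; have [q' E'] := evP g b0.
by apply: (ev_eq (q := q - q') b0); rewrite {1}E {1}E' rmorphB; ring.
Qed.
Lemma evM f g : ev b (f * g) = ev b f * ev b g.
Proof.
have [q E] := evP f b0; have [q' E'] := evP g b0.
apply: (ev_eq (q := q * g + C (ev b f) * q') b0).
by rewrite {1}E rmorphM mulrDl {2}E'; ring.
Qed.
Lemma evC c : ev b (C c) = c.
Proof. by apply: (ev_eq (q := 0) b0); rewrite mulr0 add0r. Qed.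
Lemma evX : ev b X = b.
Proof. by apply: (ev_eq (q := 1) b0); rewrite mulr1 subrK. Qed.
Lemma ev_linear c : ev b (X - C c) = b - c.
Proof. by rewrite evB evX evC. Qed.
Lemma ev0 : ev b 0 = 0. Proof. by rewrite -(rmorph0 (@powserC R)) evC. Qed.
Lemma evD f g : ev b (f + g) = ev b f + ev b g.
Proof.
have -> : f + g = f - (0 - g) by ring.
by rewrite !evB ev0; ring.
Qed.
Lemma ev1 : ev b 1 = 1. Proof. by rewrite -(rmorph1 (@powserC R)) evC. Qed.
Lemma evXn f n : ev b (f ^+ n) = ev b f ^+ n.
Proof. by elim: n => [|n IH]; rewrite ?ev1 // !exprS evM IH. Qed.
Lemma ev_prod I (r : seq I) (F : I -> powser R) :
  ev b (\prod_(i <- r) F i) = \prod_(i <- r) ev b (F i).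
Proof. exact: (big_morph _ evM ev1). Qed.

Lemma ev_dvd f : in_ideal L f <-> ev b f = 0.
Proof.
split=> [[q ->]|f0]; first by rewrite evM ev_linear subrr mul0r.
by have [q] := evP f b0; rewrite f0 rmorph0 addr0; exists q.
Qed.

Lemma red_ev f : red (ev b f) = red (pcoef f 0%N).
Proof.
have [q {2}->] := evP f b0; rewrite pcoefD pcoefM0 /= rmorphD rmorphM rmorphB.
by rewrite rmorph0 b0 subr0 mul0r add0r.
Qed.

Lemma linear_prime : ps_prime L.
Proof.
split.
  apply/negP => /unitrPr[g gE].
  have : ev b (L * g) = 0 by rewrite evM ev_linear subrr mul0r.
  by rewrite gE ev1 => /eqP; rewrite oner_eq0.
move=> f g /ev_dvd/eqP; rewrite evM mulf_eq0 => /orP[] /eqP h; [left|right];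
  exact/ev_dvd.
Qed.

(** * Taylor expansion at a point and the substitution T = b + rho X *)

Definition taylor_of f (a : nat -> R) := forall n, exists h,
  f = \sum_(i < n) C (a i) * L ^+ i + L ^+ n * h.

Lemma taylor_exists f : exists a, taylor_of f a.
Proof.
have [d dE] := choice (fun f => evP f b0).
exists (fun n => ev b (iter n d f)) => n; exists (iter n d f).
elim: n => [|n IH]; first by rewrite big_ord0 add0r mul1r.
rewrite {1}IH big_ord_recr /= -addrA; congr (_ + _).
by rewrite {1}(dE (iter n d f)) exprSr; ring.
Qed.

Lemma taylor_uniq f a a' : taylor_of f a -> taylor_of f a' -> a =1 a'.
Proof.
move=> ha ha' n; elim/ltn_ind: n => n IH.
have [h E] := ha n.+1; have [h' E'] := ha' n.+1.
have : L ^+ n * (L * h + C (a n)) = L ^+ n * (L * h' + C (a' n)).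
  have S : \sum_(i < n) C (a i) * L ^+ i = \sum_(i < n) C (a' i) * L ^+ i.
    by apply: eq_bigr => i _; rewrite IH.
  apply: (addrI (\sum_(i < n) C (a i) * L ^+ i)).
  rewrite {2}S; move: E'; rewrite {1}E !big_ord_recr /= !exprSr => E'.
  transitivity (\sum_(i < n) C (a i) * L ^+ i + C (a n) * L ^+ n + L ^+ n * L * h).
    by ring.
  by rewrite E'; ring.
move/(mulfI (expf_neq0 n (linear_neq0 b)))/(congr1 (ev b)).
by rewrite !evD !evM !evC ev_linear subrr !mul0r !add0r.
Qed.

Lemma taylorB f g a c : taylor_of f a -> taylor_of g c ->
  taylor_of (f - g) (fun i => a i - c i).
Proof.
move=> ha hc n; have [h ->] := ha n; have [h' ->] := hc n.
have S : \sum_(i < n) C (a i - c i) * L ^+ i =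
    \sum_(i < n) C (a i) * L ^+ i - \sum_(i < n) C (c i) * L ^+ i.
  by rewrite -sumrB; apply: eq_bigr => i _; rewrite rmorphB mulrBl.
by exists (h - h'); rewrite S; ring.
Qed.

Lemma taylorM f g a c : taylor_of f a -> taylor_of g c ->
  taylor_of (f * g) (pcoef (PowSer a * PowSer c)).
Proof.
move=> ha hc n; have [h fE] := ha n; have [h' gE] := hc n.
(* Truncations become polynomials evaluated at [L], so the product can be cut with [take_poly] and
   [drop_poly]. *)
pose hp (p : {poly R}) := (map_poly (@powserC R) p).[L].
have hpE (u : nat -> R) : \sum_(i < n) C (u i) * L ^+ i = hp (\poly_(i < n) u i).
  rewrite /hp (horner_coef_wide _ (n := n)); last first.
    by apply/leq_sizeP => l nl; rewrite coef_map coef_poly ltnNge nl; apply: rmorph0.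
  by apply: eq_bigr => i _; rewrite coef_map coef_poly ltn_ord.
pose p := \poly_(i < n) a i; pose q := \poly_(i < n) c i.
have hpM : hp (p * q) = hp p * hp q by rewrite /hp rmorphM hornerM.
rewrite hpE -/p in fE; rewrite hpE -/q in gE.
rewrite hpE; exists (hp (drop_poly n (p * q)) + hp p * h' + h * hp q + L ^+ n * h * h').
have -> : \poly_(i < n) pcoef (PowSer a * PowSer c) i = take_poly n (p * q).
  apply/polyP => i; rewrite coef_poly coef_take_poly; case: ifP => // i_n.
  by apply: (ps_mul_coef i_n) => l l_n; rewrite coef_poly l_n.
have tdE : hp p * hp q = hp (take_poly n (p * q)) + hp (drop_poly n (p * q)) * L ^+ n.
  rewrite -hpM -[in LHS](poly_take_drop n (p * q)) /hp rmorphD rmorphM /=.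
  by rewrite map_polyXn hornerD hornerM hornerXn.
transitivity (hp p * hp q + L ^+ n * (hp p * h' + h * hp q + L ^+ n * h * h')).
  by rewrite fE gE; ring.
by rewrite tdE; ring.
Qed.

Lemma taylorC c : taylor_of (C c) (pcoef (C c)).
Proof.
case=> [|n]; first by exists (C c); rewrite big_ord0 add0r mul1r.
exists 0; rewrite mulr0 addr0 big_ord_recl /= mulr1 big1 ?addr0 // => i _.
by rewrite rmorph0 mul0r.
Qed.

Lemma taylorX : taylor_of X (pcoef (X + C b)).
Proof.
case=> [|[|n]].
- by exists X; rewrite big_ord0 add0r mul1r.
- by exists 1; rewrite big_ord1 pcoefD /=; rewrite add0r; ring.
- exists 0; rewrite mulr0 addr0 2!big_ord_recl big1 ?addr0 => [|i _].
    by rewrite !pcoefD !pcoefC /= add0r addr0 rmorph1; ring.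
  by rewrite pcoefD /= addr0 rmorph0 mul0r.
Qed.

Variable rho : R.

(** The series f(b + rho X), read off from the Taylor coefficients of [f] at [b]. *)
Definition rescale f : powser R :=
  PowSer (fun n => rho ^+ n * (projT1 (cid (taylor_exists f))) n).

Lemma rescaleE f a : taylor_of f a -> rescale f = PowSer (fun n => rho ^+ n * a n).
Proof.
move=> ha; apply: powserP => n /=; case: cid => a' ha' /=.
by rewrite (taylor_uniq ha' ha).
Qed.

Lemma rescaleB : {morph rescale : f g / f - g}.
Proof.
move=> f g; have [a ha] := taylor_exists f; have [c hc] := taylor_exists g.
rewrite (rescaleE (taylorB ha hc)) (rescaleE ha) (rescaleE hc).
by apply: powserP => n /=; rewrite mulrBr.
Qed.

Lemma rescale_monoid : monoid_morphism rescale.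
Proof.
split=> [|f g].
  rewrite -(rmorph1 (@powserC R)) (rescaleE (taylorC 1)); apply: powserP => -[|n] /=.
    by rewrite mulr1.
  by rewrite mulr0.
have [a ha] := taylor_exists f; have [c hc] := taylor_exists g.
rewrite (rescaleE (taylorM ha hc)) (rescaleE ha) (rescaleE hc).
apply: powserP => n; rewrite [LHS]/= pcoefM mulr_sumr; apply: eq_bigr => i _ /=.
have -> : rho ^+ n = rho ^+ i * rho ^+ (n - i) by rewrite -exprD subnKC ?leq_ord.
by ring.
Qed.

HB.instance Definition _ :=
  GRing.isZmodMorphism.Build (powser R) (powser R) rescale rescaleB.
HB.instance Definition _ :=
  GRing.isMonoidMorphism.Build (powser R) (powser R) rescale rescale_monoid.

Lemma substitution : exists Phi : {rmorphism powser R -> powser R},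
  [/\ forall c, Phi (C c) = C c, Phi X = C rho * X + C b &
      forall f, red rho = 0 -> mred (Phi f) = powserC (red (pcoef f 0%N))].
Proof.
exists rescale; split=> [c||f r0] /=.
- rewrite (rescaleE (taylorC c)); apply: powserP => -[|n] /=; first by rewrite mul1r.
  by rewrite mulr0.
- rewrite (rescaleE taylorX); apply: powserP => n.
  rewrite pcoefD pcoefMC pcoefC /=; case: n => [|[|n]] /=.
  + by rewrite mul1r mulr0.
  + by rewrite !addr0 expr1.
  + by rewrite !addr0 !mulr0.
- have [a ha] := taylor_exists f; rewrite (rescaleE ha); apply: powserP => -[|n] /=.
    have [h fE] := ha 1%N; have := red_ev f; rewrite {1}fE big_ord1.
    by rewrite evD !evM evC !evXn ev_linear subrr mul0r addr0 !expr0 mulr1 mul1r => ->.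
  by rewrite exprS !rmorphM r0 !mul0r.
Qed.
End Point.
End Evaluation.

(** * Lifts of Artin-Schreier generators *)

(** The kernel of [a] is the Klein group that fixes X_a, and [v] represents the nontrivial coset,
    which conjugates X_a. *)
Lemma kernel_generators a : a != bzero -> exists h1 h2 v,
  [/\ [&& h1 != bzero, h2 != bzero & h1 != h2], [&& ~~ dot a h1, ~~ dot a h2 & dot a v] &
  forall u, u \in if dot a u then [:: v; badd v h1; badd v h2; badd v (badd h1 h2)]
                  else [:: bzero; h1; h2; badd h1 h2]].
Proof.
have : all (fun a => (a != bzero) ==> has (fun h1 => has (fun h2 => has (fun v =>
  [&& [&& h1 != bzero, h2 != bzero & h1 != h2], [&& ~~ dot a h1, ~~ dot a h2 & dot a v] &
  all (fun u => u \in if dot a u then [:: v; badd v h1; badd v h2; badd v (badd h1 h2)]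
                  else [:: bzero; h1; h2; badd h1 h2]) all_bool3])
  all_bool3) all_bool3) all_bool3) all_bool3 by vm_compute.
move=> /allP /(_ a (mem_all_bool3 a)) /implyP h /h /hasP[h1 _] /hasP[h2 _] /hasP[v _].
move=> /and3P[A B /allP D]; exists h1, h2, v; split=> // u.
exact: D _ (mem_all_bool3 u).
Qed.

Definition is_bool3_action (S : comNzRingType) (iota : {rmorphism powser S -> powser S})
    (s : bool3 -> {rmorphism powser S -> powser S}) : Prop :=
  [/\ injective iota, forall c, iota (powserC c) = powserC c,
      forall x, s bzero x = x, forall u v x, s (badd u v) x = s u (s v x) &
      forall x, (forall v, s v x = x) <-> exists a, x = iota a].

Section Action.
Variables (S : comNzRingType) (iota : {rmorphism powser S -> powser S})
  (s : bool3 -> {rmorphism powser S -> powser S}).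
Hypothesis act : is_bool3_action iota s.

Lemma act_inj : injective iota. Proof. by case: act. Qed.
Lemma act_C c : iota (powserC c) = powserC c. Proof. by case: act. Qed.
Lemma act_0 x : s bzero x = x. Proof. by case: act. Qed.
Lemma act_D u v x : s (badd u v) x = s u (s v x). Proof. by case: act. Qed.
Lemma act_fixed x : (forall v, s v x = x) -> exists a, x = iota a.
Proof. by case: act => _ _ _ _ h /h. Qed.
Lemma act_iota v a : s v (iota a) = iota a.
Proof. by case: act => _ _ _ _ h; apply: (proj2 (h (iota a))); exists a. Qed.
Lemma act_const v c : s v (powserC c) = powserC c.
Proof. by rewrite -act_C act_iota. Qed.
Lemma act_K v x : s v (s v x) = x. Proof. by rewrite -act_D baddvv act_0. Qed.
Lemma act_comm u v x : s u (s v x) = s v (s u x).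
Proof. by rewrite -!act_D baddC. Qed.
End Action.

Section Lift.
Variables (R : idomainType) (k : closedFieldType) (pi : R) (red : {rmorphism R -> k}).
Hypothesis dvr : is_complete_dvr pi.
Hypothesis res : is_residue_map pi red.
Hypothesis char2 : 2%N \in [pchar k].
Variables (iota : {rmorphism powser R -> powser R})
  (s : bool3 -> {rmorphism powser R -> powser R}).
Variables (iotak : {rmorphism powser k -> powser k})
  (sk : bool3 -> {rmorphism powser k -> powser k}).
Hypothesis act : is_bool3_action iota s.
Hypothesis actk : is_bool3_action iotak sk.
Hypothesis faithful : forall v, v != bzero -> exists y, sk v y != y.
Local Notation mred := (map_powser red).
Hypothesis red_iota : forall a, mred (iota a) = iotak (mred a).
Hypothesis red_s : forall v x, mred (s v x) = sk v (mred x).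
Local Notation t := (iotak (powserX k)).

(** The norm [N] of the parameter reduces to an element of order exactly 4, and by [klein_order] the
    orders of invariants are multiples of 4. So every leading term is matched by a lifted constant
    times a power of [N]. *)
Lemma lift_fixed h1 h2 M x : [&& h1 != bzero, h2 != bzero & h1 != h2] ->
  sk h1 x = x -> sk h2 x = x ->
  exists w, [/\ s h1 w = w, s h2 w = w & ps_ge M (x - mred w)].
Proof.
move=> /and3P[h10 h20 h12] x1 x2.
have h120 : badd h1 h2 != bzero.
  by move: h10 h20 h12; case: h1 {x1} => [[[] []] []]; case: h2 {x2} => [[[] []] []].
have nt12 : exists y, sk h1 (sk h2 y) != y.
  by have [y] := faithful h120; rewrite (act_D actk); exists y.
have k1 := act_K actk h1; have k2 := act_K actk h2.
have k12 := act_comm actk h1 h2.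
have c1 := act_const actk h1; have c2 := act_const actk h2.
have n1 := faithful h10; have n2 := faithful h20.
have [u uu NE] := klein_norm k1 k2.
pose Z := powserX R; pose N := Z * s h1 Z * (s h2 Z * s h1 (s h2 Z)).
have N1 : s h1 N = N.
  by rewrite /N !rmorphM /= !(act_K act); ring.
have N2 : s h2 N = N.
  by rewrite /N !rmorphM /= -!(act_comm act h1) !(act_K act); ring.
have NkE : mred N = powserX k ^+ 4 * u.
  by rewrite -NE /N !rmorphM /= !red_s map_powserX.
have [||||_ [[w [w1 w2 <-]] xw]] := @ps_approx _ (fun x => sk h1 x = x /\ sk h2 x = x)
  (fun y => exists w, [/\ s h1 w = w, s h2 w = w & mred w = y]) _ _ _ _ M x (conj x1 x2).
- move=> y _ [y1 y2] [w [w1 w2 <-]].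
  by rewrite !rmorphB -!red_s w1 w2 y1 y2.
- move=> _ _ [w [w1 w2 <-]] [w' [w1' w2' <-]]; exists (w + w').
  by rewrite !rmorphD w1 w2 w1' w2'.
- by exists 0; rewrite !rmorph0.
- move=> n y [y1 y2] yn; have [yn0|yn0] := eqVneq (pcoef y n) 0.
    exists 0; split; first by exists 0; rewrite !rmorph0.
    by rewrite subr0; apply: ps_geS.
  have /ps_geP[y' yE] := yn.
  have y'u : y' \is a GRing.unit.
    by rewrite powser_unit unitfE; move: yn0; rewrite yE pcoefXnM leqnn subnn.
  rewrite yE in y1 y2.
  have n4 := klein_order k1 k2 k12 c1 c2 n1 n2 nt12 y'u y1 y2.
  have NnE : mred N ^+ (n %/ 4) = powserX k ^+ n * u ^+ (n %/ 4).
    rewrite NkE exprMn -exprM; congr (_ ^+ _ * _).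
    by rewrite mulnC divnK.
  have [c cE] := red_surj res (pcoef y n / pcoef (u ^+ (n %/ 4)) 0%N).
  exists (mred (powserC c * N ^+ (n %/ 4))); split.
    exists (powserC c * N ^+ (n %/ 4)).
    by rewrite !rmorphM !rmorphXn /= N1 N2 !(act_const act).
  rewrite rmorphM rmorphXn /= map_powserC cE.
  by apply: (ps_kill NnE); rewrite ?unitrX.
by exists w.
Qed.

(** If t were a unit, its inverse would be invariant too, and the variable of k[[t]] would be
    invertible there. *)
Lemma t_order : exists e u, [/\ (0 < e)%N, u \is a GRing.unit & t = powserX k ^+ e * u].
Proof.
have t0 : t != 0.
  by rewrite -(rmorph0 iotak) (inj_eq (act_inj actk)) powserX_neq0.
have [[|e] [u [tE uu]]] := powser_factor t0; last by exists e.+1, u.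
have tu : t \is a GRing.unit by rewrite tE mul1r.
have [b bE] : exists b, t^-1 = iotak b.
  apply: (act_fixed actk) => v; apply: (mulrI tu).
  by rewrite -{1}(act_iota actk v (powserX k)) -rmorphM divrr // rmorph1.
have : iotak (powserX k * b) = iotak 1 by rewrite rmorphM rmorph1 -bE divrr.
move/(act_inj actk)/(congr1 (fun z : powser k => pcoef z 0%N)).
by rewrite pcoefM0 /= mul0r => /esym/eqP; rewrite oner_eq0.
Qed.

Lemma iotak_ge e u n x : t = powserX k ^+ e * u -> u \is a GRing.unit -> (0 < e)%N ->
  ps_ge (e * n) (iotak x) -> ps_ge n x.
Proof.
move=> tE uu e0; have [->//|x0] := eqVneq x 0.
have [m [v [-> vu]]] := powser_factor x0.
rewrite rmorphM rmorphXn tE exprMn -exprM -mulrA => /ps_ge_unit.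
rewrite unitrM unitrX // rmorph_unit // => /(_ isT).
by rewrite leq_pmul2l // => nm; apply: (ps_ge_leq nm); apply: ps_ge_X.
Qed.

Variables (XX : bool3 -> powser k) (e : bool3 -> 'I_4 -> k).
Hypothesis XX_eq : forall a, XX a ^+ 2 - t ^+ 2 * XX a = iotak (as_rhs (e a)).
Hypothesis XX_act : forall a v, sk v (XX a) = XX a + (if dot a v then t ^+ 2 else 0).
Hypothesis e_neq0 : forall a, a != bzero -> e a ord0 != 0.

(* Kummer data for the character [a]: [w] generates the quadratic subring cut
   out by [a], with trace [f] and norm [- h], so that [2 w - f] is an
   eigenvector whose square is [f ^+ 2 + 4 h]. *)
Record kummer (a : bool3) (w f h : powser R) : Prop := Kummer {
  kummer_act : forall u, s u w = if dot a u then iota f - w else w;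
  kummer_norm : w * (iota f - w) = - iota h;
  kummer_f : ps_ge 3 (mred f - powserX k ^+ 2);
  kummer_h0 : pcoef (mred h) 0%N = 0;
  kummer_h1 : pcoef (mred h) 1%N != 0
}.

Lemma kummer_exists a : a != bzero -> exists w f h, kummer a w f h.
Proof.
move=> a0; have [h1 [h2 [v [hh /and3P[ah1 ah2 av] cosets]]]] := kernel_generators a0.
(* Order [e0 * 3] in z is order 3 in t, which determines the reductions of f and h up to t ^ 2. *)
have [e0 [u [e00 uu tE]]] := t_order; pose M := (e0 * 3)%N.
have fix1 : sk h1 (XX a) = XX a by rewrite XX_act (negPf ah1) addr0.
have fix2 : sk h2 (XX a) = XX a by rewrite XX_act (negPf ah2) addr0.
have [w [w1 w2 wX]] := lift_fixed M hh fix1 fix2.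
pose w' := s v w.
have sw' u' : s u' w' = s v (s u' w) by rewrite (act_comm act).
have sw u' : s u' w = if dot a u' then w' else w.
  have := cosets u'; case: ifP => _; rewrite !inE => /or4P[] /eqP->;
  by rewrite ?(act_D act) ?(act_0 act) ?w2 ?w1.
have ww' u' : s u' w' = if dot a u' then w else w'.
  by rewrite sw' sw; case: ifP => _ //; rewrite /w' (act_K act).
have [f fE] : exists f, w + w' = iota f.
  apply: (act_fixed act) => u'; rewrite rmorphD sw ww'.
  by case: ifP => _ //; rewrite addrC.
have [h hE] : exists h, - (w * w') = iota h.
  apply: (act_fixed act) => u'; rewrite rmorphN rmorphM sw ww'.
  by case: ifP => _ //; rewrite mulrC.
have w'E : w' = iota f - w by rewrite -fE addrC addKr.
pose d := XX a - mred w; have dM : ps_ge M d by [].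
pose d' := sk v d; have d'M : ps_ge M d'.
  by apply: (aut_ge (tau := sk v)) => // z; rewrite (act_K actk).
have mwE : mred w = XX a - d by rewrite /d subKr.
have mw'E : mred w' = XX a + t ^+ 2 - d'.
  by rewrite /w' red_s mwE rmorphB XX_act av.
have two0 : 2%:R = 0 :> powser k := powser_two0 char2.
(* The conjugates of X_a are X_a and X_a + t ^ 2, of trace t ^ 2 in characteristic 2; [d] and [d']
   are the errors of the lift. *)
have fmod : ps_ge 3 (mred f - powserX k ^+ 2).
  apply: (iotak_ge tE uu e00); rewrite rmorphB rmorphXn -red_iota -fE rmorphD /=.
  have -> : mred w + mred w' - t ^+ 2 = 2%:R * XX a - d - d'.
    by rewrite mwE mw'E; ring.
  by rewrite two0 mul0r; apply: ps_geB => //; apply: ps_geB.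
have hmod : ps_ge 3 (mred h - as_rhs (e a)).
  apply: (iotak_ge tE uu e00); rewrite rmorphB -red_iota -hE rmorphN rmorphM -XX_eq /=.
  have -> : - (mred w * mred w') - (XX a ^+ 2 - t ^+ 2 * XX a) =
     d * (XX a + t ^+ 2 - d') + XX a * d' - 2%:R * XX a ^+ 2.
    by rewrite mwE mw'E; ring.
  rewrite two0 mul0r subr0; apply: ps_geD; first exact: ps_geMr.
  exact: ps_geMl.
have rhs01 : pcoef (as_rhs (e a)) 0%N = 0 /\ pcoef (as_rhs (e a)) 1%N = e a ord0.
  rewrite /as_rhs !pcoef_sum; split.
    by rewrite big1 // => i _; rewrite pcoefMC pcoefXn mulr0.
  rewrite big_ord_recl pcoefMC pcoefXn eqxx mulr1 big1 ?addr0 // => i _.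
  by rewrite pcoefMC pcoefXn mulr0.
exists w, f, h; split=> //.
- by move=> u'; rewrite sw w'E.
- by rewrite -w'E -hE opprK.
- by have := hmod 0%N isT; rewrite pcoefB rhs01.1 subr0.
- have := hmod 1%N isT; rewrite pcoefB rhs01.2 => /eqP; rewrite subr_eq0 => /eqP->.
  exact: e_neq0.
Qed.

End Lift.

(** * Branch points of the quadratic subcovers *)

Lemma count_two (T : eqType) (x0 : T) (r : seq T) i j : (i < j)%N -> (j < size r)%N ->
  nth x0 r i = nth x0 r j -> (1 < count_mem (nth x0 r j) r)%N.
Proof.
move=> ij jr E; rewrite -[r in count_mem _ r](cat_take_drop j) count_cat.
have := @leq_add 1 1 _ _ (_ : (0 < count_mem _ _)%N) (_ : (0 < count_mem _ _)%N).
apply; rewrite -has_count has_pred1.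
  by rewrite -E -(nth_take _ ij) mem_nth // size_take jr.
by rewrite (drop_nth x0 jr) mem_head.
Qed.

Section BranchLocus.
Variables (R : idomainType) (k : closedFieldType) (pi : R) (red : {rmorphism R -> k}).
Hypothesis dvr : is_complete_dvr pi.
Hypothesis res : is_residue_map pi red.
Hypothesis char2 : 2%N \in [pchar k].
Hypothesis two_neq0 : (2%:R : R) != 0.
Variables (iota : {rmorphism powser R -> powser R})
  (s : bool3 -> {rmorphism powser R -> powser R}).
Variables (iotak : {rmorphism powser k -> powser k})
  (sk : bool3 -> {rmorphism powser k -> powser k}).
Hypothesis act : is_bool3_action iota s.
Hypothesis actk : is_bool3_action iotak sk.
Local Notation mred := (map_powser red).
Hypothesis red_iota : forall a, mred (iota a) = iotak (mred a).
Hypothesis rational : branch_points_rational pi iota.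
Local Notation C := (@powserC R).
Local Notation X := (powserX R).
Local Notation wd := (wd red).
Local Notation kummer := (kummer red iota s).

Definition radicand (f h : powser R) := f ^+ 2 + 4%:R * h.

Lemma mred_two : mred 2%:R = 0.
Proof. by rewrite rmorph_nat (powser_two0 char2). Qed.

Lemma two_notin p n : ps_prime p -> wd p n -> ~ in_ideal p 2%:R.
Proof.
move=> [pu _] pn [c cE]; have [u [m [uu mE]]] := dvr_factor dvr two_neq0.
have E : p * c = C pi ^+ m * C u.
  by rewrite -cE -rmorphXn -rmorphM mulrC -mE rmorph_nat.
have [c' c'E] := pi_cancel_dvd dvr res (wd_neq0 pn) E.
move/negP: pu; apply; apply/unitrPr; exists (c' * C u^-1).
by rewrite mulrA -c'E -rmorphM divrr // rmorph1.
Qed.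

Section Kummer.
Variables (a : bool3) (w f h : powser R).
Hypothesis K : kummer a w f h.

Lemma kummer_square : (2%:R * w - iota f) ^+ 2 = iota (radicand f h).
Proof.
rewrite rmorphD rmorphXn (rmorphM iota 4%:R) rmorph_nat.
have -> : (2%:R * w - iota f) ^+ 2 = iota f ^+ 2 - 4%:R * (w * (iota f - w)) by ring.
by rewrite (kummer_norm K); ring.
Qed.

Lemma kummer_eigen u :
  s u (2%:R * w - iota f) = if dot a u then - (2%:R * w - iota f) else 2%:R * w - iota f.
Proof.
rewrite rmorphB (rmorphM (s u)) rmorph_nat (act_iota act) (kummer_act K).
by case: ifP => _ //; ring.
Qed.

Lemma radicand_wd : wd (radicand f h) 4.
Proof.
have /ps_geP[g gE] := kummer_f K.
have fE : mred f = powserX k ^+ 2 * (1 + powserX k * g).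
  by rewrite -[LHS](subrK (powserX k ^+ 2)) gE; ring.
exists ((1 + powserX k * g) ^+ 2).
  by rewrite unitrX // powser_unit pcoefD pcoef1 pcoefXM addr0 unitr1.
rewrite rmorphD rmorphXn /= fE (_ : 4%:R * h = 2%:R * (2%:R * h)); last by ring.
by rewrite rmorphM /= mred_two; ring.
Qed.

(* A square factor of [f ^+ 2 + 4 h] also divides the derivative
   [2 (f f' + 2 h')], hence [h f' ^+ 2 + h' ^+ 2], which is a unit. *)
Lemma radicand_squarefree p n : ps_prime p -> wd p n ->
  ~ in_ideal (p ^+ 2) (radicand f h).
Proof.
move=> pp pn [c cE].
have p2 := two_notin pp pn; have [pu pprime] := pp.
have dE : psderiv (radicand f h) = 2%:R * (f * psderiv f + 2%:R * psderiv h).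
  rewrite /radicand expr2 psderivD psderivM (_ : 4%:R * h = h *+ 4); last first.
    by rewrite mulr_natl.
  by rewrite psderivMn -mulr_natl; ring.
have [d dd] : in_ideal p (f * psderiv f + 2%:R * psderiv h).
  have : in_ideal p (2%:R * (f * psderiv f + 2%:R * psderiv h)).
    rewrite -dE cE psderivM expr2 psderivM.
    by exists (2%:R * psderiv p * c + p * psderiv c); ring.
  by case/pprime.
pose v := h * psderiv f ^+ 2 + psderiv h ^+ 2.
have /pprime[//|/pprime[//|pv]] : in_ideal p (2%:R * (2%:R * v)).
  (* From F f' ^ 2 - (f f' + 2 h') (f f' - 2 h') = 4 v. *)
  exists (p * c * psderiv f ^+ 2 - d * (f * psderiv f - 2%:R * psderiv h)).
  transitivity (p ^+ 2 * c * psderiv f ^+ 2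
    - p * d * (f * psderiv f - 2%:R * psderiv h)); last by ring.
  by rewrite -cE -dd /radicand /v; ring.
have vu : v \is a GRing.unit.
  have vE : mred v = mred h * mred (psderiv f) ^+ 2 + mred (psderiv h) ^+ 2.
    by rewrite rmorphD rmorphM !rmorphXn.
  rewrite (psunit_red dvr res) powser_unit unitfE vE pcoefD pcoefM0 (kummer_h0 K).
  rewrite mul0r add0r [mred (psderiv h) ^+ 2]expr2 pcoefM0 mulf_neq0 //;
  by rewrite /= mulr1n (kummer_h1 K).
have [x xE] := pv; move/negP: pu; apply; apply/unitrPr.
by exists (x * v^-1); rewrite mulrA -xE divrr.
Qed.
End Kummer.

(** The image of [p] has positive Weierstrass degree, hence a prime factor q. The contraction of (q)
    omits [pi], so it is principal; its generator divides the prime [p] and is not a unit. *)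
Lemma lying_over p n : ps_prime p -> wd p n -> (0 < n)%N ->
  exists Q, is_prime_ideal Q /\ lies_over iota Q (pideal p).
Proof.
move=> pp pn n0; have [e0 [u [e00 uu tE]]] := t_order actk.
have ipn : wd (iota p) (e0 * n).
  have [v vu vE] := pn; exists (u ^+ n * iotak v).
    by rewrite unitrM unitrX ?rmorph_unit.
  by rewrite red_iota vE rmorphM rmorphXn tE exprMn -exprM mulrA.
have [|q [m [qp qm m0 qip]]] := prime_factor dvr res ipn; first by rewrite muln_gt0 e00.
have Qp := pideal_prime qp; exists (pideal q); split=> // x.
pose P : {pred powser R} := fun x => iota x \in pideal q.
have PE y : (y \in P) = (iota y \in pideal q) by [].
have Pp : is_prime_ideal P.
  case: Qp => -[h0 h1 hD] hM; split; first split.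
  - by rewrite PE rmorph0.
  - by rewrite PE rmorph1.
  - by move=> b y z; rewrite !PE rmorphD rmorphM; apply: hD.
  - by move=> y z; rewrite !PE rmorphM; apply: hM.
have piP : C pi \notin P.
  rewrite PE (act_C act); apply: (pi_notin_pideal dvr res (wd_neq0 qm)).
  by case: qp.
have pP : p \in P by rewrite PE; apply/pidealP.
have p0 : p != 0 by apply: contraTneq (wd_neq0 pn) => ->; rewrite rmorph0 eqxx.
have [p' [n' [pn' n'0 p'P gen]]] := prime_principal dvr res Pp piP pP p0.
rewrite -PE; apply/idP/pidealP => [xP|[y ->]]; last first.
  exact: (pidMr Pp y pP).
have [c cE] := gen _ pP; have [z ->] := gen _ xP.
have [|[d dE]|[d dE]] := proj2 pp p' c; first by exists 1; rewrite mulr1 cE.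
- by exists (d * z); rewrite dE; ring.
- have : p * (p' * d) = p * 1 by rewrite mulr1 {2}cE dE; ring.
  move/(mulfI p0) => p'd; have p'u : p' \is a GRing.unit by apply/unitrPr; exists d.
  by move: p'P; rewrite (negPf (pid_unit Pp p'u)).
Qed.

(** The square root y of F lies in every Q above [p]. If [p] generated Q locally, y would be a local
    multiple of [p], and [p ^+ 2] would divide F = y ^ 2. *)
Lemma radicand_ramified a w f h p n : kummer a w f h ->
  ps_prime p -> wd p n -> (0 < n)%N -> in_ideal p (radicand f h) ->
  ramified_over iota (pideal p).
Proof.
move=> K pp pn n0 [c cE]; have [Q [Qp QP]] := lying_over pp pn n0.
exists Q; split=> // unram; pose y := 2%:R * w - iota f.
have yE : y ^+ 2 = iota (p * c) by rewrite -cE; apply: kummer_square K.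
have pQ : iota p \in Q by rewrite QP; apply/pidealP; exists 1; rewrite mulr1.
have yQ : y \in Q.
  apply: (pid_prime_expn Qp (n := 2)); rewrite yE rmorphM.
  exact: pidMr Qp _ _ pQ.
have [d [dQ [m [al [be [alP dE]]]]]] := unram _ yQ.
have [z zE] : exists z, d * y = iota p * z.
  have h' i : exists z, al i = p * z by apply/pidealP.
  have [g gE] := choice h'; exists (\sum_i iota (g i) * be i).
  by rewrite dE mulr_sumr; apply: eq_bigr => i _; rewrite gE rmorphM mulrA.
have ip0 : iota p != 0.
  rewrite -(rmorph0 iota) (inj_eq (act_inj act)).
  by apply: contraTneq (wd_neq0 pn) => ->; rewrite rmorph0 eqxx.
have E : d ^+ 2 * iota c = iota p * z ^+ 2.
  apply: (mulfI ip0); have -> : iota p * (d ^+ 2 * iota c) = d ^+ 2 * (iota p * iota c) by ring.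
  by rewrite -rmorphM -yE -exprMn zE; ring.
have : d ^+ 2 * iota c \in Q by rewrite E; apply: pidMr Qp _ _ pQ.
case/(pid_prime Qp)/orP => [/(pid_prime_expn Qp)|]; first by rewrite (negPf dQ).
rewrite QP => /pidealP[c' c'E]; apply: (radicand_squarefree K pp pn).
by exists c'; rewrite cE c'E; ring.
Qed.

Lemma branch_divisor_prime p n : ps_prime p -> wd p n ->
  ramified_over iota (pideal p) -> is_branch_divisor pi iota (pideal p).
Proof.
move=> pp pn ram; split=> //; first exact: (pideal_prime_divisor dvr res pp pn).
by apply: (pi_notin_pideal dvr res (wd_neq0 pn)); case: pp.
Qed.

Lemma in_ideal_red b : in_ideal pi b <-> red b = 0.
Proof. by case: res => _ /(_ b) [h1 h2]; split. Qed.

Lemma radicand_factor a w f h p n : kummer a w f h ->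
  ps_prime p -> wd p n -> (0 < n)%N -> in_ideal p (radicand f h) ->
  exists b, red b = 0 /\ in_ideal (X - C b) p.
Proof.
move=> K pp pn n0 pF.
have brp := branch_divisor_prime pp pn (radicand_ramified K pp pn n0 pF).
have [b /in_ideal_red b0 bE] := rational brp; exists b; split=> //.
have : p \in pideal p by apply/pidealP; exists 1; rewrite mulr1.
by rewrite bE => /asboolP.
Qed.

Lemma in_ideal_trans (p x y : powser R) : in_ideal p x -> in_ideal x y -> in_ideal p y.
Proof. by move=> [c ->] [d ->]; exists (c * d); rewrite mulrA. Qed.

(** Prime factors of F are branch divisors, hence linear by rationality. The Weierstrass degree
    counts the roots and squarefreeness separates them. *)
Lemma radicand_split a w f h : kummer a w f h -> exists (U : powser R) (r : seq R),
  [/\ U \is a GRing.unit, size r = 4, uniq r, (forall b, b \in r -> red b = 0) &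
      radicand f h = U * \prod_(b <- r) (X - C b)].
Proof.
move=> K.
have split_ind n V : wd V n -> in_ideal V (radicand f h) ->
    exists (U : powser R) (r : seq R), [/\ U \is a GRing.unit,
      (forall b, b \in r -> red b = 0) & V = U * \prod_(b <- r) (X - C b)].
  elim/ltn_ind: n V => -[|n] IH V Vn VF.
    by exists V, [::]; rewrite big_nil mulr1; split=> //; apply: (wd0_unit dvr res V).1.
  have [//|p [m [pp pm m0 pV]]] := prime_factor dvr res Vn.
  have [b [b0 bp]] := radicand_factor K pp pm m0 (in_ideal_trans pV VF).
  have [V' V'E] := in_ideal_trans bp pV.
  have [n1 [n2 [h1 h2 nE]]] : exists e e', [/\ wd (X - C b) e, wd V' e' & n.+1 = (e + e')%N].
    by apply: wdM_inv; rewrite -V'E.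
  have n11 := wd_uniq h1 (wd_linear b0); rewrite n11 in nE.
  move: nE; rewrite add1n => -[nE]; rewrite -nE in h2.
  have [|//|U [r [Uu r0 rE]]] := IH n _ V' h2; first exact: ltnSn.
    by apply: in_ideal_trans VF; exists (X - C b); rewrite V'E mulrC.
  exists U, (b :: r); split=> //.
    by move=> c; rewrite inE => /orP[/eqP->|/r0].
  by rewrite big_cons V'E rE; ring.
have [|U [r [Uu r0 rE]]] := split_ind 4 _ (radicand_wd K).
  by exists 1; rewrite mulr1.
exists U, r; split=> //.
- have prod_wd r' : (forall b, b \in r' -> red b = 0) ->
      wd (\prod_(b <- r') (X - C b)) (size r').
    elim: r' => [|b r' IH] h0.
      by rewrite big_nil; apply/(wd0_unit dvr res); rewrite unitr1.
    rewrite big_cons /= -add1n; apply: wdM.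
      by apply: wd_linear; apply: h0; rewrite mem_head.
    by apply: IH => c cr; apply: h0; rewrite inE cr orbT.
  have := wdM ((wd0_unit dvr res U).2 Uu) (prod_wd r r0); rewrite -rE.
  by move/(wd_uniq (radicand_wd K)).
- apply/negPn/negP => /(uniqPn 0)[i [j [ij jr E]]].
  have bj : nth 0 r j \in r by apply: mem_nth.
  apply: (radicand_squarefree K (linear_prime dvr res (r0 _ bj)) (wd_linear (r0 _ bj))).
  have perm : perm_eq r (nth 0 r j :: nth 0 r j :: rem (nth 0 r j) (rem (nth 0 r j) r)).
    have p1 := perm_to_rem bj; rewrite (perm_trans p1) // perm_cons perm_to_rem //.
    rewrite -has_pred1 has_count; have := seq.permP p1 (pred1 (nth 0 r j)).
    rewrite /= eqxx add1n => cE; rewrite -ltnS -cE.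
    exact: (count_two ij jr E).
  rewrite rE (perm_big _ perm) !big_cons.
  move: (\prod_(_ <- rem _ _) _) => P; exists (U * P).
  by rewrite expr2 -[RHS]mulrA [LHS]mulrCA; congr (_ * _); apply: mulrCA.
Qed.

End BranchLocus.

(** * The seven branch points *)

Lemma char_orthogonality (N : comNzRingType) (u : bool3) :
  \sum_a (-1) ^+ dot a u = (if u == bzero then 8%:R else 0) :> N.
Proof.
rewrite sum_bool3 !big_cons big_nil.
by case: u => [[[] []] []]; rewrite /dot /= ?expr0 ?expr1; ring.
Qed.

Lemma count_partition (T : Type) (e : T -> bool3) (a : bool3) (r : seq T) :
  count (fun b => dot a (e b)) r =
  (\sum_(v | dot a v) count (fun b => e b == v) r)%N.
Proof.
elim: r => [|b r IH] /=; first by rewrite big1.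
rewrite IH big_split /=; congr addn.
rewrite big_mkcond (bigD1 (e b)) //= eqxx big1 ?addn0; first by case: (dot a _).
by move=> v; rewrite eq_sym => /negPf->; rewrite if_same.
Qed.

(** The seven affine planes a . v = 1 give an invertible incidence system on the nonzero vectors,
    solved by the constant 1. *)
Lemma plane_counts (N : bool3 -> nat) :
  (forall a, a != bzero -> (\sum_(v | dot a v) N v)%N = 4) ->
  forall v, v != bzero -> N v = 1%N.
Proof.
move=> h.
have E a : a != bzero -> (\sum_(v <- all_bool3) (if dot a v then N v else 0))%N = 4.
  by move=> a0; rewrite -(h a a0) [RHS]big_mkcond (perm_big _ perm_all_bool3).
have := E (false, false, true) isT; have := E (false, true, false) isT.
have := E (false, true, true) isT; have := E (true, false, false) isT.
have := E (true, false, true) isT; have := E (true, true, false) isT.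
have := E (true, true, true) isT.
rewrite !big_cons !big_nil /dot /= {h E} => h1 h2 h3 h4 h5 h6 h7.
by case=> [[[] []] []] //= _; lia.
Qed.

Section BranchPoints.
Variables (R : idomainType) (k : closedFieldType) (pi : R) (red : {rmorphism R -> k}).
Hypothesis dvr : is_complete_dvr pi.
Hypothesis res : is_residue_map pi red.
Hypothesis char2 : 2%N \in [pchar k].
Hypothesis two_neq0 : (2%:R : R) != 0.
Variables (iota : {rmorphism powser R -> powser R})
  (s : bool3 -> {rmorphism powser R -> powser R}).
Variables (iotak : {rmorphism powser k -> powser k})
  (sk : bool3 -> {rmorphism powser k -> powser k}).
Hypothesis act : is_bool3_action iota s.
Hypothesis actk : is_bool3_action iotak sk.
Local Notation mred := (map_powser red).
Hypothesis red_iota : forall a, mred (iota a) = iotak (mred a).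
Hypothesis rational : branch_points_rational pi iota.
Local Notation C := (@powserC R).
Local Notation X := (powserX R).
Local Notation wd := (wd red).
Local Notation kummer := (kummer red iota s).
Local Notation ev := (@ev R).
Variables w f h : bool3 -> powser R.
Hypothesis K : forall a, a != bzero -> kummer a (w a) (f a) (h a).

(** The value 1 at the trivial character lets sums and products run over all of [bool3]; likewise
    for [disc]. *)
Definition eigen a := if a == bzero then 1 else 2%:R * w a - iota (f a).
Definition disc a := if a == bzero then 1 else radicand (f a) (h a).

Lemma eigen_square a : eigen a ^+ 2 = iota (disc a).
Proof.
rewrite /eigen /disc; case: eqP => [_|/eqP a0]; first by rewrite expr1n rmorph1.
exact: kummer_square (K a0).
Qed.

Lemma eigen_act a u : s u (eigen a) = (-1) ^+ dot a u * eigen a.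
Proof.
rewrite /eigen; have [->|a0] := eqVneq a bzero.
  by rewrite rmorph1 [dot _ _](_ : _ = false) ?mul1r //; case: u => [[[] []] []].
rewrite (kummer_eigen act (K a0)); case: ifP => _; first by rewrite mulN1r.
by rewrite expr0 mul1r.
Qed.

Lemma eigen_mul_iota a x : (forall u, s u x = (-1) ^+ dot a u * x) ->
  exists b, x * eigen a = iota b.
Proof.
move=> sx; apply: (act_fixed act) => u; rewrite rmorphM sx eigen_act.
by case: (dot a u); ring.
Qed.

(** Eight times the projection to the isotypic part, since 8 is not invertible in R. *)
Definition isotypic a x := \sum_u (-1) ^+ dot a u * s u x.

Lemma isotypic_act a x v : s v (isotypic a x) = (-1) ^+ dot a v * isotypic a x.
Proof.
rewrite /isotypic rmorph_sum mulr_sumr (reindex_inj (h := badd v)); last first.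
  by move=> u u' /(congr1 (badd v)); rewrite !baddA baddvv !badd0l.
apply: eq_bigr => u _; rewrite rmorphM -(act_D act) baddA baddvv badd0l.
rewrite mulrA rmorphXn rmorphN1 dotDr; congr (_ * _).
by case: (dot a v); case: (dot a u); rewrite /= ?expr1 ?expr0; ring.
Qed.

Lemma isotypic_sum x : \sum_a isotypic a x = 8%:R * x.
Proof.
rewrite /isotypic exchange_big /=.
transitivity (\sum_u (if u == bzero then 8%:R * s u x else 0)).
  apply: eq_bigr => u _; rewrite -mulr_suml char_orthogonality.
  by case: ifP => _ //; rewrite mul0r.
by rewrite -big_mkcond big_pred1_eq (act_0 act).
Qed.

Lemma disc_red b a : red b = 0 -> ev b (disc a) = 0 -> a != bzero /\
  in_ideal (X - C b) (radicand (f a) (h a)).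
Proof.
move=> b0; rewrite /disc; case: eqP => [_|/eqP a0 /(ev_dvd dvr res b0)//].
by rewrite (ev1 dvr res b0) => /eqP; rewrite oner_eq0.
Qed.

(** Where no discriminant vanishes the cover is unramified: up to the factor 8 an element is the sum
    of its isotypic parts, and each of these times its eigenvector is an invariant. *)
Lemma branch_locus_disc b : branch_locus pi iota b ->
  red b = 0 /\ exists a, ev b (disc a) = 0.
Proof.
move=> [/(in_ideal_red res) b0 [_ _ [Q [Qp QP ram]]]]; split=> //.
apply: contrapT => /forallNP disc0; case: ram => x xQ.
have QE y : iota y \in Q -> in_ideal (X - C b) y by rewrite QP => /asboolP.
have ev_notin y : ev b y <> 0 -> iota y \notin Q.
  by move=> y0; apply/negP => /QE/(ev_dvd dvr res b0).
(* Multiplying by the conjugates of [x] outside Q brings all conjugates of [x * s'] into Q. *)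
pose s' := \prod_(v | s v x \notin Q) s v x.
have s'Q : s' \notin Q by apply: (pid_prod_notin Qp).
have xs'Q v : s v (x * s') \in Q.
  rewrite rmorphM; have [xv|xv] := boolP (s v x \in Q); first exact: (pidMr Qp).
  apply: (pidMl Qp); rewrite /s' (bigD1 v) //= rmorphM (act_K act).
  exact: (pidMr Qp).
have isoQ a : isotypic a (x * s') \in Q.
  rewrite /isotypic; apply: (big_ind (fun y => y \in Q)) => [||u _].
  - exact: pid0 Qp.
  - exact: pidD Qp.
  - exact: (pidMl Qp).
pose D := \prod_a disc a.
have DQ : iota D \notin Q.
  by rewrite /D rmorph_prod; apply: (pid_prod_notin Qp) => a _; apply: ev_notin.
have eightQ : 8%:R \notin Q.
  rewrite -(rmorph_nat iota); apply: ev_notin.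
  rewrite -(rmorph_nat (@powserC R)) (evC dvr res b0) (_ : 8%:R = 2%:R ^+ 3); last by ring.
  by apply/eqP; rewrite expf_neq0.
exists (8%:R * iota D * s'); split.
  by apply/negP => /(pid_prime Qp); rewrite (negPf s'Q) orbF
    => /(pid_prime Qp); rewrite (negPf eightQ) (negPf DQ).
(* An invariant in Q is divisible by [X - C b]. Multiplying back by the eigenvector costs the factor
   [disc a], which is outside Q. *)
have termP a : exists z, iota D * isotypic a (x * s') = iota (X - C b) * z.
  have [c cE] := eigen_mul_iota (isotypic_act a (x * s')).
  have [d dE] : in_ideal (X - C b) c by apply: QE; rewrite -cE; apply: (pidMr Qp).
  exists (iota (\prod_(a' | a' != a) disc a') * iota d * eigen a).
  rewrite /D (bigD1 a) //= rmorphM -eigen_square.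
  have -> : eigen a ^+ 2 * iota (\prod_(i | i != a) disc i) * isotypic a (x * s') =
    iota (\prod_(i | i != a) disc i) * eigen a * (isotypic a (x * s') * eigen a) by ring.
  by rewrite cE dE rmorphM; ring.
have [z zE] := choice termP.
exists 1%N, (fun=> X - C b), (fun=> \sum_a z a); split.
  by move=> _; apply/asboolP; exists 1; rewrite mulr1.
rewrite big_ord1 mulr_sumr -(eq_bigr _ (fun a _ => zE a)) -mulr_sumr isotypic_sum.
ring.
Qed.

Lemma disc_branch_locus a b : red b = 0 -> ev b (disc a) = 0 -> branch_locus pi iota b.
Proof.
move=> b0 /(disc_red b0)[a0 bF]; split; first exact/(in_ideal_red res).
apply: (branch_divisor_prime dvr res (linear_prime dvr res b0) (wd_linear b0)).
exact: (radicand_ramified dvr res two_neq0 act actk red_iota (K a0)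
  (linear_prime dvr res b0) (wd_linear b0) isT bF).
Qed.

Lemma ev_square0 b d : red b = 0 -> ev b (d ^+ 2) = 0 -> in_ideal (X - C b) d.
Proof.
move=> b0; rewrite (evXn dvr res b0) => /eqP; rewrite expf_eq0 => /eqP.
by move/(ev_dvd dvr res b0).
Qed.

Lemma linear_odd b g d : red b = 0 -> ev b g <> 0 -> (X - C b) * g <> d ^+ 2.
Proof.
move=> b0 g0 E; have [d' dE] : in_ideal (X - C b) d.
  apply: ev_square0 => //; rewrite -E (evM dvr res b0).
  by rewrite (ev_linear dvr res b0) subrr mul0r.
apply: g0; apply/(ev_dvd dvr res b0); exists (d' ^+ 2).
by apply: (mulfI (linear_neq0 b)); rewrite E dE; ring.
Qed.

Lemma disc_simple a b g : red b = 0 -> disc a = (X - C b) * g -> ev b g <> 0.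
Proof.
move=> b0 E /(ev_dvd dvr res b0)[c cE].
have [|a0 _] := @disc_red b a b0.
  by rewrite E (evM dvr res b0) (ev_linear dvr res b0) subrr mul0r.
apply: (radicand_squarefree dvr res two_neq0 (K a0)
  (linear_prime dvr res b0) (wd_linear b0)).
by exists c; move: E; rewrite /disc (negPf a0) cE => ->; ring.
Qed.

Lemma disc_product a a' : exists d, disc a * disc a' * disc (badd a a') = d ^+ 2.
Proof.
have [d dE] : exists d, eigen a * eigen a' * eigen (badd a a') = iota d.
  apply: eigen_mul_iota => u; rewrite rmorphM !eigen_act dotDl.
  by case: (dot a u); case: (dot a' u); rewrite /= ?expr1 ?expr0; ring.
exists d; apply: (act_inj act).
by rewrite [RHS]rmorphXn -dE !(rmorphM iota) -!eigen_square; ring.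
Qed.

(** The three discriminants multiply to a square and each vanishes at [b] to order at most 1, so an
    even number of them vanish. *)
Lemma disc_parity b a a' : red b = 0 ->
  (ev b (disc (badd a a')) == 0) = (ev b (disc a) == 0) (+) (ev b (disc a') == 0).
Proof.
move=> b0; have [d dE] := disc_product a a'.
have factor c : (ev b (disc c) == 0) ->
    exists2 g, disc c = (X - C b) * g & ev b g <> 0.
  by move=> /eqP/(ev_dvd dvr res b0)[g gE]; exists g => //; apply: disc_simple gE.
have evMn x y : ev b x <> 0 -> ev b y <> 0 -> ev b (x * y) <> 0.
  by move=> /eqP x0 /eqP y0; apply/eqP; rewrite (evM dvr res b0) mulf_neq0.
case: (boolP (ev b (disc a) == 0)) => [/factor[g1 E1 n1]|/eqP n1];
case: (boolP (ev b (disc a') == 0)) => [/factor[g2 E2 n2]|/eqP n2];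
case: (boolP (ev b (disc (badd a a')) == 0)) => [/factor[g3 E3 n3]|/eqP n3] //=; exfalso.
- have [d' d'E] : in_ideal (X - C b) d.
    apply: ev_square0 => //; rewrite -dE E1.
    by rewrite !(evM dvr res b0) (ev_linear dvr res b0) subrr !mul0r.
  apply: (@linear_odd b (g1 * g2 * g3) d' b0);
    first exact: (evMn _ _ (evMn _ _ n1 n2) n3).
  apply: (mulfI (expf_neq0 2 (linear_neq0 b))); rewrite -exprMn -d'E -dE E1 E2 E3.
  ring.
- by apply: (@linear_odd b (g1 * disc a' * disc (badd a a')) d b0);
    [exact: (evMn _ _ (evMn _ _ n1 n2) n3) | rewrite -dE E1; ring].
- by apply: (@linear_odd b (disc a * g2 * disc (badd a a')) d b0);
    [exact: (evMn _ _ (evMn _ _ n1 n2) n3) | rewrite -dE E2; ring].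
- by apply: (@linear_odd b (disc a * disc a' * g3) d b0);
    [exact: (evMn _ _ (evMn _ _ n1 n2) n3) | rewrite -dE E3; ring].
Qed.

(** The vector v for which [disc a] vanishes at [b] exactly when a . v = 1. By parity it is
    determined by the three coordinate characters. *)
Definition inertia b : bool3 := (ev b (disc (true, false, false)) == 0,
  ev b (disc (false, true, false)) == 0, ev b (disc (false, false, true)) == 0).

Lemma disc_inertia b a : red b = 0 -> (ev b (disc a) == 0) = dot a (inertia b).
Proof.
move=> b0; have d0 : ev b (disc bzero) == 0 = false.
  by rewrite /disc eqxx (ev1 dvr res b0) oner_eq0.
have -> : a = badd (badd (if a.1.1 then (true, false, false) else bzero)
   (if a.1.2 then (false, true, false) else bzero))
   (if a.2 then (false, false, true) else bzero).
  by case: a => [[[] []] []].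
rewrite !(disc_parity _ _ b0); case: a => [[b1 b2] b3] /=; rewrite /inertia /dot /=.
by case: b1; case: b2; case: b3; rewrite /= ?d0 ?addbF ?addFb.
Qed.

Lemma branch_points : exists (beta : bool3 -> R) (U : bool3 -> powser R),
  [/\ forall v, v != bzero -> red (beta v) = 0,
      forall u v, u != bzero -> v != bzero -> beta u = beta v -> u = v,
      forall b, branch_locus pi iota b <-> exists2 v, v != bzero & b = beta v,
      forall a, a != bzero -> U a \is a GRing.unit &
      forall a, a != bzero ->
        radicand (f a) (h a) = U a * \prod_(v | dot a v) (X - C (beta v))].
Proof.
have splitE a : exists Ur : powser R * seq R, a != bzero -> [/\ Ur.1 \is a GRing.unit,
    size Ur.2 = 4, uniq Ur.2, (forall b, b \in Ur.2 -> red b = 0) &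
    radicand (f a) (h a) = Ur.1 * \prod_(b <- Ur.2) (X - C b)].
  have [->|a0] := eqVneq a bzero; first by exists (0, [::]).
  have [U [r rP]] := radicand_split dvr res char2 two_neq0 act actk red_iota rational (K a0).
  by exists (U, r).
have [Ur UrP] := choice splitE; pose r a := (Ur a).2.
pose nz := [seq a <- all_bool3 | a != bzero].
pose B := undup (flatten [seq r a | a <- nz]).
have nzE a : (a \in nz) = (a != bzero) by rewrite mem_filter mem_all_bool3 andbT.
have Bex b : b \in B -> exists2 a, a != bzero & b \in r a.
  by rewrite mem_undup => /flattenP[_ /mapP[a + ->]]; rewrite nzE; exists a.
have rB a b : a != bzero -> b \in r a -> b \in B.
  move=> a0 br; rewrite mem_undup; apply/flattenP; exists (r a) => //.
  by apply: map_f; rewrite nzE.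
have Bred b : b \in B -> red b = 0 by move=> /Bex[a /UrP[_ _ _ + _]]; apply.
have rdisc a b : a != bzero -> red b = 0 -> (b \in r a) = (ev b (disc a) == 0).
  move=> a0 b0; have [Uu _ _ _ E] := UrP a a0.
  rewrite /disc (negPf a0) E (evM dvr res b0) mulf_eq0 (ev_prod dvr res b0).
  have /negPf-> : ev b (Ur a).1 != 0.
    have /unitrPr[z zE] := Uu; apply/eqP => U0.
    have := ev1 dvr res b0; rewrite -zE (evM dvr res b0) U0 mul0r => /esym/eqP.
    by rewrite oner_eq0.
  rewrite prodf_seq_eq0; apply/idP/hasP => [br|[c cr]].
    by exists b => //=; rewrite (ev_linear dvr res b0) subrr.
  by rewrite /= (ev_linear dvr res b0) subr_eq0 => /eqP->.
have perm_r a : a != bzero -> perm_eq (r a) [seq b <- B | dot a (inertia b)].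
  move=> a0; have [_ _ ru r0 _] := UrP a a0.
  apply: uniq_perm; rewrite ?filter_uniq ?undup_uniq // => b; rewrite mem_filter.
  apply/idP/andP => [br|[ab bB]].
    have bB := rB _ _ a0 br; split=> //.
    by rewrite -disc_inertia ?Bred // -rdisc // Bred.
  by rewrite rdisc ?Bred // disc_inertia ?Bred.
(* Each [disc a] has four roots, so the numbers of points with given inertia satisfy the plane
   equations. *)
pose N v := count (fun b => inertia b == v) B.
have N1 : forall v, v != bzero -> N v = 1%N.
  apply: plane_counts => a a0; have [_ r4 _ _ _] := UrP a a0.
  by rewrite -count_partition -size_filter -(perm_size (perm_r a a0)) r4.
pose beta v := nth 0 [seq b <- B | inertia b == v] 0.
have fibre v : v != bzero -> [seq b <- B | inertia b == v] = [:: beta v].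
  move=> /N1; rewrite /N -size_filter /beta.
  by case: [seq b <- B | inertia b == v] => [|b [|]].
have betaP v : v != bzero -> inertia (beta v) = v /\ beta v \in B.
  move=> v0; have : beta v \in [seq b <- B | inertia b == v].
    by rewrite fibre // mem_head.
  by rewrite mem_filter => /andP[/eqP].
have Bbeta b : b \in B -> inertia b != bzero /\ b = beta (inertia b).
  move=> bB; have [a a0] := Bex _ bB; rewrite rdisc ?Bred // disc_inertia ?Bred // => ab.
  have i0 : inertia b != bzero by apply: contraTneq ab => ->; rewrite dot0.
  split=> //; apply/eqP; rewrite -mem_seq1 -fibre //.
  by rewrite mem_filter eqxx.
exists beta, (fun a => (Ur a).1); split.
- by move=> v /betaP[_ /Bred].
- by move=> u v /betaP[uE _] /betaP[vE _] E; rewrite -uE E vE.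
- move=> b; split=> [/branch_locus_disc[b0 [a ba]]|[v v0 ->]].
    have [a0 _] := disc_red b0 ba.
    have /Bbeta[i0 ->] : b \in B by apply: (rB a) => //; rewrite rdisc // ba.
    by exists (inertia b).
  have [_ vB] := betaP v v0; have [a a0] := Bex _ vB; rewrite rdisc ?Bred // => /eqP.
  by apply: disc_branch_locus; apply: Bred.
- by move=> a /UrP[].
- move=> a a0; have [_ _ ru r0 ->] := UrP a a0; congr (_ * _).
  rewrite [RHS](perm_big _ perm_all_bool3) -[RHS]big_filter.
  transitivity (\prod_(b <- [seq beta v | v <- [seq v <- all_bool3 | dot a v]]) (X - C b));
    last by rewrite big_map.
  apply: perm_big; apply: uniq_perm => //.
    rewrite map_inj_in_uniq ?filter_uniq // => u v; rewrite !mem_filter.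
    move=> /andP[au _] /andP[av _] E.
    have u0 : u != bzero by apply: contraTneq au => ->; rewrite dot0.
    have v0 : v != bzero by apply: contraTneq av => ->; rewrite dot0.
    by rewrite -(betaP u u0).1 E (betaP v v0).1.
  move=> b; apply/idP/mapP => [br|[v + ->]].
    have bB := rB _ _ a0 br; have [i0 bE] := Bbeta _ bB.
    exists (inertia b) => //; rewrite mem_filter mem_all_bool3 andbT.
    by rewrite -disc_inertia ?Bred // -rdisc // Bred.
  rewrite mem_filter => /andP[av _].
  have v0 : v != bzero by apply: contraTneq av => ->; rewrite dot0.
  have [vE vB] := betaP v v0.
  by rewrite rdisc ?Bred // disc_inertia ?Bred // vE.
Qed.
End BranchPoints.

(** * Distances between the branch points *)

Definition affine_count (s : bool3 -> bool) (a : bool3) : nat :=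
  count (fun v => dot a v && s v) all_bool3.

(** Again all 256 subsets are tested. The hypothesis says that on each line of characters a, b, a +
    b the largest count is attained at least twice, which is what [no_unique_max] provides. *)
Lemma subspace_of_counts (s : bool3 -> bool) :
  (forall a b, a != bzero -> b != bzero -> a != b ->
     ~~ ((affine_count s b < affine_count s a)%N &&
         (affine_count s (badd a b) < affine_count s a)%N)) ->
  forall u v, u != bzero -> v != bzero -> u != v -> s u -> s v -> s (badd u v).
Proof.
pose nz2 (P : bool3 -> bool3 -> bool) := all (fun a => all (fun b =>
  [&& a != bzero, b != bzero & a != b] ==> P a b) all_bool3) all_bool3.
pose Q (s : bool3 -> bool) := nz2 (fun a b =>
  ~~ ((affine_count s b < affine_count s a)%N &&
      (affine_count s (badd a b) < affine_count s a)%N)) ==>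
  nz2 (fun u v => s u ==> s v ==> s (badd u v)).
have /(_ s) : forall s, Q s.
  apply: bool3_set_ind => [s1 s2 E|]; last by vm_compute.
  have cE a : affine_count s2 a = affine_count s1 a.
    by apply: eq_count => v; rewrite E.
  rewrite /Q /nz2; congr (_ ==> _); apply: eq_all => a; apply: eq_all => b.
    by rewrite !cE.
  by rewrite !E.
move=> /implyP h hs u v u0 v0 uv su sv.
have nzP (P : bool3 -> bool3 -> bool) : (forall a b, a != bzero -> b != bzero -> a != b -> P a b) -> nz2 P.
  move=> hP; apply/allP => a _; apply/allP => b _; apply/implyP => /and3P[a0 b0 ab].
  exact: hP.
have /allP/(_ u (mem_all_bool3 u))/allP/(_ v (mem_all_bool3 v)) := h (nzP _ hs).
by rewrite u0 v0 uv su sv.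
Qed.

(** The vectors u, v, z are independent, and a is the character equal to 1 on u and z and to 0 on
    v. *)
Lemma complete_plane u v z : u != bzero -> v != bzero -> u != v ->
  z \notin [:: bzero; u; v; badd u v] -> exists a,
  [/\ a != bzero, z != bzero, badd z v != bzero & badd z v != z] /\
  perm_eq [seq w <- all_bool3 | dot a w] [:: u; badd u v; z; badd z v].
Proof.
move=> u0 v0 uv zn.
have : all (fun u => all (fun v => all (fun z =>
  [&& u != bzero, v != bzero, u != v & z \notin [:: bzero; u; v; badd u v]] ==>
  has (fun a => [&& a != bzero, z != bzero, badd z v != bzero & badd z v != z] &&
    perm_eq [seq w <- all_bool3 | dot a w] [:: u; badd u v; z; badd z v]) all_bool3)
  all_bool3) all_bool3) all_bool3 by vm_compute.
move=> /allP/(_ u (mem_all_bool3 u))/allP/(_ v (mem_all_bool3 v))/allP/(_ z (mem_all_bool3 z)).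
rewrite u0 v0 uv zn => /hasP[a _ /andP[/and4P[a0 z0 zv0 zvz] perm]].
by exists a.
Qed.

(** The class of u and v contains u + v. In the sum over the plane u, u + v, z, z + v the first two
    terms cancel in characteristic 2, so z and z + v have equal values; by closure the class of z
    contains v. *)
Lemma coincidence_propagates (k : fieldType) (y : bool3 -> k) : 2%N \in [pchar k] ->
  (forall g a b, g != bzero -> a != bzero -> b != bzero -> a != b ->
     let n c := affine_count (fun v => (v != bzero) && (y v == y g)) c in
     ~~ ((n b < n a)%N && (n (badd a b) < n a)%N)) ->
  (forall a, a != bzero -> \sum_(v <- all_bool3 | dot a v) y v = 0) ->
  forall u v, u != bzero -> v != bzero -> u != v -> y u = y v ->
  forall z, z != bzero -> y z = y u.
Proof.
move=> char2 hA hB u v u0 v0 uv E z z0.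
have cl g p q : g != bzero -> p != bzero -> q != bzero -> p != q ->
    y p = y g -> y q = y g -> y (badd p q) = y g.
  move=> g0 p0 q0 pq pg qg.
  have := @subspace_of_counts (fun v => (v != bzero) && (y v == y g)).
  move=> /(_ (fun a b a0 b0 ab => hA g a b g0 a0 b0 ab) p q p0 q0 pq).
  by rewrite p0 q0 pg qg eqxx => /(_ isT isT) /andP[_ /eqP].
have [|zn] := boolP (z \in [:: bzero; u; v; badd u v]).
  rewrite !inE (negPf z0) /= => /or3P[] /eqP-> //; exact: cl.
have [a [[a0 _ zv0 zvz] perm]] := complete_plane u0 v0 uv zn.
have := hB a a0; rewrite -big_filter (perm_big _ perm) !big_cons big_nil /=.
rewrite (cl u u v) // addr0 addrA (addrr_pchar2 char2) add0r => /eqP.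
rewrite addr_eq0 (oppr_pchar2 char2) => /eqP zE.
have := cl z (badd z v) z z0 zv0 z0 zvz (esym zE) erefl.
by rewrite baddC baddA baddvv badd0l E.
Qed.

(** * Square roots and derivatives modulo [pi] *)

Section Geometry.
Variables (R : idomainType) (k : closedFieldType) (pi : R) (red : {rmorphism R -> k}).
Hypothesis dvr : is_complete_dvr pi.
Hypothesis res : is_residue_map pi red.
Local Notation C := (@powserC R).
Local Notation X := (powserX R).
Local Notation mred := (map_powser red).
Local Notation ev := (@ev R).

Lemma red_piX n x : (0 < n)%N -> red (pi ^+ n * x) = 0.
Proof. by case: n => // n _; rewrite exprS !rmorphM (red_pi res) !mul0r. Qed.

Lemma mred_piX n f : (0 < n)%N -> mred (C pi ^+ n * f) = 0.
Proof.
by case: n => // n _; rewrite exprS -mulrA rmorphM /= (mred_pi res) mul0r.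
Qed.

Lemma dvr_sqrt (c x y : R) : c != 0 -> x ^+ 2 = c ^+ 2 * y -> exists z, x = c * z.
Proof.
move=> c0 E; have [->|x0] := eqVneq x 0; first by exists 0; rewrite mulr0.
have [u [n [uu xE]]] := dvr_factor dvr x0.
have [v [m [vu cE]]] := dvr_factor dvr c0.
have [mn|nm] := leqP m n.
  exists (v^-1 * u * pi ^+ (n - m)); rewrite xE cE -[n in LHS](subnKC mn) exprD.
  have -> : v * pi ^+ m * (v^-1 * u * pi ^+ (n - m)) =
    v / v * (u * (pi ^+ m * pi ^+ (n - m))) by ring.
  by rewrite divrr // mul1r.
have : pi ^+ (n + n) * u ^+ 2 = pi ^+ (n + n) * (pi ^+ (m + m - (n + n)) * v ^+ 2 * y).
  rewrite mulrA mulrA -exprD subnKC; last by rewrite leq_add // ltnW.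
  transitivity (x ^+ 2); first by rewrite xE exprD; ring.
  by rewrite E cE exprD; ring.
move/(mulfI (expf_neq0 _ (pi_neq0 dvr)))/(congr1 red).
rewrite -mulrA red_piX; last by lia.
rewrite rmorphXn => /eqP; rewrite expf_eq0 /= => u0.
by move: uu; rewrite (unit_red dvr res) u0.
Qed.

Lemma psqrt n f g : f ^+ 2 = C pi ^+ (n + n) * g -> exists h, f = C pi ^+ n * h.
Proof.
move=> E; have [->|f0] := eqVneq f 0; first by exists 0; rewrite mulr0.
have [m [f' [fE f'0]]] := gauss_factor dvr res f0.
have [nm|mn] := leqP n m.
  by exists (C pi ^+ (m - n) * f'); rewrite mulrA -exprD subnKC.
have : C pi ^+ (m + m) * f' ^+ 2 = C pi ^+ (m + m) * (C pi ^+ (n + n - (m + m)) * g).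
  rewrite mulrA -exprD subnKC; last by rewrite leq_add // ltnW.
  by rewrite -E fE exprD; ring.
move/(pi_cancel dvr)/(congr1 mred).
rewrite mred_piX; last by lia.
rewrite rmorphXn => /eqP.
by rewrite expf_eq0 (negPf f'0).
Qed.

Hypothesis char2 : 2%N \in [pchar k].

Lemma psderiv_square (g : powser k) : psderiv (g ^+ 2) = 0.
Proof.
rewrite expr2 psderivM; have -> : psderiv g * g + g * psderiv g = 2%:R * (g * psderiv g) by ring.
by rewrite (powser_two0 char2) mul0r.
Qed.

(** Let m be the content of [s]. If 2 m < 9 r, the term s ^ 2 alone has least content, which is
    impossible. Otherwise m > 3 r, the linear term disappears modulo [pi], and N reduces to a
    square, possibly 0. The exponents 6 r and 9 r are those of f1 f2 f3 and h1 f2 ^ 2 f3 ^ 2 after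
    rescaling. *)
Lemma artin_schreier_valuation r s E N : (0 < r)%N ->
  s ^+ 2 - C pi ^+ (6 * r) * E * s = C pi ^+ (9 * r) * N -> psderiv (mred N) = 0.
Proof.
move=> r0 H; have [s0|s0] := eqVneq s 0.
  have N0 : N = 0.
    by apply: (@pi_cancel _ _ dvr (9 * r)); rewrite -H s0; ring.
  by rewrite N0 rmorph0; apply: powserP => n /=; rewrite mul0rn.
have [m [s' [sE s'0]]] := gauss_factor dvr res s0.
have [mr|mr] := leqP (9 * r) (m + m).
  have NE : N = C pi ^+ (m + m - 9 * r) * s' ^+ 2 - C pi ^+ (m + 6 * r - 9 * r) * (E * s').
    apply: (@pi_cancel _ _ dvr (9 * r)); rewrite -H mulrBr !mulrA -!exprD !subnKC //; last by lia.
    by rewrite sE !exprD; ring.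
  have pos : (0 < m + 6 * r - 9 * r)%N by lia.
  have -> : mred N = (if (m + m - 9 * r)%N == 0%N then 1 else 0) * mred s' ^+ 2.
    rewrite NE rmorphB /= (mred_piX _ pos) subr0; case: eqP => [->|/eqP n0].
      by rewrite expr0 !mul1r rmorphXn.
    by rewrite mul0r mred_piX // lt0n.
  rewrite psderivM psderiv_square mulr0 addr0.
  have -> : psderiv (if (m + m - 9 * r)%N == 0%N then 1 else 0 : powser k) = 0.
    by case: ifP => _; apply: powserP => -[|n] /=; rewrite ?mul0rn.
  by rewrite mul0r.
have : C pi ^+ (m + m) * s' ^+ 2 = C pi ^+ (m + m) *
    (C pi ^+ (6 * r + m - (m + m)) * (E * s') + C pi ^+ (9 * r - (m + m)) * N).
  rewrite mulrDr !mulrA -!exprD !subnKC; [|lia|lia].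
  by rewrite -H sE !exprD; ring.
move/(pi_cancel dvr)/(congr1 mred).
have p1 : (0 < 6 * r + m - (m + m))%N by lia.
have p2 : (0 < 9 * r - (m + m))%N by lia.
rewrite rmorphD /= !mred_piX // addr0 rmorphXn => /eqP.
by rewrite expf_eq0 (negPf s'0).
Qed.

Lemma cubic_coefficient (T : Type) (y : T -> k) (r : seq T) : size r = 4 ->
  pcoef (\prod_(v <- r) (powserX k - powserC (y v))) 3 = - \sum_(v <- r) y v.
Proof.
case: r => [|v1 [|v2 [|v3 [|v4 [|]]]]] // _; rewrite !big_cons !big_nil.
move: (y v1) (y v2) (y v3) (y v4) => y1 y2 y3 y4; rewrite addr0 mulr1.
transitivity (pcoef (powserX k ^+ 4 - powserC (y1 + (y2 + (y3 + y4))) * powserX k ^+ 3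
  + powserC (y1 * y2 + y1 * y3 + y1 * y4 + y2 * y3 + y2 * y4 + y3 * y4) * powserX k ^+ 2
  - powserC (y1 * y2 * y3 + y1 * y2 * y4 + y1 * y3 * y4 + y2 * y3 * y4) * powserX k ^+ 1
  + powserC (y1 * y2 * y3 * y4) * powserX k ^+ 0) 3).
  by congr pcoef; rewrite !(rmorphD, rmorphM); ring.
rewrite !(pcoefD, pcoefN) !pcoefMC !pcoefXn /=; ring.
Qed.

Lemma square_coef3 (g : powser k) : pcoef (g ^+ 2) 3 = 0.
Proof.
rewrite expr2 pcoefM !big_ord_recl big_ord0 /=.
rewrite (_ : _ + _ = 2%:R * (pcoef g 0%N * pcoef g 3 + pcoef g 1%N * pcoef g 2)).
  by rewrite (pcharf0 char2) mul0r.
by rewrite /bump /=; ring.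
Qed.

Lemma order_count (y : bool3 -> k) (a : bool3) : exists2 u : powser k,
  u \is a GRing.unit & \prod_(v <- all_bool3 | dot a v) (powserX k - powserC (y v)) =
    powserX k ^+ affine_count (fun v => y v == 0) a * u.
Proof.
rewrite /affine_count; elim: all_bool3 => [|v r [u uu IH]].
  by exists 1; rewrite ?unitr1 // big_nil mulr1.
rewrite big_cons /=; case: (dot a v) => /=; last by exists u.
have [v0|v0] := eqVneq (y v) 0.
  by exists u; rewrite // IH v0 rmorph0 subr0 add1n exprS mulrA.
exists ((powserX k - powserC (y v)) * u); last by rewrite IH add0n mulrCA.
by rewrite unitrM uu andbT powser_unit pcoefB /= sub0r unitrN unitfE.
Qed.
End Geometry.

Lemma card_dot a va : a != bzero -> dot a va ->
  #|[pred v | dot a v]| = 4 /\ #|[pred v | dot a v & v != va]| = 3.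
Proof.
move=> a0 ava; have c4 : #|[pred v | dot a v]| = 4.
  rewrite -sum1_card (perm_big _ perm_all_bool3) /= !big_cons big_nil !inE.
  by case: a a0 {ava} => [[[] []] []].
split=> //; apply: succn_inj; rewrite -[RHS]c4 (cardD1 va [pred v | dot a v]) inE ava.
by congr _.+1; apply: eq_card => v; rewrite !inE andbC.
Qed.

Section Trilinear.
Variable S : comNzRingType.
Implicit Types q e t : powser S.

(** The quotient by t of the product of the [qi + t * ei] minus the product of the [qi], written so
    that it makes sense for t = 0. *)
Definition trilinear q1 q2 q3 e1 e2 e3 t :=
  e1 * q2 * q3 + q1 * e2 * q3 + q1 * q2 * e3
  + t * (e1 * e2 * q3 + e1 * q2 * e3 + q1 * e2 * e3) + t ^+ 2 * (e1 * e2 * e3).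

Lemma trilinear_deriv q1 q2 q3 e1 e2 e3 t :
  psderiv q1 = 0 -> psderiv q2 = 0 -> psderiv q3 = 0 -> psderiv t = 0 ->
  psderiv (trilinear q1 q2 q3 e1 e2 e3 t) =
    psderiv e1 * (q2 + t * e2) * (q3 + t * e3) +
    psderiv e2 * (q1 + t * e1) * (q3 + t * e3) +
    psderiv e3 * (q1 + t * e1) * (q2 + t * e2).
Proof.
move=> d1 d2 d3 dt; rewrite /trilinear expr2 !(psderivD, psderivM) d1 d2 d3 dt.
ring.
Qed.
End Trilinear.

(** * Rescaling around a branch point and equidistance *)

Section Equidistance.
Variables (R : idomainType) (k : closedFieldType) (pi : R) (red : {rmorphism R -> k}).
Hypothesis dvr : is_complete_dvr pi.
Hypothesis res : is_residue_map pi red.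
Hypothesis char2 : 2%N \in [pchar k].
Hypothesis two_neq0 : (2%:R : R) != 0.
Variables (iota : {rmorphism powser R -> powser R})
  (s : bool3 -> {rmorphism powser R -> powser R}).
Hypothesis act : is_bool3_action iota s.
Local Notation mred := (map_powser red).
Local Notation C := (@powserC R).
Local Notation X := (powserX R).
Local Notation kummer := (kummer red iota s).
Local Notation ev := (@ev R).

Lemma pstwo_neq0 : (2%:R : powser R) != 0.
Proof.
rewrite -(rmorph_nat (@powserC R)) -(rmorph0 (@powserC R)).
by rewrite (inj_eq (@powserC_inj R)).
Qed.

Lemma mred_linear_coef b e : red b = 0 ->
  pcoef (mred ((X - C b) * e)) 1 = red (pcoef e 0%N).
Proof.
move=> b0; have -> : mred ((X - C b) * e) = powserX k * mred e.
  by rewrite -(mred_linear b0) -rmorphM.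
by rewrite pcoefXM.
Qed.

(** At a root b of F, f(b) ^ 2 = - 4 h(b), so f(b) = 2 q with q ^ 2 = - h(b). Replacing w by w - q
    keeps F; as q has residue 0, the reductions of f and h do not change. *)
Lemma kummer_normalize a w f h b : kummer a w f h -> red b = 0 ->
  ev b (radicand f h) = 0 -> exists w' f' h',
  [/\ kummer a w' f' h', ev b f' = 0, ev b h' = 0 & radicand f' h' = radicand f h].
Proof.
move=> K b0; rewrite /radicand (evD dvr res b0) (evXn dvr res b0) (evM dvr res b0).
rewrite -(rmorph_nat (@powserC R)) (evC dvr res b0) => /eqP; rewrite addr_eq0 => /eqP E.
have [|q qE] := @dvr_sqrt _ _ _ _ dvr res 2%:R (ev b f) (- ev b h) two_neq0.
  by rewrite E; ring.
have qq : q ^+ 2 = - ev b h.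
  apply: (mulfI (expf_neq0 2 two_neq0)); rewrite -exprMn -qE E; ring.
have q0 : red q = 0.
  have /eqP : red q ^+ 2 = 0.
    by rewrite -rmorphXn qq rmorphN (red_ev dvr res b0) -[red _]/(pcoef (mred h) 0%N)
      (kummer_h0 K) oppr0.
  by rewrite expf_eq0 => /eqP.
have mq : mred (C q) = 0 by rewrite map_powserC q0 rmorph0.
pose w' := w - C q; pose f' := f - 2%:R * C q; pose h' := h + C q * f - C q ^+ 2.
have mf : mred f' = mred f by rewrite rmorphB rmorphM /= mq mulr0 subr0.
have mh : mred h' = mred h.
  by rewrite rmorphB rmorphD rmorphM rmorphXn /= mq expr0n mul0r addr0 subr0.
have iq : iota (C q) = C q := act_C act q.
exists w', f', h'; split.
- split; rewrite ?mf ?mh; first last.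
  + exact: kummer_h1 K.
  + exact: kummer_h0 K.
  + exact: kummer_f K.
  + rewrite /w' /f' /h' !rmorphB rmorphD rmorphXn !(rmorphM iota) !iq rmorph_nat.
    have -> : (w - C q) * (iota f - 2%:R * C q - (w - C q)) =
      w * (iota f - w) - C q * iota f + C q ^+ 2 by ring.
    by rewrite (kummer_norm K); ring.
  + move=> u; rewrite /w' /f' !rmorphB (kummer_act K) rmorphM iq rmorph_nat.
    by rewrite (act_const act); case: ifP => _ //; ring.
- rewrite /f' (evB dvr res b0) -(rmorph_nat (@powserC R)) -rmorphM (evC dvr res b0).
  by rewrite qE subrr.
- rewrite /h' (evB dvr res b0) (evD dvr res b0) (evM dvr res b0) (evXn dvr res b0).
  rewrite (evC dvr res b0) qE.
  have -> : ev b h = - q ^+ 2 by rewrite qq opprK.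
  ring.
- by rewrite /radicand /f' /h'; ring.
Qed.

(* The product of the three eigenvectors is an invariant [2 s - f1 f2 f3]. *)
Lemma kummer_product a1 a2 w1 f1 h1 w2 f2 h2 w3 f3 h3 :
  kummer a1 w1 f1 h1 -> kummer a2 w2 f2 h2 -> kummer (badd a1 a2) w3 f3 h3 ->
  exists z, z ^+ 2 - f1 * f2 * f3 * z =
    h1 * f2 ^+ 2 * f3 ^+ 2 + f1 ^+ 2 * h2 * f3 ^+ 2 + f1 ^+ 2 * f2 ^+ 2 * h3
    + 4%:R * (h1 * h2 * f3 ^+ 2 + h1 * f2 ^+ 2 * h3 + f1 ^+ 2 * h2 * h3)
    + 16%:R * (h1 * h2 * h3).
Proof.
move=> K1 K2 K3; pose y w f := 2%:R * w - iota f.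
have [d dE] : exists d, y w1 f1 * y w2 f2 * y w3 f3 = iota d.
  apply: (act_fixed act) => u; rewrite !rmorphM /y.
  rewrite (kummer_eigen act K1) (kummer_eigen act K2) (kummer_eigen act K3) dotDl.
  by case: (dot a1 u); case: (dot a2 u) => /=; ring.
pose F i := iota i.
(* Half of d + f1 f2 f3, expanded so that no division by 2 is left. *)
pose z := w1 * F f2 * F f3 + F f1 * w2 * F f3 + F f1 * F f2 * w3
  - 2%:R * (w1 * w2 * F f3 + w1 * F f2 * w3 + F f1 * w2 * w3) + 4%:R * (w1 * w2 * w3).
have zE : 2%:R * z = iota (d + f1 * f2 * f3).
  by rewrite rmorphD -dE !(rmorphM iota) /z /y /F; ring.
have [z' z'E] : exists z', z = iota z'.
  apply: (act_fixed act) => u; apply: (mulfI pstwo_neq0).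
  by rewrite zE -(act_iota act u (d + _)) -zE rmorphM rmorph_nat.
have d2 : 2%:R * z' = d + f1 * f2 * f3.
  by apply: (act_inj act); rewrite -zE z'E rmorphM rmorph_nat.
have dd : d ^+ 2 = radicand f1 h1 * radicand f2 h2 * radicand f3 h3.
  apply: (act_inj act); rewrite rmorphXn -dE !exprMn !(rmorphM iota).
  by rewrite (kummer_square K1) (kummer_square K2) (kummer_square K3).
exists z'; apply: (mulfI pstwo_neq0); apply: (mulfI pstwo_neq0).
transitivity ((2%:R * z') ^+ 2 - 2%:R * (f1 * f2 * f3) * (2%:R * z')); first by ring.
rewrite d2.
transitivity (d ^+ 2 - (f1 * f2 * f3) ^+ 2); first by ring.
by rewrite dd /radicand; ring.
Qed.

Variables (beta : bool3 -> R) (U w f h : bool3 -> powser R).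
Hypothesis beta0 : forall v, v != bzero -> red (beta v) = 0.
Hypothesis K : forall a, a != bzero -> kummer a (w a) (f a) (h a).
Hypothesis Uunit : forall a, a != bzero -> U a \is a GRing.unit.
Hypothesis split_radicand : forall a, a != bzero ->
  radicand (f a) (h a) = U a * \prod_(v | dot a v) (X - C (beta v)).

Section Scale.
Variables (r : nat) (y : bool3 -> R) (bs : R).
Hypothesis r0 : (0 < r)%N.
Hypothesis betaE : forall v, v != bzero -> beta v = bs + pi ^+ r * y v.

Lemma dot_neq0 a v : dot a v -> a != bzero /\ v != bzero.
Proof. by case: a => [[[] []] []]; case: v => [[[] []] []]. Qed.

Lemma normalized a : a != bzero -> exists va w' f' h', [/\ dot a va, kummer a w' f' h',
  ev (beta va) f' = 0, ev (beta va) h' = 0 &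
  radicand f' h' = U a * \prod_(v | dot a v) (X - C (beta v))].
Proof.
move=> a0; have [va ava] := dot_exists a0; have [_ va0] := dot_neq0 ava.
have bva := beta0 va0.
have [|w' [f' [h' [K' fb hb E]]]] := @kummer_normalize a _ _ _ (beta va) (K a0) bva.
  rewrite split_radicand // (evM dvr res bva) (bigD1 va) //= (evM dvr res bva).
  by rewrite (ev_linear dvr res bva) subrr mul0r mulr0.
by exists va, w', f', h'; split=> //; rewrite E split_radicand.
Qed.

(* Evaluating [F / (T - b)] at the root [b] of [F = f ^+ 2 + 4 h]. *)
Lemma four_divisible : exists theta, 4%:R = pi ^+ (3 * r) * theta :> R.
Proof.
pose a : bool3 := (true, false, false); have a0 : a != bzero by [].
have [va [w' [f' [h' [ava K' fb hb E]]]]] := normalized a0.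
have [_ va0] := dot_neq0 ava; have bva := beta0 va0.
have [f1 f1E] := (ev_dvd dvr res bva f').2 fb.
have [h1 h1E] := (ev_dvd dvr res bva h').2 hb.
set L := X - C (beta va) in f1E h1E.
have E1 : L * f1 ^+ 2 + 4%:R * h1 = U a * \prod_(v | dot a v && (v != va)) (X - C (beta v)).
  apply: (mulfI (linear_neq0 (beta va))); rewrite [RHS]mulrCA -[X - _]/L.
  have -> : L * \prod_(v | dot a v && (v != va)) (X - C (beta v)) =
    \prod_(v | dot a v) (X - C (beta v)) by rewrite [RHS](bigD1 va).
  by rewrite -E /radicand f1E h1E; ring.
have h1u : ev (beta va) h1 \is a GRing.unit.
  rewrite (unit_red dvr res) (red_ev dvr res bva); have := kummer_h1 K'.
  by rewrite h1E mred_linear_coef.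
have := congr1 (ev (beta va)) E1.
rewrite (evD dvr res bva) !(evM dvr res bva) (ev_linear dvr res bva) subrr mul0r add0r.
rewrite -(rmorph_nat (@powserC R)) (evC dvr res bva) (big_morph _ (evM dvr res bva) (ev1 dvr res bva)).
have -> : \prod_(v | dot a v && (v != va)) ev (beta va) (X - C (beta v)) =
    \prod_(v | dot a v && (v != va)) (pi ^+ r * (y va - y v)).
  apply: eq_bigr => v /andP[av _]; have [_ v0] := dot_neq0 av.
  by rewrite (ev_linear dvr res bva) !betaE //; ring.
rewrite big_split /= prodr_const (card_dot a0 ava).2 -exprM mulnC => E2.
exists (ev (beta va) (U a) * \prod_(v | dot a v && (v != va)) (y va - y v)
  / ev (beta va) h1).
by apply: (mulIr h1u); rewrite mulrA divrK // E2; ring.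
Qed.

Section Rescaling.
Variable theta : R.
Hypothesis thetaE : 4%:R = pi ^+ (3 * r) * theta.
Variables (g : bool3) (Phi : {rmorphism powser R -> powser R}).
Hypothesis g0 : g != bzero.
Hypothesis PhiC : forall c, Phi (C c) = C c.
Hypothesis PhiX : Phi X = C (pi ^+ r) * X + C (beta g).
Hypothesis PhiR : forall e, mred (Phi e) = powserC (red (pcoef e 0%N)).

Definition reduced v : k := red (y v) - red (y g).
(** The radicand after T = beta g + pi ^ r X, divided by pi ^ (4 r). *)
Definition rescaled a := Phi (U a) * \prod_(v | dot a v) (X - C (y v - y g)).

Lemma Phi_linear v : v != bzero ->
  Phi (X - C (beta v)) = C (pi ^+ r) * (X - C (y v - y g)).
Proof.
move=> v0; by rewrite rmorphB PhiC PhiX !betaE // !(rmorphD, rmorphN, rmorphM); ring.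
Qed.

Lemma mred_linear_y v : mred (X - C (y v - y g)) = powserX k - powserC (reduced v).
Proof.
have -> : reduced v = red (y v - y g) by rewrite /reduced rmorphB.
by rewrite rmorphB /= map_powserX map_powserC.
Qed.

Lemma rescaled_mred a : a != bzero -> exists2 c, c != 0 &
  mred (rescaled a) = powserC c * \prod_(v <- all_bool3 | dot a v) (powserX k - powserC (reduced v)).
Proof.
move=> a0; exists (red (pcoef (U a) 0%N)).
  by rewrite -(unit_red dvr res) -powser_unit Uunit.
rewrite /rescaled rmorphM rmorph_prod /= PhiR; congr (_ * _).
by rewrite (perm_big _ perm_all_bool3); apply: eq_bigr => v _; apply: mred_linear_y.
Qed.

(** The root of h' turns into [pi ^+ r] times a linear factor while its cofactor reduces to the
    constant [c], so [eta] reduces to a linear polynomial of slope [c]. Then pi ^ (4 r) divides the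
    square of [Phi f'], and [psqrt] extracts [phi]. *)
Lemma local_data a : a != bzero -> exists w' f' h' phi eta c,
  [/\ kummer a w' f' h' /\ c != 0, Phi f' = C pi ^+ (2 * r) * phi, Phi h' = C pi ^+ r * eta,
      phi ^+ 2 + C theta * eta = rescaled a &
      psderiv (mred eta) = powserC c /\ pcoef (mred eta) 3 = 0].
Proof.
move=> a0; have [va [w' [f' [h' [ava K' fb hb E]]]]] := normalized a0.
have [_ va0] := dot_neq0 ava; have bva := beta0 va0.
have [h1 h1E] := (ev_dvd dvr res bva h').2 hb.
pose eta := (X - C (y va - y g)) * Phi h1; pose c := red (pcoef h1 0%N).
have etaE : Phi h' = C pi ^+ r * eta.
  by rewrite h1E rmorphM Phi_linear // rmorphXn /eta mulrA.
have FE : Phi (radicand f' h') = C pi ^+ (4 * r) * rescaled a.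
  rewrite E rmorphM rmorph_prod /rescaled mulrCA; congr (_ * _).
  have -> : \prod_(v | dot a v) Phi (X - C (beta v)) =
      \prod_(v | dot a v) (C (pi ^+ r) * (X - C (y v - y g))).
    by apply: eq_bigr => v /dot_neq0[_ v0]; apply: Phi_linear.
  by rewrite big_split /= prodr_const (card_dot a0 ava).1 rmorphXn -exprM mulnC.
have four : 4%:R = C pi ^+ (3 * r) * C theta.
  by rewrite -rmorphXn -rmorphM -thetaE rmorph_nat.
have [phi phiE] : exists phi, Phi f' = C pi ^+ (2 * r) * phi.
  apply: (@psqrt _ _ _ _ dvr res _ _ (rescaled a - C theta * eta)).
  have -> : (2 * r + 2 * r = 4 * r)%N by lia.
  rewrite mulrBr -FE /radicand rmorphD rmorphXn rmorphM rmorph_nat etaE four.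
  have -> : (4 * r = 3 * r + r)%N by lia.
  by rewrite exprD; ring.
exists w', f', h', phi, eta, c; split=> //.
- split=> //; have := kummer_h1 K'.
  by rewrite h1E mred_linear_coef.
- apply: (@pi_cancel _ _ dvr (4 * r)); rewrite -FE /radicand rmorphD rmorphXn rmorphM.
  rewrite rmorph_nat etaE phiE four.
  have -> : (4 * r = 2 * r + 2 * r)%N by lia.
  have e4 : C pi ^+ (2 * r + 2 * r) = C pi ^+ (3 * r) * C pi ^+ r :> powser R.
    by rewrite -exprD; congr (_ ^+ _); lia.
  by rewrite mulrDr {2}e4 exprD; ring.
- have -> : mred eta = powserC c * (powserX k - powserC (reduced va)).
    by rewrite /eta rmorphM /= mred_linear_y PhiR mulrC.
  split; last by rewrite pcoefMC pcoefB /= subrr mulr0.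
  rewrite psderivM psderivC mul0r add0r.
  have -> : psderiv (powserX k - powserC (reduced va)) = 1.
    by rewrite -rmorphN psderivD psderivX psderivC addr0.
  by rewrite mulr1.
Qed.

(** A square in characteristic 2 has no odd terms and [eta] is linear modulo [pi], so the
    coefficient of X ^ 3 vanishes; in the product it is a nonzero multiple of the sum of the
    roots. *)
Lemma reduced_sum a : a != bzero -> \sum_(v <- all_bool3 | dot a v) reduced v = 0.
Proof.
move=> a0; have [w' [f' [h' [phi [eta [c [_ _ _ E [_ eta3]]]]]]]] := local_data a0.
have [e e0 eE] := rescaled_mred a0.
have sz : size [seq v <- all_bool3 | dot a v] = 4 by case: a a0 {E e eE e0} => [[[] []] []].
have := congr1 (fun z => pcoef (mred z) 3) E.
rewrite eE pcoefMC -big_filter (cubic_coefficient _ sz) big_filter.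
have -> : mred (phi ^+ 2 + C theta * eta) = mred phi ^+ 2 + powserC (red theta) * mred eta.
  by rewrite rmorphD rmorphXn rmorphM /= map_powserC.
rewrite pcoefD pcoefMC eta3 mulr0 addr0.
rewrite (square_coef3 char2) => /esym/eqP.
by rewrite mulf_eq0 (negPf e0) oppr_eq0 => /eqP.
Qed.

(** Rescaling [kummer_product] presents N as in [artin_schreier_valuation]. Differentiating N modulo
    [pi] sees only the [eta]s, because theta is constant and the [phi]s enter as squares. *)
Lemma line_relation a1 a2 : a1 != bzero -> a2 != bzero -> a1 != a2 ->
  exists c1 c2 c3 : k, [/\ c1 != 0, c2 != 0, c3 != 0 &
  powserC c1 * mred (rescaled a2) * mred (rescaled (badd a1 a2)) +
  powserC c2 * mred (rescaled a1) * mred (rescaled (badd a1 a2)) +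
  powserC c3 * mred (rescaled a1) * mred (rescaled a2) = 0].
Proof.
move=> a10 a20 a12.
have a30 : badd a1 a2 != bzero.
  by move: a12 a10 a20; case: a1 => [[[] []] []]; case: a2 => [[[] []] []].
have [w1 [f1 [h1 [p1 [e1 [c1 [[K1 c10] fE1 hE1 <- [d1 _]]]]]]]] := local_data a10.
have [w2 [f2 [h2 [p2 [e2 [c2 [[K2 c20] fE2 hE2 <- [d2 _]]]]]]]] := local_data a20.
have [w3 [f3 [h3 [p3 [e3 [c3 [[K3 c30] fE3 hE3 <- [d3 _]]]]]]]] := local_data a30.
exists c1, c2, c3; split=> //.
have [z zE] := kummer_product K1 K2 K3.
pose N := e1 * p2 ^+ 2 * p3 ^+ 2 + p1 ^+ 2 * e2 * p3 ^+ 2 + p1 ^+ 2 * p2 ^+ 2 * e3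
  + C theta * (e1 * e2 * p3 ^+ 2 + e1 * p2 ^+ 2 * e3 + p1 ^+ 2 * e2 * e3)
  + C theta ^+ 2 * (e1 * e2 * e3).
have four : 4%:R = (C pi ^+ r) ^+ 3 * C theta.
  by rewrite -exprM mulnC -rmorphXn -rmorphM -thetaE rmorph_nat.
have NE : Phi z ^+ 2 - C pi ^+ (6 * r) * (p1 * p2 * p3) * Phi z = C pi ^+ (9 * r) * N.
  have := congr1 Phi zE; rewrite (_ : 16%:R = 4%:R * 4%:R :> powser R); last by ring.
  rewrite !(rmorph_nat, rmorphD, rmorphN, rmorphXn, rmorphM).
  rewrite fE1 fE2 fE3 hE1 hE2 hE3 four !(mulnC _ r) !exprM => E.
  transitivity (Phi z ^+ 2 - (C pi ^+ r) ^+ 2 * p1 * ((C pi ^+ r) ^+ 2 * p2) *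
     ((C pi ^+ r) ^+ 2 * p3) * Phi z); first by ring.
  by rewrite E /N; ring.
have := artin_schreier_valuation dvr res char2 r0 NE.
have mE p e : mred (p ^+ 2 + C theta * e) = mred p ^+ 2 + powserC (red theta) * mred e.
  by rewrite rmorphD rmorphXn rmorphM /= map_powserC.
have -> : mred N = trilinear (mred p1 ^+ 2) (mred p2 ^+ 2) (mred p3 ^+ 2)
    (mred e1) (mred e2) (mred e3) (powserC (red theta)).
  by rewrite /N /trilinear !(rmorphD, rmorphXn, rmorphM) /= map_powserC.
rewrite trilinear_deriv ?(psderiv_square char2) ?psderivC // d1 d2 d3 => <-.
by rewrite !mE.
Qed.

(** A strictly largest multiplicity at a1 would give the term P_2 P_3 of the line relation the
    strictly lowest order, with nothing to cancel it. *)
Lemma no_unique_max a1 a2 : a1 != bzero -> a2 != bzero -> a1 != a2 ->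
  let n c := affine_count (fun v => (v != bzero) && (red (y v) == red (y g))) c in
  ~~ ((n a2 < n a1)%N && (n (badd a1 a2) < n a1)%N).
Proof.
move=> a10 a20 a12 /=.
pose n c := affine_count (fun v => (v != bzero) && (red (y v) == red (y g))) c.
rewrite -!/(n _); apply/negP => /andP[n21 n31].
have a30 : badd a1 a2 != bzero.
  by move: a12 a10 a20; case: a1 {n21 n31} => [[[] []] []]; case: a2 => [[[] []] []].
have nE a : n a = affine_count (fun v => reduced v == 0) a.
  apply: eq_count => v; case av: (dot a v) => //=.
  by rewrite (dot_neq0 av).2 /reduced subr_eq0.
have form a : a != bzero -> exists2 u : powser k, u \is a GRing.unit &
    mred (rescaled a) = powserX k ^+ n a * u.
  move=> a0; have [c c0 ->] := rescaled_mred a0.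
  have [u uu ->] := order_count reduced a; rewrite -nE.
  exists (powserC c * u); last by rewrite mulrCA.
  by rewrite unitrM uu andbT powser_unit unitfE.
have [c1 [c2 [c3 [c10 _ _]]]] := line_relation a10 a20 a12.
have [u1 u1u ->] := form _ a10; have [u2 u2u ->] := form _ a20.
have [u3 u3u ->] := form _ a30.
set n1 := n a1 in n21 n31 *; set n2 := n a2 in n21 *; set n3 := n (badd a1 a2) in n31 *.
move=> E; have : ps_ge (n2 + n3).+1 (powserX k ^+ (n2 + n3) * (powserC c1 * (u2 * u3))).
  have -> : powserX k ^+ (n2 + n3) * (powserC c1 * (u2 * u3)) =
      - (powserX k ^+ (n1 + n3) * (powserC c2 * u1 * u3)
         + powserX k ^+ (n1 + n2) * (powserC c3 * u1 * u2)).
    by apply/eqP; rewrite -addr_eq0 -E !exprD; apply/eqP; ring.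
  apply: ps_geN; apply: ps_geD.
    apply: (@ps_ge_leq _ _ (n1 + n3)); last exact: ps_ge_X.
    by rewrite -addSn leq_add2r.
  apply: (@ps_ge_leq _ _ (n1 + n2)); last exact: ps_ge_X.
  by rewrite -addnS addnC leq_add2r.
move/ps_ge_unit; rewrite !unitrM u2u u3u powser_unit /= unitfE c10 => /(_ isT).
by rewrite ltnn.
Qed.

(** The shift by the residue of [y g] occurs four times and drops out in characteristic 2. *)
Lemma residue_sum a : a != bzero -> \sum_(v <- all_bool3 | dot a v) red (y v) = 0.
Proof.
move=> a0; have := reduced_sum a0; rewrite /reduced sumrB big_const_seq.
have -> : count (dot a) all_bool3 = 4 by case: a a0 => [[[] []] []].
have -> : iter 4 (+%R (red (y g))) 0 = 2%:R * (red (y g) + red (y g)) by rewrite /=; ring.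
by rewrite (pcharf0 char2) mul0r subr0.
Qed.
End Rescaling.

Lemma residues_equal u v z : u != bzero -> v != bzero -> u != v ->
  red (y u) = red (y v) -> z != bzero -> red (y z) = red (y u).
Proof.
have rho0 : red (pi ^+ r) = 0 by rewrite rmorphXn (red_pi res) expr0n eqn0Ngt r0.
have [theta thetaE] := four_divisible.
have Phi_ex g : g != bzero -> exists Phi : {rmorphism powser R -> powser R},
   [/\ forall c, Phi (C c) = C c, Phi X = C (pi ^+ r) * X + C (beta g) &
       forall e, mred (Phi e) = powserC (red (pcoef e 0%N))].
  move=> g0; have [Phi [P1 P2 P3]] := substitution dvr res (beta0 g0) (pi ^+ r).
  by exists Phi; split=> // e; apply: P3.
move=> u0 v0 uv E z0.
apply: (@coincidence_propagates k (fun v => red (y v)) char2 _ _ u v u0 v0 uv E z z0).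
  move=> g a b g0 a0 b0 ab; have [Phi [P1 P2 P3]] := Phi_ex g g0.
  exact: (no_unique_max thetaE g0 P1 P2 P3 a0 b0 ab).
have [Phi [P1 P2 P3]] := Phi_ex u u0 => a.
exact: (residue_sum thetaE u0 P1 P2 P3).
Qed.
End Scale.

Hypothesis beta_inj : forall u v, u != bzero -> v != bzero -> beta u = beta v -> u = v.

(** The least valuation [r] is attained by a pair with distinct residues. One coincidence of
    residues would spread to all seven points and contradict that pair. *)
Lemma equidistant : exists r, forall u v, u != bzero -> v != bzero -> u != v ->
  exists x, x \is a GRing.unit /\ beta u - beta v = x * pi ^+ r.
Proof.
pose P n := `[< exists u v x, [/\ u != bzero, v != bzero, u != v, x \is a GRing.unit &
  beta u - beta v = x * pi ^+ n] >].
have dist u v : u != bzero -> v != bzero -> u != v ->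
    exists n x, x \is a GRing.unit /\ beta u - beta v = x * pi ^+ n.
  move=> u0 v0 uv; have [|x [n xn]] := @dvr_factor _ _ dvr (beta u - beta v).
    by rewrite subr_eq0; apply: contra uv => /eqP/beta_inj->.
  by exists n, x.
have exP : exists n, P n.
  have [n [x [xu E]]] := dist (true, false, false) (false, true, false) isT isT isT.
  by exists n; apply/asboolP; exists (true, false, false), (false, true, false), x.
case: (ex_minnP exP) => r /asboolP[u0 [v0 [x0 [u00 v00 uv0 x0u x0E]]]] rmin.
exists r; pose bs := beta u0.
have yex v : exists y, v != bzero -> beta v = bs + pi ^+ r * y.
  have [->|v0'] := eqVneq v bzero; first by exists 0.
  have [->|vu] := eqVneq v u0; first by exists 0; rewrite mulr0 addr0.
  have [n [x [xu E]]] := dist v u0 v0' u00 vu.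
  have rn : (r <= n)%N by apply: rmin; apply/asboolP; exists v, u0, x.
  exists (pi ^+ (n - r) * x) => _.
  by rewrite mulrA -exprD subnKC // mulrC -E /bs addrC subrK.
have [y yE] := choice yex.
have pi0 := pi_neq0 dvr.
have diff u v : u != bzero -> v != bzero -> beta u - beta v = (y u - y v) * pi ^+ r.
  by move=> u1 v1; rewrite !yE //; ring.
(* All branch points have residue 0, so no difference is a unit. *)
have r0 : (0 < r)%N.
  rewrite lt0n; apply/eqP => r0; rewrite r0 mulr1 in x0E.
  move: x0u; rewrite -x0E (unit_red dvr res) rmorphB !beta0 //.
  by rewrite subrr eqxx.
move=> u v u1 v1 uv; exists (y u - y v); split; last exact: diff.
rewrite (unit_red dvr res) rmorphB subr_eq0; apply/eqP => E.
have := residues_equal r0 yE u1 v1 uv E => all_eq.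
move: x0u; have -> : x0 = y u0 - y v0.
  by apply: (mulIf (expf_neq0 r pi0)); rewrite -x0E diff.
by rewrite (unit_red dvr res) rmorphB !all_eq // subrr eqxx.
Qed.
End Equidistance.

(** * Branch partition *)

Lemma dvr_val_unit (R : idomainType) (pi x : R) n : is_dvr pi ->
  x \is a GRing.unit -> dvr_val pi (x * pi ^+ n) = n.
Proof.
move=> [pi0 piu _] xu; rewrite /dvr_val; case: xgetP => [m _ [x' [x'u E]]|/(_ n) []]; last by exists x.
have main i j (a b : R) : a \is a GRing.unit -> b * pi ^+ j = a * pi ^+ i -> (i < j)%N -> False.
  move=> au Eij ij; move/negP: piu; apply.
  have : pi ^+ i * (pi ^+ (j - i) * b) = pi ^+ i * a.
    by rewrite mulrA -exprD subnKC ?(ltnW ij) // mulrC Eij mulrC.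
  move/(mulfI (expf_neq0 i pi0)) => abE; move: au; rewrite -abE unitrM => /andP[+ _].
  by rewrite unitrX_pos // subn_gt0.
have [nm|mn|//] := ltngtP n m.
- by case: (main n m x x' xu (esym E) nm).
- by case: (main m n x' x x'u E mn).
Qed.

Section Configuration.
Variables (R : idomainType) (pi : R) (B : set R) (bl : seq R) (r : nat).
Hypothesis uniq_bl : uniq bl.
Hypothesis size_bl : size bl = 7%N.
Hypothesis B_bl : forall b, B b <-> b \in bl.
Hypothesis dist : forall b b', b \in bl -> b' \in bl -> b <> b' -> dvr_val pi (b - b') = r.

Lemma configuration_equidistant : equidistant_geometry pi B.
Proof.
by move=> b1 b2 b3 b4 /B_bl h1 /B_bl h2 /B_bl h3 /B_bl h4 n12 n34; rewrite !dist.
Qed.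

Lemma configuration_card : (B #= `I_7)%card.
Proof.
apply/card_set_bijP; exists (fun b => index b bl); split.
- by move=> b /B_bl bB; rewrite /= -size_bl index_mem.
- move=> b b' /set_mem/B_bl bB /set_mem/B_bl b'B /(congr1 (nth 0 bl)).
  by rewrite !nth_index.
- move=> i /= i7; exists (nth 0 bl i); first by apply/B_bl; rewrite mem_nth ?size_bl.
  by rewrite index_uniq ?size_bl.
Qed.

Lemma configuration_partition e : branch_partition pi B e <-> e = [:: 1; 1; 1; 1; 1; 1; 1]%N.
Proof.
split=> [[mu [cls [[[b1 [b2 [/B_bl h1 /B_bl h2 n12 <-]]] _] [ucls ncls] Bcls same ->]]]|->].
  rewrite dist // in same.
  (* Two points in one class would lie at a valuation above the minimum [r], but every difference
     has valuation [r]. *)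
  have single c : c \in cls -> size c = 1%N.
    move=> cc; case: c cc => [|b [|b' c]] cc //; first by rewrite cc in ncls.
    have inB x : x \in b :: b' :: c -> x \in bl.
      by move=> xc; apply/B_bl/Bcls; apply/flattenP; exists (b :: b' :: c).
    have bc : b \in b :: b' :: c by rewrite mem_head.
    have b'c : b' \in b :: b' :: c by rewrite inE mem_head orbT.
    have uc : uniq (b :: b' :: c).
      have [i il <-] := nthP [::] cc.
      by move: ucls {same Bcls ncls}; elim: cls i il {cc} => // d cls IH [|i] /= il;
        rewrite cat_uniq => /and3P[ud _ ucl] //; apply: IH.
    have bb' : b <> b' by move=> E; move: uc; rewrite /= E inE eqxx.
    have [/(_ b'c) sb _] := same _ b b' cc bc ((B_bl b').2 (inB _ b'c)).
    by case: sb => [/bb'//|]; rewrite dist ?inB // ltnn.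
  have szf : size (flatten cls) = 7%N.
    rewrite -size_bl; apply/perm_size/uniq_perm => // b.
    by apply/idP/idP => [/Bcls/B_bl|/B_bl/Bcls].
  have sizes : map size cls = nseq (size cls) 1%N.
    rewrite -[size cls](size_map size); apply/all_pred1P/allP => _ /mapP[c /single sc ->].
    by rewrite /= sc.
  suff -> : map size cls = nseq 7 1%N by [].
  by rewrite sizes -szf size_flatten /shape sizes sumn_nseq mul1n.
exists r, [seq [:: b] | b <- bl].
have flat : flatten [seq [:: b] | b <- bl] = bl by elim: bl => //= b l ->.
have [b1 [b2 [h1 h2 n12]]] : exists b1 b2, [/\ b1 \in bl, b2 \in bl & b1 <> b2].
  exists (nth 0 bl 0), (nth 0 bl 1); rewrite !mem_nth ?size_bl //; split=> //.
  by apply/eqP; rewrite nth_uniq ?size_bl.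
rewrite flat; split=> //.
- split; first by exists b1, b2; split; rewrite ?dist //; apply/B_bl.
  by move=> b b' /B_bl hb /B_bl hb' n; rewrite dist.
- by split=> //; apply/negP => /mapP[].
- move=> c b b' /mapP[d dbl ->]; rewrite !inE => /eqP-> /B_bl b'l; split.
    by move/eqP->; left.
  case=> [->//|]; have [->//|/eqP n] := eqVneq d b'.
  by rewrite dist // ltnn.
- rewrite -map_comp; move: size_bl; clear.
  by move: bl => [|? [|? [|? [|? [|? [|? [|? [|]]]]]]]].
Qed.
End Configuration.

Theorem proposition5p6
  (k : closedFieldType) (char2 : 2%N \in [pchar k])
  (gT : finGroupType)
  (hG : (2%N.-abelem [set: gT])%g /\ #|[set: gT]| = 8%N)
  (* the (Z/2)^3-cover k[[z]]/k[[t]] of type (4,4,4) *)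
  (iotak : {rmorphism powser k -> powser k})
  (rhok : gT -> {rmorphism powser k -> powser k})
  (hcover : is_Galois_cover iotak rhok)
  (htype : has_type iotak rhok 4 4 4)
  (* the complete discrete valuation ring R, finite over W = W(k) *)
  (W R : idomainType)
  (redW : {rmorphism W -> k}) (j : {rmorphism W -> R})
  (pi : R) (red : {rmorphism R -> k})
  (hR : is_coefficient_ring 2 redW j pi red)
  (* the lift R[[Z]]/R[[T]] *)
  (iota : {rmorphism powser R -> powser R})
  (rho : gT -> {rmorphism powser R -> powser R})
  (hlift : is_lift red iotak rhok iota rho)
  (hrat : branch_points_rational pi iota) :
  let B := branch_locus pi iota in
  [/\ forall e : seq nat,
        branch_partition pi B e <-> e = [:: 1; 1; 1; 1; 1; 1; 1]%N,
      (B #= `I_7)%card &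
      equidistant_geometry pi B].
Proof.
case: hG => abG cardG; case: hR => hW dvr res [jinj _] _.
(* In W the element 2 is a uniformizer, hence nonzero, and W embeds in R. *)
have two_neq0 : (2%:R : R) != 0.
  case: hW => -[[W2 _ _] _] _; apply: contra W2 => /eqP E.
  by apply/eqP/jinj; rewrite rmorph_nat E rmorph0.
have [chi [XX [e [bij_chi chiM XX_as e_neq0]]]] := type_data char2 abG cardG hcover htype.
have [gam chiK gamK] := bij_chi.
have gamD u v : gam (badd u v) = (gam u * gam v)%g.
  by apply: (can_inj chiK); rewrite chiM !gamK.
have gam0 : gam bzero = 1%g.
  by apply: (can_inj chiK); rewrite gamK -(mulg1 1%g) chiM baddvv.
(* Both covers are indexed by the same coordinates [gam], so reduction commutes with the two
   actions. *)
have action (S : comNzRingType) io (ro : gT -> {rmorphism powser S -> powser S}) :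
    is_Galois_cover io ro -> is_bool3_action io (fun v => ro (gam v)).
  move=> [[inj [r1 rM] _ fixed] ioC]; split=> // [x|u v x|x].
  - by rewrite gam0 r1.
  - by rewrite gamD rM.
  - rewrite -fixed; split=> h v; last exact: h.
    by rewrite -(chiK v); apply: h.
have [lcover red_iota red_rho] := hlift.
have actk := action _ _ _ hcover; have act := action _ _ _ lcover.
have faithful v : v != bzero -> exists y, rhok (gam v) y != y.
  move=> v0; apply: contrapT => /forallNP hv; case/eqP: v0.
  have [[_ _ faith _] _] := hcover.
  have : gam v = 1%g by apply: faith => y; apply/eqP/negPn/negP/hv.
  by move/(congr1 chi); rewrite gamK -(mulg1 1%g) chiM baddvv.
have XXeq a := (XX_as a).1.
have XXact a v : rhok (gam v) (XX a) = XX a + (if dot a v then iotak (powserX k) ^+ 2 else 0).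
  by rewrite (XX_as a).2 gamK.
(* The trivial character receives a dummy triple, so that [choice] applies to a total relation. *)
have kex a : exists wfh : powser R * powser R * powser R, a != bzero ->
    kummer red iota (fun v => rho (gam v)) a wfh.1.1 wfh.1.2 wfh.2.
  have [->|a0] := eqVneq a bzero; first by exists (0, 0, 0).
  have [w [f [h K]]] := kummer_exists res char2 act actk faithful red_iota
    (fun v => red_rho (gam v)) XXeq XXact e_neq0 a0.
  by exists (w, f, h).
have [wfh K] := choice kex.
have [beta [U [beta0 beta_inj betaP Uu rad]]] :=
  branch_points dvr res char2 two_neq0 act actk red_iota hrat K.
have [r distr] := equidistant dvr res char2 two_neq0 act beta0 K Uu rad beta_inj.
pose nz := [seq v <- all_bool3 | v != bzero]; pose bl := map beta nz.
have nzE v : (v \in nz) = (v != bzero) by rewrite mem_filter mem_all_bool3 andbT.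
have ubl : uniq bl.
  rewrite map_inj_in_uniq // => u v; rewrite !nzE; exact: beta_inj.
have Bbl b : branch_locus pi iota b <-> b \in bl.
  rewrite betaP; split=> [[v v0 ->]|/mapP[v + ->]].
    by apply: map_f; rewrite nzE.
  by rewrite nzE; exists v.
have dist b b' : b \in bl -> b' \in bl -> b <> b' -> dvr_val pi (b - b') = r.
  move=> /mapP[u + ->] /mapP[v + ->]; rewrite !nzE => u0 v0 uv.
  have [|x [xu ->]] := distr u v u0 v0; first by apply/eqP => E; rewrite E in uv.
  by apply: dvr_val_unit => //; case: dvr.
split.
- by move=> e'; apply: (configuration_partition ubl _ Bbl dist).
- by apply: (configuration_card ubl _ Bbl).
- exact: (configuration_equidistant Bbl dist).
Qed.
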